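(* The unambiguity problem for (Büchi-)recognizable languages of infinite pictures is $\Pi_2^1$-complete, i.e. the set $$\{ z \in \mathbb{N} \mid L^B(\mathcal{T}_z) \text{ is unambiguous (non ambiguous)} \}$$ is $\Pi_2^1$-complete.
   Context: **Infinite pictures.** Let $\Sigma$ be a finite alphabet, $\#\notin\Sigma$ and $\hat{\Sigma}=\Sigma\cup\{\#\}$. An $\omega$-picture (infinite picture) over $\Sigma$ is a function $p:\omega\times\omega\to\hat{\Sigma}$ with $p(i,0)=p(0,i)=\#$ for all $i\ge 0$ and $p(i,j)\in\Sigma$ for all $i,j>0$. $\Sigma^{\omega,\omega}$ is the set of $\omega$-pictures over $\Sigma$. **Tiling systems.** A tiling system is a tuple $\mathcal{A}=(Q,\Sigma,\Delta)$ with $Q$ a finite set of states, $\Sigma$ a finite alphabet, and $\Delta\subseteq(\hat{\Sigma}\times Q)^4$ a finite set of tiles. A Büchi tiling system is a pair $(\mathcal{A},F)$ with $F\subseteq Q$. A run of $\mathcal{A}$ on $p\in\Sigma^{\omega,\omega}$ is a map $\rho:\omega\times\omega\to Q$ such that for all $(i,j)\in\omega\times\omega$ the tile $$\begin{pmatrix}(p(i,j+1),\rho(i,j+1)) & (p(i+1,j+1),\rho(i+1,j+1))\\ (p(i,j),\rho(i,j)) & (p(i+1,j),\rho(i+1,j))\end{pmatrix}$$ belongs to $\Delta$. The run is accepting if $\rho(v)\in F$ for infinitely many $v\in\omega^2$. $L^B((\mathcal{A},F))$ is the set of $p\in\Sigma^{\omega,\omega}$ having an accepting run; languages of this form are called Büchi-recognizable.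 **Unambiguity.** $(\mathcal{A},F)$ is unambiguous if every $p\in\Sigma^{\omega,\omega}$ has at most one accepting run. A Büchi-recognizable language $L\subseteq\Sigma^{\omega,\omega}$ is unambiguous if $L=L^B((\mathcal{A},F))$ for some unambiguous Büchi tiling system $(\mathcal{A},F)$; otherwise it is inherently ambiguous. **Indexing.** $\Sigma=\{a,b\}$ and $\mathcal{T}_z$ denotes the (non deterministic) Büchi tiling system of index $z\in\mathbb{N}$ over $\{a,b\}$, in a fixed effective enumeration of all Büchi tiling systems over $\{a,b\}$. **Completeness.** $\Sigma^1_n,\Pi^1_n$ are the (lightface) levels of the analytical hierarchy of subsets of $\mathbb{N}$. For $A,B\subseteq\mathbb{N}$, $A\le_1 B$ means that there is a total computable injective $f:\mathbb{N}\to\mathbb{N}$ with $A=f^{-1}[B]$. A set $A\subseteq\mathbb{N}$ is $\Pi^1_n$-complete if $A$ is $\Pi^1_n$ and $B\le_1 A$ for every $\Pi^1_n$-set $B\subseteq\mathbb{N}$. *)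

(* Defs.v *)
From HB Require Import structures.
From mathcomp Require Import all_boot.
From mathcomp Require Import boolp classical_sets cardinality.

Set Implicit Arguments.
Unset Strict Implicit.
Unset Printing Implicit Defensive.

Local Open Scope classical_set_scope.

(* The padded alphabet is [option Sigma]; [None] is the border letter #. *)
Definition pictures (Sigma : finType) : set (nat * nat -> option Sigma) :=
  [set p | (forall i, p (i, 0) = None /\ p (0, i) = None) /\
           (forall i j, 0 < i -> 0 < j -> p (i, j) <> None)].

(* The components of a tile are, in order, its top left, top right, bottom
   left and bottom right cells. *)
Definition tile (Q Sigma : finType) : finType :=
  ((option Sigma * Q) * (option Sigma * Q) *
   (option Sigma * Q) * (option Sigma * Q))%type.

Record buchi_system (Q Sigma : finType) := BuchiSystem {
  tiles : {set tile Q Sigma};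
  final : {set Q}
}.

Definition is_run (Q Sigma : finType) (A : buchi_system Q Sigma)
    (p : nat * nat -> option Sigma) (rho : nat * nat -> Q) : Prop :=
  forall i j : nat,
    ((p (i, j.+1), rho (i, j.+1)), (p (i.+1, j.+1), rho (i.+1, j.+1)),
     (p (i, j), rho (i, j)), (p (i.+1, j), rho (i.+1, j))) \in tiles A.

Definition accepting_runs (Q Sigma : finType) (A : buchi_system Q Sigma)
    (p : nat * nat -> option Sigma) : set (nat * nat -> Q) :=
  [set rho | is_run A p rho /\ infinite_set [set v | rho v \in final A]].

Definition buchi_language (Q Sigma : finType) (A : buchi_system Q Sigma) :
    set (nat * nat -> option Sigma) :=
  [set p | pictures p /\ accepting_runs A p !=set0].

Definition unambiguous_system (Q Sigma : finType)
    (A : buchi_system Q Sigma) : Prop :=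
  forall p, pictures p -> is_subset1 (accepting_runs A p).

Definition unambiguous_language (Sigma : finType)
    (L : set (nat * nat -> option Sigma)) : Prop :=
  exists (Q : finType) (A : buchi_system Q Sigma),
    L = buchi_language A /\ unambiguous_system A.

(* [recf m n]: descriptions of n-ary functions recursive in m function
   oracles. *)
Inductive recf (m : nat) : nat -> Type :=
| RZero n : recf m n
| RSucc : recf m 1
| RProj n (i : 'I_n) : recf m n
| ROracle (i : 'I_m) : recf m 1
| RComp k n (f : recf m k) (g : 'I_k -> recf m n) : recf m n
| RPrec n (f : recf m n) (g : recf m n.+2) : recf m n.+1
| RMin n (f : recf m n.+1) : recf m n.

Fixpoint prec_graph n (F : n.-tuple nat -> nat -> Prop)
    (G : n.+2.-tuple nat -> nat -> Prop) (v : n.-tuple nat) (k : nat) :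
    nat -> Prop :=
  if k is k'.+1 then
    fun y => exists2 z, prec_graph F G v k' z &
                        G [tuple of [:: k', z & v]] y
  else F v.

(* [rec_eval fs c v y]: the computation of [c] on the arguments [v] with the
   oracles [fs] converges to [y]. *)
Fixpoint rec_eval m (fs : m.-tuple (nat -> nat)) n (c : recf m n) :
    n.-tuple nat -> nat -> Prop :=
  match c in recf _ n0 return n0.-tuple nat -> nat -> Prop with
  | RZero _ => fun _ y => y = 0
  | RSucc => fun v y => y = (thead v).+1
  | RProj _ i => fun v y => y = tnth v i
  | ROracle i => fun v y => y = tnth fs i (thead v)
  | RComp k _ f g => fun v y =>
      exists2 w : k.-tuple nat,
        forall i, rec_eval fs (g i) v (tnth w i) & rec_eval fs f w y
  | RPrec n' f g => fun v y =>
      prec_graph (rec_eval fs f) (rec_eval fs g)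
        [tuple of behead v] (thead v) y
  | RMin _ f => fun v y =>
      rec_eval fs f [tuple of y :: v] 0 /\
      forall x, x < y -> exists z, rec_eval fs f [tuple of x :: v] z.+1
  end.

Definition computable (f : nat -> nat) : Prop :=
  exists c : recf 0 1, forall x, rec_eval [tuple] c [tuple x] (f x).

Definition relation (m n : nat) : Type :=
  m.-tuple (nat -> nat) -> n.-tuple nat -> Prop.

Definition recursive_relation m n (R : relation m n) : Prop :=
  exists c : recf m n, forall fs v,
    (R fs v -> rec_eval fs c v 1) /\ (~ R fs v -> rec_eval fs c v 0).

Variant quantifier := ExNum | AllNum | ExFun | AllFun.

(* [predicate_form pi R]: [R] is obtained by putting the quantifier prefix
   [pi] in front of a recursive relation. *)
Inductive predicate_form :
    seq quantifier -> forall m n, relation m n -> Prop :=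
| PFMatrix m n (R : relation m n) :
    recursive_relation R -> predicate_form [::] R
| PFExNum pi m n (R : relation m n.+1) : predicate_form pi R ->
    predicate_form (ExNum :: pi)
      (fun fs (v : n.-tuple nat) => exists x, R fs [tuple of x :: v])
| PFAllNum pi m n (R : relation m n.+1) : predicate_form pi R ->
    predicate_form (AllNum :: pi)
      (fun fs (v : n.-tuple nat) => forall x, R fs [tuple of x :: v])
| PFExFun pi m n (R : relation m.+1 n) : predicate_form pi R ->
    predicate_form (ExFun :: pi)
      (fun (fs : m.-tuple (nat -> nat)) v =>
         exists f, R [tuple of f :: fs] v)
| PFAllFun pi m n (R : relation m.+1 n) : predicate_form pi R ->
    predicate_form (AllFun :: pi)
      (fun (fs : m.-tuple (nat -> nat)) v =>
         forall f, R [tuple of f :: fs] v).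

(* The reduced prefix keeps the function quantifiers only; [true] stands for
   a universal one. *)
Definition reduced_prefix (pi : seq quantifier) : seq bool :=
  pmap (fun q => match q with
                 | ExFun => Some false
                 | AllFun => Some true
                 | _ => None
                 end) pi.

Definition alternations (s : seq bool) : nat :=
  if s is b :: s' then count id (pairmap addb b s') else 0.

Definition Pi1_prefix (n : nat) (pi : seq quantifier) : Prop :=
  let s := reduced_prefix pi in
  if n is k.+1 then ohead s = Some true /\ alternations s = k else s = [::].

Definition Pi1 (n : nat) (A : set nat) : Prop :=
  exists (pi : seq quantifier) (R : relation 0 1),
    [/\ Pi1_prefix n pi, predicate_form pi R &
        A = [set x | R [tuple] [tuple x]]].

Definition one_reducible (A B : set nat) : Prop :=
  exists f : nat -> nat, [/\ computable f, injective f & A = f @^-1` B].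

Definition Pi1_complete (n : nat) (A : set nat) : Prop :=
  Pi1 n A /\ forall B : set nat, Pi1 n B -> one_reducible B A.

(* The alphabet {a, b} is [bool].  Every finite set of states is, up to
   renaming, some ['I_n], so these are all the Buchi tiling systems over
   {a, b} as finite objects. *)
Definition numbered_system : Type := {n : nat & buchi_system 'I_n bool}.

Definition letter_code (x : option bool) : nat :=
  if x is Some b then (nat_of_bool b).+1 else 0.

Definition tile_code n (t : tile 'I_n bool) : nat :=
  let: ((s1, q1), (s2, q2), (s3, q3), (s4, q4)) := t in
  CodeSeq.code [:: letter_code s1; nat_of_ord q1; letter_code s2;
                   nat_of_ord q2; letter_code s3; nat_of_ord q3;
                   letter_code s4; nat_of_ord q4].

(* An injective Goedel numbering; finite sets are coded by their canonical
   index, the sum of the 2 ^ x for x a code of an element. *)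
Definition system_code (S : numbered_system) : nat :=
  let: existT n A := S in
  CodeSeq.code [:: n; \sum_(t in tiles A) 2 ^ tile_code t;
                   \sum_(q in final A) 2 ^ q].

Definition effective_enumeration (T : nat -> numbered_system) : Prop :=
  computable (fun z => system_code (T z)) /\ forall S, exists z, T z = S.

(* Main.v *)
(* Unambiguity of L(T_z) says that some system T', a finite object, has the same
   language and is unambiguous; these two facts are universal over pictures and
   runs, then existential over runs, so the set is Pi^1_2.

   For hardness, write a Pi^1_2 set B in the normal form
   forall f, exists g, forall k, M(g, f; k, x) with M recursive.  Evaluating M
   is done by a program on unary counters; a row of a run displays one
   configuration (location, counters, oracle bits), and local constraints
   between consecutive rows express one instruction.  So a tiling system can
   guess g and accept a picture coding f iff M(g, f; k, x) holds for all k.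
   The system S_x also accepts the pictures coding no f at all, and those whose
   second half lies in a Sigma^1_1 set D that is not bi-analytic.  If x is in B
   then S_x accepts every picture.  Otherwise the section of its language at a
   bad f is D; but an unambiguous language is an injective projection of a
   closed set, so by the Lusin-Souslin theorem its complement is analytic. *)

From HB Require Import structures.
Require Import Defs.
From mathcomp Require Import all_boot.
From mathcomp Require Import boolp classical_sets cardinality zify.

Set Implicit Arguments.
Unset Strict Implicit.
Unset Printing Implicit Defensive.

Local Open Scope classical_set_scope.

(** * Recursive functionals *)

(** Three obstacles shape the construction. A column of a diagram carries only finitely many bits,
    so both oracles of the program are sets. A guessed function is recovered from a set by a search
    that the program must also see halt. The input word is an arbitrary set, possibly not the graph
    of a function, hence acceptance when some argument has no value and a free choice of values
    otherwise. Next, Büchi acceptance is a G-delta condition, while the Lusin-Souslin argument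
    projects a closed set; a run is therefore coded together with the first final position from each
    number on, which makes the condition closed and keeps the code unique. Finally, the enumeration
    is an arbitrary surjection with computable codes, so the reduction searches for an index whose
    system has a prescribed code. This calls for a recursive and injective formula for the code of
    the tiling system. *)

Lemma prec_graph_det n (F : n.-tuple nat -> nat -> Prop)
    (G : n.+2.-tuple nat -> nat -> Prop) :
  (forall v y y', F v y -> F v y' -> y = y') ->
  (forall v y y', G v y -> G v y' -> y = y') ->
  forall v k y y', prec_graph F G v k y -> prec_graph F G v k y' -> y = y'.
Proof.
move=> hF hG v; elim=> [|k IH] y y' /=; first exact: hF.
by move=> [z hz h] [z' /(IH _ _ hz) <-]; apply: hG.
Qed.

Lemma rec_eval_det m (fs : m.-tuple (nat -> nat)) n (c : recf m n) v y y' :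
  rec_eval fs c v y -> rec_eval fs c v y' -> y = y'.
Proof.
elim: c v y y' => {n} [n|| n i|i|k n f IHf g IHg|n f IHf g IHg|n f IHf] v y y'
    //=; try by move=> -> ->.
- move=> [w hw hf] [w' hw' hf'].
  suff eqw : w = w' by rewrite -eqw in hf'; exact: IHf hf hf'.
  by apply: eq_from_tnth => i; apply: IHg (hw i) (hw' i).
- exact: prec_graph_det.
- move=> [h0 hlt] [h0' hlt']; case: (ltngtP y y') => // h.
    by have [z hz] := hlt' _ h; have := IHf _ _ _ h0 hz.
  by have [z hz] := hlt _ h; have := IHf _ _ _ h0' hz.
Qed.

(** One code serves all oracles and arguments, so totality and uniformity in the oracles are built
    in. *)
Definition recfun m n (F : m.-tuple (nat -> nat) -> n.-tuple nat -> nat) :=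
  exists c : recf m n, forall fs v, rec_eval fs c v (F fs v).

Lemma recfun_ext m n (F G : m.-tuple (nat -> nat) -> n.-tuple nat -> nat) :
  (forall fs v, F fs v = G fs v) -> recfun F -> recfun G.
Proof. by move=> h [c hc]; exists c => fs v; rewrite -h. Qed.

Lemma recursive_relationE m n (R : relation m n) :
  recursive_relation R <-> recfun (fun fs v => nat_of_bool `[< R fs v >]).
Proof.
split=> -[c hc]; exists c => fs v.
  by have [h1 h0] := hc fs v; case: asboolP.
by have := hc fs v; case: asboolP => h; split.
Qed.

Lemma recfun_tnth m n (i : 'I_n) :
  @recfun m n (fun fs v => tnth v i).
Proof. by exists (RProj m i). Qed.

Lemma recfun_nth m n k : k < n -> @recfun m n (fun fs v => nth 0 v k).
Proof.
move=> h; apply: (recfun_ext _ (recfun_tnth m (Ordinal h))) => fs v.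
by rewrite (tnth_nth 0).
Qed.

Lemma recfun_comp m n k (F : m.-tuple (nat -> nat) -> k.-tuple nat -> nat)
    (G : 'I_k -> m.-tuple (nat -> nat) -> n.-tuple nat -> nat) :
  recfun F -> (forall i, recfun (G i)) ->
  recfun (fun fs v => F fs [tuple G i fs v | i < k]).
Proof.
move=> [c hc] /choice [d hd]; exists (RComp c d) => fs v /=.
by exists [tuple G i fs v | i < k] => // i; rewrite tnth_mktuple.
Qed.

Lemma recfun_comp1 m n (f : nat -> nat)
    (F : m.-tuple (nat -> nat) -> n.-tuple nat -> nat) :
  @recfun m 1 (fun fs v => f (thead v)) -> recfun F ->
  recfun (fun fs v => f (F fs v)).
Proof.
move=> hf hF; apply: recfun_ext (recfun_comp hf (G := fun=> F) _) => // fs v.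
by rewrite /thead tnth_mktuple.
Qed.

Lemma recfun_succ m n (F : m.-tuple (nat -> nat) -> n.-tuple nat -> nat) :
  recfun F -> recfun (fun fs v => (F fs v).+1).
Proof. by apply: recfun_comp1; exists (RSucc m). Qed.

Lemma recfun_const m n k : @recfun m n (fun _ _ => k).
Proof. by elim: k => [|k]; [exists (RZero m n)|apply: recfun_succ]. Qed.

Lemma recfun_oracle m n k (F : m.-tuple (nat -> nat) -> n.-tuple nat -> nat) :
  k < m -> recfun F ->
  recfun (fun fs v => nth (fun=> 0) fs k (F fs v)).
Proof.
move=> h hF; have ho : @recfun m 1 (fun fs v => tnth fs (Ordinal h) (thead v)).
  by exists (ROracle (Ordinal h)).
apply: recfun_ext (recfun_comp ho (G := fun=> F) _) => // fs v.
by rewrite /thead tnth_mktuple (tnth_nth (fun=> 0)).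
Qed.

Definition primrec (b : nat) (s : nat -> nat -> nat) :=
  nat_rect (fun=> nat) b s.

Lemma recfun_primrec m n (B N : m.-tuple (nat -> nat) -> n.-tuple nat -> nat)
    (S : m.-tuple (nat -> nat) -> n.+2.-tuple nat -> nat) :
  recfun B -> recfun S -> recfun N ->
  recfun (fun fs v => primrec (B fs v)
    (fun k r => S fs [tuple of k :: r :: v]) (N fs v)).
Proof.
move=> [b hb] [s hs] hN.
have h : @recfun m n.+1 (fun fs v => primrec (B fs [tuple of behead v])
   (fun k r => S fs [tuple of k :: r :: [tuple of behead v]]) (thead v)).
  exists (RPrec b s) => fs v /=.
  elim: (thead v) => [|k IH] /=; first exact: hb.
  by eexists; [exact: IH|exact: hs].
(* [RPrec] recurses on its first argument, so the bound [N] is put in front of [v] by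
   composition. *)
pose G i := if unlift ord0 i is Some j then
  (fun (fs : m.-tuple (nat -> nat)) (v : n.-tuple nat) => tnth v j) else N.
have hG i : recfun (G i).
  by rewrite /G; case: unlift => // j; apply: recfun_tnth.
apply: recfun_ext (recfun_comp h hG) => fs v.
have -> : thead [tuple G i fs v | i < n.+1] = N fs v.
  by rewrite /thead tnth_mktuple /G unlift_none.
have -> // : [tuple of behead [tuple G i fs v | i < n.+1]] = v.
apply: eq_from_tnth => i; rewrite tnth_behead tnth_mktuple.
have -> : inord i.+1 = lift ord0 i.
  by apply: val_inj; rewrite /= inordK // ltnS.
by rewrite /G liftK.
Qed.

(* Substitution of the functions computed by [H i] for the oracles, with [p]
   parameters appended to the arguments. *)
Fixpoint rec_subst m m' p (H : 'I_m -> recf m' p.+1) n (c : recf m n) :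
    recf m' (n + p) :=
  match c in recf _ n0 return recf m' (n0 + p) with
  | RZero n => RZero m' (n + p)
  | RSucc => RComp (RSucc m') (fun=> RProj m' (lshift p ord0))
  | RProj n i => RProj m' (lshift p i)
  | ROracle i => H i
  | RComp k n f g =>
      RComp (rec_subst H f) (fun i => match split i with
        | inl j => rec_subst H (g j) | inr j => RProj m' (rshift n j) end)
  | RPrec n f g => @RPrec m' (n + p) (rec_subst H f) (rec_subst H g)
  | RMin n f => @RMin m' (n + p) (rec_subst H f)
  end.

(** Only convergence is transferred, which allows [H] to be total for some oracles [fs'] only;
    [rec_eval_det] gives the converse where it is wanted. *)
Lemma rec_subst_eval m m' p (H : 'I_m -> recf m' p.+1)
    (fs : m.-tuple (nat -> nat)) (fs' : m'.-tuple (nat -> nat))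
    (u : p.-tuple nat) n (c : recf m n) v y :
  (forall i x, rec_eval fs' (H i) [tuple of x :: u] (tnth fs i x)) ->
  rec_eval fs c v y -> rec_eval fs' (rec_subst H c) [tuple of v ++ u] y.
Proof.
move=> hH; elim: c v y => {n} [n|| n i|i|k n f IHf g IHg|n f IHf g IHg|n f IHf]
    v y /=.
- by [].
- move=> ->; exists [tuple thead v] => // i /=.
  by rewrite tnth_lshift ord1.
- by rewrite tnth_lshift.
- move=> ->; case/tupleP: v => x v; rewrite theadE (tuple0 v).
  have -> : [tuple of [tuple of x :: [tuple]] ++ u] = [tuple of x :: u].
    exact: val_inj.
  exact: hH.
- move=> [w hw hf]; exists [tuple of w ++ u]; last exact: IHf.
  move=> i; case: splitP => j hj.
    have -> : i = lshift p j by apply: val_inj.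
    by rewrite tnth_lshift; apply: IHg.
  have -> : i = rshift k j by apply: val_inj.
  by rewrite /= !tnth_rshift.
- have -> : thead [tuple of v ++ u] = thead v.
    by rewrite (tuple_eta v).
  have -> : [tuple of behead [tuple of v ++ u]] = [tuple of [tuple of behead v] ++ u].
    by apply: val_inj; rewrite /= {1}(tuple_eta v).
  elim: (thead v) y => [|k IH] y /=; first exact: IHf.
  move=> [z hz hy]; exists z; first exact: IH.
  have := IHg _ _ hy; congr rec_eval; exact: val_inj.
- have E x : [tuple of [tuple of x :: v] ++ u] = [tuple of x :: [tuple of v ++ u]].
    exact: val_inj.
  move=> [h0 hlt]; split=> [|x /hlt [z hz]].
    by have := IHf _ _ h0; congr rec_eval; exact: val_inj.
  by exists z; have := IHf _ _ hz; congr rec_eval; exact: val_inj.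
Qed.

(** The arguments [u] are passed along to every simulated oracle call, since the new oracles
    [hs fs u] may depend on them. *)
Lemma recfun_subst m n m' p
    (F : m.-tuple (nat -> nat) -> n.-tuple nat -> nat)
    (hs : m'.-tuple (nat -> nat) -> p.-tuple nat -> m.-tuple (nat -> nat))
    (ws : m'.-tuple (nat -> nat) -> p.-tuple nat -> n.-tuple nat) :
  recfun F ->
  (forall i, recfun (fun fs (v : p.+1.-tuple nat) =>
     tnth (hs fs [tuple of behead v]) i (thead v))) ->
  (forall j, recfun (fun fs u => tnth (ws fs u) j)) ->
  recfun (fun fs u => F (hs fs u) (ws fs u)).
Proof.
move=> [c hc] /choice [H hH] hw.
have hc' fs (u : p.-tuple nat) (v : n.-tuple nat) :
    rec_eval fs (rec_subst H c) [tuple of v ++ u] (F (hs fs u) v).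
  apply: rec_subst_eval (hc _ _) => i x.
  have := hH i fs [tuple of x :: u].
  have -> : [tuple of behead [tuple of x :: u]] = u by apply: val_inj.
  by rewrite theadE.
move/choice: hw => [d hd].
pose G i := match split i with inl j => d j | inr j => RProj m' j end.
exists (RComp (rec_subst H c) G) => fs u /=.
exists [tuple of ws fs u ++ u] => // i; rewrite /G.
case: splitP => j hj.
  have -> : i = lshift p j by apply: val_inj.
  by rewrite tnth_lshift; apply: hd.
have -> : i = rshift n j by apply: val_inj.
by rewrite /= tnth_rshift.
Qed.

(** * Closure of the recursive functionals under arithmetic and Boolean operations *)

Section Addition.
Variables m n : nat.
Implicit Types F G : m.-tuple (nat -> nat) -> n.-tuple nat -> nat.

Lemma recfun_prim F G (s : nat -> nat -> nat) :
  @recfun m n.+2 (fun _ w => s (nth 0 w 0) (nth 0 w 1)) -> recfun F ->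
  recfun G -> recfun (fun fs v => primrec (F fs v) s (G fs v)).
Proof. by move=> hs hF hG; apply: recfun_primrec hF hs hG. Qed.

Lemma recfun_add F G : recfun F -> recfun G ->
  recfun (fun fs v => F fs v + G fs v).
Proof.
move=> hF hG; apply: (recfun_ext _ (recfun_prim (s := fun _ r => r.+1) _ hF hG)).
  by move=> fs v; elim: (G fs v) => [|k /= ->]; rewrite ?addn0 ?addnS.
by apply: recfun_succ; apply: recfun_nth.
Qed.

Lemma recfun_pred F : recfun F -> recfun (fun fs v => (F fs v).-1).
Proof.
move=> hF.
apply: (recfun_ext _ (recfun_prim (s := fun k _ => k) _ (recfun_const m n 0) hF)).
  by move=> fs v; case: (F fs v).
exact: recfun_nth.
Qed.

End Addition.

Section Subtraction.
Variables m n : nat.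
Implicit Types F G : m.-tuple (nat -> nat) -> n.-tuple nat -> nat.

Lemma recfun_sub F G : recfun F -> recfun G ->
  recfun (fun fs v => F fs v - G fs v).
Proof.
move=> hF hG; apply: (recfun_ext _ (recfun_prim (s := fun _ r => r.-1) _ hF hG)).
  by move=> fs v; elim: (G fs v) => [|k /= ->]; rewrite ?subn0 ?subnS.
by apply: recfun_pred; apply: recfun_nth.
Qed.

Lemma recfun_mul F G : recfun F -> recfun G ->
  recfun (fun fs v => F fs v * G fs v).
Proof.
move=> hF hG; apply: recfun_ext (recfun_primrec (recfun_const m n 0) (S :=
  fun fs w => F fs [tuple of behead (behead w)] + nth 0 w 1) _ hG).
  move=> fs v /=; elim: (G fs v) => [|k /= ->]; rewrite ?muln0 ?mulnS //.
  by congr (F fs _ + _); apply: val_inj.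
apply: recfun_add; last exact: recfun_nth.
have := @recfun_comp m n.+2 n F (fun i fs w => nth 0 w i.+2) hF.
move/(_ (fun i => recfun_nth m (k := i.+2) (n := n.+2) (ltn_ord i))).
apply: recfun_ext => fs w; congr F; apply: eq_from_tnth => i.
by rewrite tnth_mktuple (tnth_nth 0) /= ?nth_behead.
Qed.

End Subtraction.

Section Predicates.
Variables m n : nat.
Implicit Types F G : m.-tuple (nat -> nat) -> n.-tuple nat -> nat.
Implicit Types P Q : m.-tuple (nat -> nat) -> n.-tuple nat -> bool.

Lemma recfun_leq F G : recfun F -> recfun G ->
  recfun (fun fs v => F fs v <= G fs v : nat).
Proof.
move=> hF hG; apply: (recfun_ext _ (recfun_sub (recfun_const m n 1)
  (recfun_sub hF hG))) => fs v.
by rewrite -subn_eq0; case: (F fs v - G fs v).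
Qed.

Lemma recfun_neg P : recfun (fun fs v => P fs v : nat) ->
  recfun (fun fs v => ~~ P fs v : nat).
Proof.
move=> hP; apply: (recfun_ext _ (recfun_sub (recfun_const m n 1) hP)) => fs v.
by case: (P fs v).
Qed.

Lemma recfun_and P Q : recfun (fun fs v => P fs v : nat) ->
  recfun (fun fs v => Q fs v : nat) ->
  recfun (fun fs v => P fs v && Q fs v : nat).
Proof.
move=> hP hQ; apply: (recfun_ext _ (recfun_mul hP hQ)) => fs v.
by case: (P fs v); case: (Q fs v).
Qed.

Lemma recfun_eq F G : recfun F -> recfun G ->
  recfun (fun fs v => F fs v == G fs v : nat).
Proof.
move=> hF hG.
apply: (recfun_ext _ (recfun_and (recfun_leq hF hG) (recfun_leq hG hF))) => fs v.
by rewrite eqn_leq.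
Qed.

Lemma recfun_if P F G : recfun (fun fs v => P fs v : nat) ->
  recfun F -> recfun G -> recfun (fun fs v => if P fs v then F fs v else G fs v).
Proof.
move=> hP hF hG; apply: (recfun_ext _ (recfun_add (recfun_mul hP hF)
  (recfun_mul (recfun_neg hP) hG))) => fs v.
by case: (P fs v); rewrite /= ?mul1n ?mul0n ?addn0.
Qed.

Lemma recfun_exp2 F : recfun F -> recfun (fun fs v => 2 ^ F fs v).
Proof.
move=> hF; apply: (recfun_ext _ (recfun_prim (s := fun _ r => r + r) _
  (recfun_const m n 1) hF)).
  by move=> fs v; elim: (F fs v) => [|k /= ->]; rewrite // expnS mul2n addnn.
by apply: recfun_add; apply: recfun_nth.
Qed.

Lemma recfun_odd F : recfun F -> recfun (fun fs v => odd (F fs v) : nat).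
Proof.
move=> hF; apply: (recfun_ext _ (recfun_prim (s := fun _ r => 1 - r) _
  (recfun_const m n 0) hF)).
  by move=> fs v; elim: (F fs v) => [|k /= ->] //=; case: (odd k).
by apply: recfun_sub; [apply: recfun_const|apply: recfun_nth].
Qed.

Lemma recfun_half F : recfun F -> recfun (fun fs v => (F fs v)./2).
Proof.
move=> hF; apply: (recfun_ext _ (recfun_prim (s := fun k r => k - r) _
  (recfun_const m n 0) hF)).
  move=> fs v; elim: (F fs v) => [|k /= ->] //=.
  by rewrite uphalf_half -[X in X - _](odd_double_half k) -addnn addnA addnK.
by apply: recfun_sub; apply: recfun_nth.
Qed.

Lemma recfun_orb P Q : recfun (fun fs v => P fs v : nat) ->
  recfun (fun fs v => Q fs v : nat) ->
  recfun (fun fs v => P fs v || Q fs v : nat).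
Proof.
move=> hP hQ; apply: (recfun_ext _ (recfun_neg (recfun_and (recfun_neg hP)
  (recfun_neg hQ)))) => fs v.
by case: (P fs v); case: (Q fs v).
Qed.

Lemma recfun_imp P Q : recfun (fun fs v => P fs v : nat) ->
  recfun (fun fs v => Q fs v : nat) ->
  recfun (fun fs v => P fs v ==> Q fs v : nat).
Proof.
move=> hP hQ; apply: (recfun_ext _ (recfun_orb (recfun_neg hP) hQ)) => fs v.
by case: (P fs v); case: (Q fs v).
Qed.

Lemma recfun_ifb P Q Q' : recfun (fun fs v => P fs v : nat) ->
  recfun (fun fs v => Q fs v : nat) -> recfun (fun fs v => Q' fs v : nat) ->
  recfun (fun fs v => (if P fs v then Q fs v else Q' fs v) : nat).
Proof.
move=> hP hQ hQ'; apply: (recfun_ext _ (recfun_if hP hQ hQ')) => fs v.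
by case: (P fs v).
Qed.

End Predicates.

(** * Binary digits, pairs and codes of initial segments *)

Definition bit (x k : nat) : bool := odd (iter k half x).

Lemma recfun_bit m n (F G : m.-tuple (nat -> nat) -> n.-tuple nat -> nat) :
  recfun F -> recfun G -> recfun (fun fs v => bit (F fs v) (G fs v) : nat).
Proof.
move=> hF hG; apply: recfun_odd.
apply: (recfun_ext _ (recfun_prim (s := fun _ r => r./2) _ hF hG)).
  by move=> fs v; elim: (G fs v) => [|k /= ->].
by apply: recfun_half; apply: recfun_nth.
Qed.

(** This is the step of [CodeSeq.code], so codes of explicit lists are iterated pairs by conversion.
    Its values are positive, which leaves 0 for the empty sequence. *)
Definition pair_code (a b : nat) : nat := 2 ^ a * b.*2.+1.

Lemma recfun_pair_code m n
    (F G : m.-tuple (nat -> nat) -> n.-tuple nat -> nat) :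
  recfun F -> recfun G -> recfun (fun fs v => pair_code (F fs v) (G fs v)).
Proof.
move=> hF hG; apply: recfun_mul; first exact: recfun_exp2.
apply: recfun_succ; apply: (recfun_ext _ (recfun_add hG hG)) => fs v.
by rewrite addnn.
Qed.

Lemma pair_code_gt0 a b : 0 < pair_code a b.
Proof. by rewrite muln_gt0 expn_gt0. Qed.

Lemma pair_code_inj a b a' b' :
  pair_code a b = pair_code a' b' -> a = a' /\ b = b'.
Proof.
rewrite /pair_code; elim: a a' => [|a IH] [|a'] /=; rewrite ?expnS.
- by rewrite !mul1n => -[] /double_inj.
- by move=> /(congr1 odd); rewrite mul1n -mulnA oddM /= odd_double.
- by move=> /(congr1 odd); rewrite mul1n -mulnA oddM /= odd_double.
- rewrite -!mulnA => /eqP; rewrite eqn_pmul2l // => /eqP /IH [-> ->] //.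
Qed.

Ltac rec_step :=
  match goal with
  | |- recfun (fun fs v => nth 0 (tval v) _) => apply: recfun_nth; by []
  | |- recfun (fun fs v => nth (fun=> 0) (tval fs) _ _) =>
      apply: recfun_oracle; [by []|]
  | |- recfun (fun fs v => _ - _) => apply: recfun_sub
  | |- recfun (fun fs v => pair_code _ _) => apply: recfun_pair_code
  | |- recfun (fun fs v => _.+1) => apply: recfun_succ
  | |- recfun (fun fs v => nat_of_bool (_ && _)) => apply: recfun_and
  | |- recfun (fun fs v => nat_of_bool (~~ _)) => apply: recfun_neg
  | |- recfun (fun fs v => nat_of_bool (bit _ _)) => apply: recfun_bit
  | |- recfun (fun fs v => nat_of_bool (_ == _)) => apply: recfun_eq
  | |- recfun (fun fs v => if _ then _ else _) => apply: recfun_if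
  | |- recfun (fun fs v => _) => apply: recfun_const
  end.
Ltac rec_tac := repeat rec_step.

Fixpoint hist (h : nat -> nat) (k : nat) : nat :=
  if k is k'.+1 then pair_code (hist h k') (h k') else 0.

Lemma hist_inj h h' k k' : hist h k = hist h' k' ->
  k = k' /\ forall i, i < k -> h i = h' i.
Proof.
elim: k k' => [|k IH] [|k'] //=.
- by move=> e; have := pair_code_gt0 (hist h' k') (h' k'); rewrite -e.
- by move=> e; have := pair_code_gt0 (hist h k) (h k); rewrite e.
- move=> /pair_code_inj [/IH [<- hk] e]; split=> // i.
  by rewrite ltnS leq_eqVlt => /orP [/eqP ->|/hk].
Qed.

Lemma recfun_skip m n (F : m.-tuple (nat -> nat) -> n.+1.-tuple nat -> nat) :
  recfun F ->
  recfun (fun fs (w : n.+2.-tuple nat) =>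
    F fs [tuple of nth 0 w 0 :: behead (behead w)]).
Proof.
move=> hF; pose H (i : 'I_n.+1) (fs : m.-tuple (nat -> nat)) (w : n.+2.-tuple nat) :=
  nth 0 w (if val i is k.+1 then k.+2 else 0).
have hH i : recfun (H i) by apply: recfun_nth; case: i => -[|k].
have := recfun_comp hF hH; apply: recfun_ext => fs w.
congr F; apply: eq_from_tnth => i; rewrite tnth_mktuple (tnth_nth 0) /H /=.
by case: i => -[|i] //= hi; rewrite !(nth_behead 0).
Qed.

Lemma recfun_hist m n (F : m.-tuple (nat -> nat) -> n.+1.-tuple nat -> nat)
    (G : m.-tuple (nat -> nat) -> n.-tuple nat -> nat) :
  recfun F -> recfun G ->
  recfun (fun fs v => hist (fun i => F fs [tuple of i :: v]) (G fs v)).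
Proof.
move=> hF hG; apply: recfun_ext (recfun_primrec (recfun_const m n 0) (S :=
  fun fs w => pair_code (nth 0 w 1)
    (F fs [tuple of nth 0 w 0 :: behead (behead w)])) _ hG).
  move=> fs v /=; elim: (G fs v) => [|k /= ->] //.
  by congr (pair_code _ (F fs _)); apply: val_inj.
by apply: recfun_pair_code; [exact: recfun_nth|exact: recfun_skip].
Qed.

(** * Normal form of Pi^1_2 relations *)

(** Counts the trailing zero bits of [k]: [r] grows along with [i] up to the first bit that is set.
    On a pair with first component a the bound [k] suffices, as a < 2 ^ a. *)
Definition unpair1 (k : nat) : nat :=
  primrec 0 (fun i r => if (r == i) && ~~ bit k i then r.+1 else r) k.
Definition unpair2 (k : nat) : nat := (iter (unpair1 k).+1 half k).

Lemma iter_halfD a x i : i <= a -> iter i half (2 ^ a * x) = 2 ^ (a - i) * x.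
Proof.
elim: i => [|i IH] hi; rewrite ?subn0 //= IH ?(ltnW hi) //.
by rewrite -[a - i]prednK ?subn_gt0 // -subnS expnS -mulnA mul2n doubleK.
Qed.

Lemma bit_pair_code a b i : i <= a -> bit (pair_code a b) i = (i == a).
Proof.
move=> hi; rewrite /bit /pair_code iter_halfD //; case: (eqVneq i a) => [->|ne].
  by rewrite subnn mul1n /= odd_double.
rewrite -[a - i]prednK ?expnS ?subn_gt0 ?ltn_neqAle ?ne //.
by rewrite -mulnA oddM.
Qed.

Lemma unpair1K a b : unpair1 (pair_code a b) = a.
Proof.
rewrite /unpair1; set f := fun i r => _.
have h i : primrec 0 f i = minn i a.
  elim: i => [|i IH] /=; first by rewrite min0n.
  rewrite IH /f; case: (ltngtP i a) => [lt|gt|->].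
  - rewrite eqxx bit_pair_code ?(ltnW lt) //.
    by rewrite (ltn_eqF lt) /=; apply/esym/minn_idPl.
  - rewrite (ltn_eqF gt) /=.
    by apply/esym/minn_idPr; apply: ltnW; apply: ltnW.
  - by rewrite eqxx bit_pair_code // eqxx /=; apply/esym/minn_idPr.
rewrite h; apply/minn_idPr; rewrite /pair_code.
by apply: leq_trans (ltnW (ltn_expl a (ltnSn 1))) _; apply: leq_pmulr.
Qed.

Lemma unpair2K a b : unpair2 (pair_code a b) = b.
Proof.
rewrite /unpair2 unpair1K /= /pair_code iter_halfD // subnn mul1n.
exact: uphalf_double.
Qed.

Lemma recfun_unpair1 m n (F : m.-tuple (nat -> nat) -> n.-tuple nat -> nat) :
  recfun F -> recfun (fun fs v => unpair1 (F fs v)).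
Proof.
apply: recfun_comp1.
apply: recfun_ext (recfun_primrec (m := m) (n := 1) (recfun_const m 1 0) (S :=
  fun fs w => if (nth 0 w 1 == nth 0 w 0) && ~~ bit (nth 0 w 2) (nth 0 w 0)
              then (nth 0 w 1).+1 else nth 0 w 1) _ (recfun_nth m (ltn0Sn 0))).
  by move=> fs; case/tupleP => k v.
by rec_tac.
Qed.

Lemma recfun_unpair2 m n (F : m.-tuple (nat -> nat) -> n.-tuple nat -> nat) :
  recfun F -> recfun (fun fs v => unpair2 (F fs v)).
Proof.
move=> hF.
apply: recfun_ext (recfun_prim (s := fun _ r => r./2) _ hF
  (recfun_succ (recfun_unpair1 hF))).
  by move=> fs v; rewrite /unpair2; elim: _.+1 => [|k /= ->].
by apply: recfun_half; apply: recfun_nth.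
Qed.

Definition recvec m n k
    (ws : m.-tuple (nat -> nat) -> n.-tuple nat -> k.-tuple nat) :=
  forall j, recfun (fun fs v => tnth (ws fs v) j).

Definition recfuns m n k
    (hs : m.-tuple (nat -> nat) -> n.-tuple nat -> k.-tuple (nat -> nat)) :=
  forall j, recfun (fun fs (v : n.+1.-tuple nat) =>
    tnth (hs fs [tuple of behead v]) j (thead v)).

Lemma recvec_id m n : @recvec m n n (fun _ v => v).
Proof. by move=> j; apply: recfun_tnth. Qed.

Lemma recvec_behead m n : @recvec m n.+1 n (fun _ v => [tuple of behead v]).
Proof.
move=> j; apply: (recfun_ext _ (recfun_tnth m (lift ord0 j))) => fs v.
by rewrite !(tnth_nth 0) /= nth_behead.
Qed.

Lemma recvec_nil m n (ws : m.-tuple (nat -> nat) -> n.-tuple nat -> 0.-tuple nat) :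
  recvec ws.
Proof. by case. Qed.

Lemma recvec_cons m n k F
    (ws : m.-tuple (nat -> nat) -> n.-tuple nat -> k.-tuple nat) :
  recfun F -> recvec ws ->
  recvec (fun fs v => [tuple of F fs v :: ws fs v]).
Proof.
move=> hF hw j; case: (unliftP ord0 j) => [i ->|->].
  by apply: (recfun_ext _ (hw i)) => fs v; rewrite tnthS.
by apply: (recfun_ext _ hF) => fs v; rewrite tnth0.
Qed.

Lemma recfuns_nil m n
    (hs : m.-tuple (nat -> nat) -> n.-tuple nat -> 0.-tuple (nat -> nat)) :
  recfuns hs.
Proof. by case. Qed.

Lemma recfuns_cons m n k
    (h : m.-tuple (nat -> nat) -> n.-tuple nat -> nat -> nat)
    (hs : m.-tuple (nat -> nat) -> n.-tuple nat -> k.-tuple (nat -> nat)) :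
  recfun (fun fs (v : n.+1.-tuple nat) => h fs [tuple of behead v] (thead v)) ->
  recfuns hs ->
  recfuns (fun fs v => [tuple of h fs v :: hs fs v]).
Proof.
move=> hF hw j; case: (unliftP ord0 j) => [i ->|->].
  by apply: (recfun_ext _ (hw i)) => fs v; rewrite tnthS.
by apply: (recfun_ext _ hF) => fs v; rewrite tnth0.
Qed.

Lemma recfun_thead m n : @recfun m n.+1 (fun _ v => thead v).
Proof. exact: recfun_tnth. Qed.

Lemma recfun_app m n (i : 'I_m) F : recfun F ->
  @recfun m n (fun fs v => tnth fs i (F fs v)).
Proof.
move=> hF; apply: (recfun_ext _ (recfun_oracle (ltn_ord i) hF)) => fs v.
by rewrite (tnth_nth (fun=> 0)).
Qed.

Lemma recfuns_id m n : @recfuns m n m (fun fs _ => fs).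
Proof. by move=> j; apply: recfun_app; apply: recfun_thead. Qed.

Lemma recfuns_behead m n : @recfuns m.+1 n m (fun fs _ => [tuple of behead fs]).
Proof.
move=> j; apply: (recfun_ext _ (recfun_app (lift ord0 j) (recfun_thead _ _))).
by move=> fs v; rewrite !(tnth_nth (fun=> 0)) /= nth_behead.
Qed.

Lemma recfuns_behead2 m n :
  @recfuns m.+2 n m (fun fs _ => [tuple of behead (behead fs)]).
Proof.
move=> j.
apply: (recfun_ext _ (recfun_app (lift ord0 (lift ord0 j)) (recfun_thead _ _))).
by move=> fs v; rewrite !(tnth_nth (fun=> 0)) /= !nth_behead.
Qed.

Lemma recfun_behead m n F : @recfun m n F ->
  recfun (fun fs (v : n.+1.-tuple nat) => F fs [tuple of behead v]).
Proof.
move=> hF; apply: (recfun_subst (hs := fun fs _ => fs)) hF _ _.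
  exact: recfuns_id.
exact: recvec_behead.
Qed.

Lemma recursive_subst m n m' p (M : relation m n)
    (hs : m'.-tuple (nat -> nat) -> p.-tuple nat -> m.-tuple (nat -> nat))
    (ws : m'.-tuple (nat -> nat) -> p.-tuple nat -> n.-tuple nat) :
  recursive_relation M -> recfuns hs -> recvec ws ->
  recursive_relation (fun fs v => M (hs fs v) (ws fs v)).
Proof.
move=> /recursive_relationE hM hhs hws; apply/recursive_relationE.
exact: recfun_subst hM hhs hws.
Qed.

(** The number quantifier is universal because a computation that goes on forever can verify it. *)
Definition sigma_form m n (R : relation m n) := exists M : relation m.+1 n.+1,
  recursive_relation M /\ forall fs v,
  R fs v <-> exists g, forall k, M [tuple of g :: fs] [tuple of k :: v].

Definition pi_form m n (R : relation m n) := exists M : relation m.+2 n.+1,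
  recursive_relation M /\ forall fs v, R fs v <->
  forall f, exists g, forall k, M [tuple of g :: f :: fs] [tuple of k :: v].

Lemma behead_cons_tuple (T : Type) n (x : T) (t : n.-tuple T) :
  [tuple of behead [tuple of x :: t]] = t.
Proof. exact: val_inj. Qed.

Lemma behead2_cons_tuple (T : Type) n (x y : T) (t : n.-tuple T) :
  [tuple of behead (behead [tuple of x :: y :: t])] = t.
Proof. exact: val_inj. Qed.

Lemma sigma_recursive m n (R : relation m n) :
  recursive_relation R -> sigma_form R.
Proof.
move=> hR.
exists (fun (fs : m.+1.-tuple (nat -> nat)) (v : n.+1.-tuple nat) =>
  R [tuple of behead fs] [tuple of behead v]); split.
  by apply: recursive_subst hR _ _; [apply: recfuns_behead|apply: recvec_behead].
move=> fs v; split=> [h|[g /(_ 0)]]; last by rewrite !behead_cons_tuple.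
by exists id => k; rewrite !behead_cons_tuple.
Qed.

(** The number is stored as [g 0], the old witness in the rest of [g]. *)
Lemma sigma_exnum m n (R : relation m n.+1) : sigma_form R ->
  sigma_form (fun fs (v : n.-tuple nat) => exists x, R fs [tuple of x :: v]).
Proof.
move=> [M [hM eM]].
exists (fun (fs : m.+1.-tuple (nat -> nat)) (v : n.+1.-tuple nat) =>
  M [tuple of (fun y => thead fs y.+1) :: [tuple of behead fs]]
   [tuple of thead v :: [tuple of thead fs 0 :: [tuple of behead v]]]); split.
  apply: recursive_subst hM _ _.
    apply: recfuns_cons; last exact: recfuns_behead.
    by apply: recfun_app; apply: recfun_succ; apply: recfun_thead.
  apply: recvec_cons; first exact: recfun_thead.
  apply: recvec_cons; last exact: recvec_behead.
  by apply: recfun_app; apply: recfun_const.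
move=> fs v; split=> [[x /eM [g hg]]|[g hg]].
  exists (fun y => if y is y'.+1 then g y' else x) => k.
  by rewrite !behead_cons_tuple !theadE.
exists (g 0); apply/eM; exists (fun y => g y.+1) => k.
by have := hg k; rewrite !behead_cons_tuple !theadE.
Qed.

(** Choice gives one witness per number; they become the columns of one function, and [k] codes the
    number together with the old bound variable. *)
Lemma sigma_allnum m n (R : relation m n.+1) : sigma_form R ->
  sigma_form (fun fs (v : n.-tuple nat) => forall x, R fs [tuple of x :: v]).
Proof.
move=> [M [hM eM]].
exists (fun (fs : m.+1.-tuple (nat -> nat)) (v : n.+1.-tuple nat) =>
  M [tuple of (fun y => thead fs (pair_code (unpair1 (thead v)) y)) ::
              [tuple of behead fs]]
   [tuple of unpair2 (thead v) ::
     [tuple of unpair1 (thead v) :: [tuple of behead v]]]); split.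
  apply: recursive_subst hM _ _.
    apply: recfuns_cons; last exact: recfuns_behead.
    apply: recfun_app; apply: recfun_pair_code; last exact: recfun_thead.
    apply: recfun_unpair1; apply: (recfun_behead (F := fun _ w => thead w));
    exact: recfun_thead.
  apply: recvec_cons; first by apply: recfun_unpair2; apply: recfun_thead.
  apply: recvec_cons; last exact: recvec_behead.
  by apply: recfun_unpair1; apply: recfun_thead.
move=> fs v; split=> [h|[g hg] x].
  have /choice [G hG] : forall x, exists g, forall k,
      M [tuple of g :: fs] [tuple of k :: [tuple of x :: v]].
    by move=> x; apply/eM.
  exists (fun y => G (unpair1 y) (unpair2 y)) => k.
  rewrite !behead_cons_tuple !theadE.
  under [fun y : nat => G _ _]functional_extensionality_dep => y do
    rewrite unpair1K unpair2K.
  exact: hG.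
apply/eM; exists (fun y => g (pair_code x y)) => k.
have := hg (pair_code x k).
by rewrite !behead_cons_tuple !theadE unpair1K unpair2K.
Qed.

Lemma recfun_double m n F : @recfun m n F -> recfun (fun fs v => (F fs v).*2).
Proof.
by move=> hF; apply: (recfun_ext _ (recfun_add hF hF)) => fs v; rewrite addnn.
Qed.

Definition merge (f g : nat -> nat) (y : nat) : nat :=
  if odd y then f y./2 else g y./2.

Lemma merge_even f g : (fun y => merge f g y.*2) = g.
Proof. by apply/funext => y; rewrite /merge odd_double doubleK. Qed.

Lemma merge_odd f g : (fun y => merge f g y.*2.+1) = f.
Proof. by apply/funext => y; rewrite /merge /= odd_double uphalf_double. Qed.

Lemma sigma_exfun m n (R : relation m.+1 n) : sigma_form R ->
  sigma_form (fun (fs : m.-tuple (nat -> nat)) v =>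
    exists f, R [tuple of f :: fs] v).
Proof.
move=> [M [hM eM]].
exists (fun (fs : m.+1.-tuple (nat -> nat)) (v : n.+1.-tuple nat) =>
  M [tuple of (fun y => thead fs (y.*2)) ::
     [tuple of (fun y => thead fs (y.*2.+1)) :: [tuple of behead fs]]] v); split.
  apply: recursive_subst hM _ _; last exact: recvec_id.
  apply: recfuns_cons; last apply: recfuns_cons; last exact: recfuns_behead.
    by apply: recfun_app; apply: recfun_double; apply: recfun_thead.
  by apply: recfun_app; apply: recfun_succ; apply: recfun_double; apply: recfun_thead.
move=> fs v; split=> [[f /eM [g hg]]|[g hg]].
  exists (merge f g) => k.
  rewrite !behead_cons_tuple !theadE.
  by rewrite merge_even merge_odd.
exists (fun y => g y.*2.+1); apply/eM; exists (fun y => g y.*2) => k.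
by have := hg k; rewrite !behead_cons_tuple !theadE.
Qed.
Lemma pi_sigma m n (R : relation m n) : sigma_form R -> pi_form R.
Proof.
move=> [M [hM eM]].
exists (fun (fs : m.+2.-tuple (nat -> nat)) v =>
  M [tuple of thead fs :: [tuple of behead (behead fs)]] v); split.
  apply: recursive_subst hM _ _; last exact: recvec_id.
  apply: recfuns_cons; last exact: recfuns_behead2.
  by apply: recfun_app; apply: recfun_thead.
move=> fs v; split=> [/eM [g hg] f|/(_ id) [g hg]].
  by exists g => k; rewrite behead2_cons_tuple theadE.
by apply/eM; exists g => k; have := hg k; rewrite behead2_cons_tuple theadE.
Qed.

Lemma recfun_thead2 m n F : recfun F ->
  @recfun m.+2 n (fun fs v => thead [tuple of behead fs] (F fs v)).
Proof.
move=> hF; apply: (recfun_ext _ (recfun_app (lift ord0 ord0) hF)) => fs v.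
by rewrite /thead !(tnth_nth (fun=> 0)) /= nth_behead.
Qed.

(** The answer [g] names [x] in [g 0] and is tested against column [x] of [f] only. Conversely, if
    every [x] had a counterexample [F x], these would be the columns of a single [f] without
    answer. *)
Lemma pi_exnum m n (R : relation m n.+1) : pi_form R ->
  pi_form (fun fs (v : n.-tuple nat) => exists x, R fs [tuple of x :: v]).
Proof.
move=> [M [hM eM]].
exists (fun (fs : m.+2.-tuple (nat -> nat)) (v : n.+1.-tuple nat) =>
  M [tuple of (fun y => thead fs y.+1) ::
     [tuple of (fun y => thead [tuple of behead fs] (pair_code (thead fs 0) y)) ::
      [tuple of behead (behead fs)]]]
   [tuple of thead v :: [tuple of thead fs 0 :: [tuple of behead v]]]); split.
  apply: recursive_subst hM _ _.
    apply: recfuns_cons; last apply: recfuns_cons; last exact: recfuns_behead2.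
      by apply: recfun_app; apply: recfun_succ; apply: recfun_thead.
    apply: recfun_thead2; apply: recfun_pair_code; last exact: recfun_thead.
    by apply: recfun_app; apply: recfun_const.
  apply: recvec_cons; first exact: recfun_thead.
  apply: recvec_cons; last exact: recvec_behead.
  by apply: recfun_app; apply: recfun_const.
move=> fs v; split=> [[x /eM h] f|h].
  have [g hg] := h (fun y => f (pair_code x y)).
  exists (fun y => if y is y'.+1 then g y' else x) => k.
  by rewrite !behead_cons_tuple !behead2_cons_tuple !theadE.
apply: contrapT => /forallNP hn.
have /choice [F hF] : forall x, exists f, ~ exists g, forall k,
    M [tuple of g :: f :: fs] [tuple of k :: [tuple of x :: v]].
  by move=> x; have := hn x; rewrite eM => /existsNP.
have [g hg] := h (fun y => F (unpair1 y) (unpair2 y)).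
case: (hF (g 0)); exists (fun y => g y.+1) => k.
have := hg k; rewrite !behead_cons_tuple !behead2_cons_tuple !theadE.
under [fun y : nat => F _ _]functional_extensionality_dep => y do
    rewrite unpair1K unpair2K.
exact.
Qed.

Lemma pi_allnum m n (R : relation m n.+1) : pi_form R ->
  pi_form (fun fs (v : n.-tuple nat) => forall x, R fs [tuple of x :: v]).
Proof.
move=> [M [hM eM]].
exists (fun (fs : m.+2.-tuple (nat -> nat)) (v : n.+1.-tuple nat) =>
  M [tuple of thead fs ::
     [tuple of (fun y => thead [tuple of behead fs] y.+1) ::
      [tuple of behead (behead fs)]]]
   [tuple of thead v ::
      [tuple of thead [tuple of behead fs] 0 :: [tuple of behead v]]]); split.
  apply: recursive_subst hM _ _.
    apply: recfuns_cons; last apply: recfuns_cons; last exact: recfuns_behead2.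
      by apply: recfun_app; apply: recfun_thead.
    by apply: recfun_thead2; apply: recfun_succ; apply: recfun_thead.
  apply: recvec_cons; first exact: recfun_thead.
  apply: recvec_cons; last exact: recvec_behead.
  by apply: recfun_thead2; apply: recfun_const.
move=> fs v; split=> [h f|h x].
  have /eM/(_ (fun y => f y.+1)) [g hg] := h (f 0).
  by exists g => k; rewrite !behead_cons_tuple !behead2_cons_tuple !theadE.
apply/eM => f; have [g hg] := h (fun y => if y is y'.+1 then f y' else x).
exists g => k; have := hg k.
by rewrite !behead_cons_tuple !behead2_cons_tuple !theadE.
Qed.

Lemma pi_allfun m n (R : relation m.+1 n) : pi_form R ->
  pi_form (fun (fs : m.-tuple (nat -> nat)) v =>
    forall f, R [tuple of f :: fs] v).
Proof.
move=> [M [hM eM]].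
exists (fun (fs : m.+2.-tuple (nat -> nat)) (v : n.+1.-tuple nat) =>
  M [tuple of thead fs ::
     [tuple of (fun y => thead [tuple of behead fs] y.*2) ::
     [tuple of (fun y => thead [tuple of behead fs] y.*2.+1) ::
      [tuple of behead (behead fs)]]]] v); split.
  apply: recursive_subst hM _ _; last exact: recvec_id.
  apply: recfuns_cons; first by apply: recfun_app; apply: recfun_thead.
  apply: recfuns_cons; last apply: recfuns_cons; last exact: recfuns_behead2.
    by apply: recfun_thead2; apply: recfun_double; apply: recfun_thead.
  apply: recfun_thead2; apply: recfun_succ; apply: recfun_double.
  exact: recfun_thead.
move=> fs v; split=> [h f|h f0].
  have /eM/(_ (fun y => f y.*2)) [g hg] := h (fun y => f y.*2.+1).
  by exists g => k; rewrite !behead2_cons_tuple !theadE.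
apply/eM => f.
have [g hg] := h (merge f0 f).
exists g => k; have := hg k; rewrite !behead2_cons_tuple !theadE.
by rewrite merge_even merge_odd.
Qed.

Lemma sigma_prefix pi m n (R : relation m n) :
  predicate_form pi R -> all negb (reduced_prefix pi) -> sigma_form R.
Proof.
elim=> {m n R pi} [m n R hR _|pi m n R _ IH h|pi m n R _ IH h|pi m n R _ IH h|
  pi m n R _ _ h].
- exact: sigma_recursive.
- exact: sigma_exnum (IH h).
- exact: sigma_allnum (IH h).
- exact: sigma_exfun (IH h).
- by [].
Qed.

(** The universal block may be empty, so the induction on the prefix can remove its quantifiers one
    at a time. *)
Fixpoint all_ex (s : seq bool) : bool :=
  if s is b :: s' then if b then all_ex s' else all negb s' else true.

Lemma pi_prefix pi m n (R : relation m n) :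
  predicate_form pi R -> all_ex (reduced_prefix pi) -> pi_form R.
Proof.
elim=> {m n R pi} [m n R hR _|pi m n R _ IH h|pi m n R _ IH h|pi m n R hR IH h|
  pi m n R _ IH h].
- exact/pi_sigma/sigma_recursive.
- exact: pi_exnum (IH h).
- exact: pi_allnum (IH h).
- by apply/pi_sigma/sigma_exfun; apply: sigma_prefix hR _.
- exact: pi_allfun (IH h).
Qed.

Lemma all_ex_Pi2 pi : Pi1_prefix 2 pi -> all_ex (reduced_prefix pi).
Proof.
rewrite /Pi1_prefix; case: (reduced_prefix pi) => [[]|b s] //= [[->]].
(* The first induction reads the universal block; the first existential quantifier uses up the only
   alternation, so the rest is constant. *)
elim: s => //= -[] s IH; rewrite /= ?add0n //.
move=> [] h {IH}; elim: s h => //= -[] s IH /=; rewrite ?addn0 //.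
Qed.

Theorem Pi2_normal_form (B : set nat) : Pi1 2 B ->
  exists M : relation 2 2, recursive_relation M /\
    forall x, B x <-> forall f, exists g, forall k, M [tuple g; f] [tuple k; x].
Proof.
move=> [pi [R [/all_ex_Pi2 hpi hR ->]]].
have [M [hM eM]] := pi_prefix hR hpi.
have e1 k x : [tuple of k :: [tuple x]] = [tuple k; x] :> 2.-tuple nat.
  exact: val_inj.
have e2 f g : [tuple of g :: [tuple of f :: [tuple]]] = [tuple g; f]
    :> 2.-tuple (nat -> nat) by exact: val_inj.
exists M; split=> // x; split=> [/eM h f|h]; last apply/eM => f.
  by have [g hg] := h f; exists g => k; have := hg k; rewrite e1 e2.
by have [g hg] := h f; exists g => k; have := hg k; rewrite e1 e2.
Qed.

(** * Lusin-Souslin theorem *)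

Definition agree (T : Type) (k : nat) (x y : nat -> T) :=
  forall i, i < k -> x i = y i.

Lemma agree_refl T k (x : nat -> T) : agree k x x.
Proof. by []. Qed.

Lemma agree_sym T k (x y : nat -> T) : agree k x y -> agree k y x.
Proof. by move=> h i /h. Qed.

Lemma agree_trans T k (x y z : nat -> T) :
  agree k x y -> agree k y z -> agree k x z.
Proof. by move=> h h' i hi; rewrite h // h'. Qed.

Lemma agree_le T k l (x y : nat -> T) : k <= l -> agree l x y -> agree k x y.
Proof. by move=> kl h i hi; apply: h; apply: leq_trans kl. Qed.

(** Closedness in the product of Cantor space and Baire space, tested on basic neighbourhoods. *)
Definition closed2 (C : (nat -> bool) -> (nat -> nat) -> Prop) :=
  forall h g, (forall k, exists h' g', [/\ agree k h h', agree k g g' & C h' g']) ->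
  C h g.

Definition analytic (A : (nat -> bool) -> Prop) :=
  exists2 C, closed2 C & forall h, A h <-> exists g, C h g.

Lemma analytic_ext A B : (forall h, A h <-> B h) -> analytic A -> analytic B.
Proof. by move=> e [C hC eC]; exists C => // h; rewrite -e. Qed.

Lemma analytic_exists (A : nat -> (nat -> bool) -> Prop) :
  (forall n, analytic (A n)) -> analytic (fun h => exists n, A n h).
Proof.
move=> hA.
have /choice [C hC] : forall n, exists C, closed2 C /\
    forall h, A n h <-> exists g, C h g.
  by move=> n; have [C hC eC] := hA n; exists C.
exists (fun h g => C (g 0) h (fun i => g i.+1)).
  move=> h g hk; apply: (proj1 (hC _)) => k.
  have [h' [g' [ah ag c]]] := hk k.+1.
  exists h', (fun i => g' i.+1); split.
  - exact: agree_le ah.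
  - by move=> i hi; apply: ag.
  - by rewrite (ag 0).
move=> h; split=> [[n /(proj2 (hC n)) [g hg]]|[g hg]].
  by exists (fun i => if i is i'.+1 then g i' else n).
by exists (g 0); apply/(proj2 (hC _)); exists (fun i => g i.+1).
Qed.

Lemma ltn_pair_code a b b' : b < b' -> pair_code a b < pair_code a b'.
Proof. by move=> h; rewrite /pair_code ltn_pmul2l ?expn_gt0 // ltnS ltn_double. Qed.

(** Witnesses for all [n] are the columns of one [g]. Positions increase along a column, so an
    initial segment of a column lies in an initial segment of [g], which keeps the set closed. *)
Lemma analytic_forall (A : nat -> (nat -> bool) -> Prop) :
  (forall n, analytic (A n)) -> analytic (fun h => forall n, A n h).
Proof.
move=> hA.
have /choice [C hC] : forall n, exists C, closed2 C /\
    forall h, A n h <-> exists g, C h g.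
  by move=> n; have [C hC eC] := hA n; exists C.
exists (fun h g => forall n, C n h (fun i => g (pair_code n i))).
  move=> h g hk n; apply: (proj1 (hC _)) => k.
  have [h' [g' [ah ag c]]] := hk (maxn k (pair_code n k)).
  exists h', (fun i => g' (pair_code n i)); split => //.
    exact: agree_le (leq_maxl _ _) ah.
  move=> i hi; apply: ag; apply: leq_trans (leq_maxr _ _).
  exact: ltn_pair_code.
move=> h; split=> [hn|[g hg] n].
  have /choice [g hg] : forall n, exists g, C n h g.
    by move=> n; apply/(proj2 (hC n)).
  exists (fun i => g (unpair1 i) (unpair2 i)) => n.
  have -> // : (fun i => g (unpair1 (pair_code n i)) (unpair2 (pair_code n i))) = g n.
  by apply/funext => i; rewrite unpair1K unpair2K.
by apply/(proj2 (hC n)); exists (fun i => g (pair_code n i)).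
Qed.

Lemma analytic_finite_dep N (P : (nat -> bool) -> Prop) :
  (forall h h', agree N h h' -> P h -> P h') -> analytic P.
Proof.
move=> hP; exists (fun h _ => P h).
  move=> h g hk; have [h' [_ [/agree_sym ah _ p]]] := hk N.
  exact: hP ah p.
by move=> h; split=> [p|[]] //; exists id.
Qed.

(** Stands in for the Borel sets: the argument relies on clopen sets and on closure under
    complements and countable unions and intersections. *)
Definition bianalytic (A : (nat -> bool) -> Prop) :=
  analytic A /\ analytic (fun h => ~ A h).

Lemma bianalytic_not A : bianalytic A -> bianalytic (fun h => ~ A h).
Proof.
by case=> hA hA'; split=> //; apply: analytic_ext hA => h; rewrite notK.
Qed.

Lemma bianalytic_finite_dep N (P : (nat -> bool) -> Prop) :
  (forall h h', agree N h h' -> P h -> P h') -> bianalytic P.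
Proof.
move=> hP; split; apply: (@analytic_finite_dep N) => // h h' /agree_sym ah np p.
by apply: np; apply: hP p.
Qed.

Lemma bianalytic_const (P : Prop) : bianalytic (fun=> P).
Proof. exact: (@bianalytic_finite_dep 0). Qed.

Lemma bianalytic_exists (A : nat -> (nat -> bool) -> Prop) :
  (forall n, bianalytic (A n)) -> bianalytic (fun h => exists n, A n h).
Proof.
move=> hA; split; first by apply: analytic_exists => n; case: (hA n).
apply: (@analytic_ext (fun h => forall n, ~ A n h)).
  by move=> h; rewrite -forallNE.
by apply: analytic_forall => n; case: (hA n).
Qed.

Lemma bianalytic_forall (A : nat -> (nat -> bool) -> Prop) :
  (forall n, bianalytic (A n)) -> bianalytic (fun h => forall n, A n h).
Proof.
move=> hA; have [h1 h2] := bianalytic_exists (fun n => bianalytic_not (hA n)).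
split; first by apply: analytic_forall => n; case: (hA n).
by apply: analytic_ext h1 => h; rewrite -existsNE.
Qed.

Lemma bianalytic_and A B : bianalytic A -> bianalytic B ->
  bianalytic (fun h => A h /\ B h).
Proof.
move=> hA hB.
have h : bianalytic (fun h => forall n : nat, if n is 0 then A h else B h).
  by apply: bianalytic_forall => -[|n].
have -> // : (fun h => A h /\ B h) =
    (fun h => forall n : nat, if n is 0 then A h else B h).
apply/funext => x; apply/propext; split=> [[a b] [|n] //|hn].
by split; [apply: (hn 0)|apply: (hn 1)].
Qed.

Definition separable (X Y : (nat -> bool) -> Prop) :=
  exists B, [/\ bianalytic B, forall h, X h -> B h & forall h, Y h -> ~ B h].

(** Given separators of all pairs, take the union over [i] of the intersections over [j]. *)
Lemma separable_exists (X Y : nat -> (nat -> bool) -> Prop) :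
  (forall i j, separable (X i) (Y j)) ->
  separable (fun h => exists i, X i h) (fun h => exists i, Y i h).
Proof.
move=> hs; have /choice [B hB] : forall ij : nat * nat, exists B,
    [/\ bianalytic B, forall h, X ij.1 h -> B h & forall h, Y ij.2 h -> ~ B h].
  by move=> [i j]; apply: hs.
exists (fun h => exists i, forall j, B (i, j) h); split.
- apply: bianalytic_exists => i; apply: bianalytic_forall => j.
  by case: (hB (i, j)).
- by move=> h [i xi]; exists i => j; case: (hB (i, j)) => _ hX _; apply: hX.
- move=> h [j yj] [i /(_ j)]; case: (hB (i, j)) => _ _; exact.
Qed.

Lemma separable_sub (X X' Y Y' : (nat -> bool) -> Prop) :
  (forall h, X' h -> X h) -> (forall h, Y' h -> Y h) ->
  separable X Y -> separable X' Y'.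
Proof.
move=> hX hY [B [bB xB yB]]; exists B; split=> // h; first by move/hX/xB.
by move/hY/yB.
Qed.

Section LusinSouslin.
Variable C : (nat -> bool) -> (nat -> nat) -> Prop.
Hypothesis closedC : closed2 C.
Hypothesis injC : forall h y z, C h y -> C h z -> y = z.

Definition section_at n (y : nat -> nat) h := exists2 y', agree n y y' & C h y'.

(** The offset [n] is the length at which the two initial witnesses already differ; stage [k]
    refines witness and point by [k] further entries. *)
Let piece n k (x : (nat -> nat) * (nat -> bool)) h :=
  agree k x.2 h /\ section_at (n + k) x.1 h.

Let bad n k x y := ~ separable (piece n k x) (piece n k y).

Let agree2 n k (x y : (nat -> nat) * (nat -> bool)) :=
  agree (n + k) x.1 y.1 /\ agree k x.2 y.2.

(** A piece is the countable union of its one-step refinements, so if all pairs of refinements were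
    separable, [separable_exists] would separate the pieces. *)
Lemma bad_step n k x y : bad n k x y -> exists x' y',
  [/\ agree2 n k x x', agree2 n k y y' & bad n k.+1 x' y'].
Proof.
move=> hb; apply: contrapT => hn; apply: hb.
(* [i] codes the next entry of the witness and, by a parity, the next bit of the point. *)
pose ext (x : (nat -> nat) * (nat -> bool)) i :=
  ((fun j => if j == n + k then unpair1 i else x.1 j),
   (fun j => if j == k then odd (unpair2 i) else x.2 j)).
have hext z i : agree2 n k z (ext z i).
  by split=> j hj /=; rewrite ltn_eqF.
have cover z h : piece n k z h -> exists i, piece n k.+1 (ext z i) h.
  move=> [ah [y' ay c]]; exists (pair_code (y' (n + k)) (h k)); split.
    move=> j /=; rewrite ltnS leq_eqVlt => /orP [/eqP ->|hj].
      by rewrite eqxx unpair2K; case: (h k).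
    by rewrite ltn_eqF // ah.
  exists y' => // j /=; rewrite addnS ltnS leq_eqVlt => /orP [/eqP ->|hj].
    by rewrite eqxx unpair1K.
  by rewrite ltn_eqF // ay.
apply: separable_sub (cover x) (cover y) _.
apply: separable_exists => i j; apply: contrapT => hb.
by apply: hn; exists (ext x i), (ext y j); split.
Qed.

Lemma piece_ext n k x y h : agree2 n k x y -> piece n k x h -> piece n k y h.
Proof.
move=> [a1 a2] [ah [y' ay c]]; split.
  exact: agree_trans (agree_sym a2) ah.
by exists y' => //; exact: agree_trans (agree_sym a1) ay.
Qed.

Lemma bad_limit n x y : bad n 0 x y -> exists x' y',
  [/\ agree2 n 0 x x', agree2 n 0 y y' & forall k, bad n k x' y'].
Proof.
move=> h0.
pose T := (((nat -> nat) * (nat -> bool)) * ((nat -> nat) * (nat -> bool)))%type.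
have /choice [F hF] : forall kx : nat * T, exists x' : T,
    bad n kx.1 kx.2.1 kx.2.2 ->
    [/\ agree2 n kx.1 kx.2.1 x'.1, agree2 n kx.1 kx.2.2 x'.2 &
        bad n kx.1.+1 x'.1 x'.2].
  move=> [k [u v]] /=; case: (pselect (bad n k u v)) => [/bad_step|] hb.
    by have [u' [v' h]] := hb; exists (u', v').
  by exists (u, v).
pose S := fix S k : T := if k is k'.+1 then F (k', S k') else (x, y).
have badS k : bad n k (S k).1 (S k).2.
  by elim: k => //= k /(hF (k, S k)) [].
have stepS k : agree2 n k (S k).1 (S k.+1).1 /\ agree2 n k (S k).2 (S k.+1).2.
  by have /= [] := hF (k, S k) (badS k).
have monS (p : T -> (nat -> nat) * (nat -> bool)) :
    (forall k, agree2 n k (p (S k)) (p (S k.+1))) ->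
    forall k l, k <= l -> agree2 n k (p (S k)) (p (S l)).
  move=> hp k; elim=> [|l IH]; first by rewrite leqn0 => /eqP ->; split.
  rewrite leq_eqVlt => /orP [/eqP ->|]; first by split.
  rewrite ltnS => kl; have [a b] := IH kl; have [a' b'] := hp l.
  split; [apply: agree_trans a _|apply: agree_trans b _].
    by apply: agree_le a'; rewrite leq_add2l.
  exact: agree_le b'.
(* Stage [i.+1] has fixed both entries at [i], so the diagonal is the limit. *)
pose lim (p : T -> (nat -> nat) * (nat -> bool)) :=
  (fun i => (p (S i.+1)).1 i, fun i => (p (S i.+1)).2 i).
have limS p : (forall k, agree2 n k (p (S k)) (p (S k.+1))) ->
    forall k, agree2 n k (p (S k)) (lim p).
  move=> hp k; split=> i hi /=; case: (leqP k i.+1) => hk.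
  - exact: (proj1 (monS p hp _ _ hk)).
  - apply/esym; apply: (proj1 (monS p hp _ _ (ltnW hk))).
    by rewrite addnS ltnS leq_addl.
  - exact: (proj2 (monS p hp _ _ hk)).
  - by apply/esym; apply: (proj2 (monS p hp _ _ (ltnW hk))).
have l1 := limS fst (fun k => proj1 (stepS k)).
have l2 := limS snd (fun k => proj2 (stepS k)).
exists (lim fst), (lim snd); split; [exact: (l1 0)|exact: (l2 0)|].
move=> k hs; apply: (badS k); apply: separable_sub hs => h.
  exact: piece_ext (l1 k).
exact: piece_ext (l2 k).
Qed.

(** The empty set separates an empty piece from anything, so no piece around [x] is empty, and [C]
    is closed. *)
Lemma bad_closed n x y : (forall k, bad n k x y) -> C x.2 x.1.
Proof.
move=> hb; apply: closedC => k; apply: contrapT => hn; apply: (hb k).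
exists (fun=> False); split; [exact: bianalytic_const| |by move=> h _ []].
move=> h [ah [y' ay c]]; apply: hn; exists h, y'; split=> //.
by apply: agree_le ay; rewrite leq_addl.
Qed.

Lemma bad_sym n k x y : bad n k x y -> bad n k y x.
Proof.
move=> hb [B [bB xB yB]]; apply: hb; exists (fun h => ~ B h); split=> //.
  exact: bianalytic_not.
by move=> h /xB b nb; apply: nb.
Qed.

(** Otherwise inseparable refinements converge to two elements of [C]. Their points coincide, as a
    clopen set would separate distinct ones; then [injC] makes their witnesses equal, although these
    differ below [n]. *)
Lemma separable_sections n y z : ~ agree n y z ->
  separable (section_at n y) (section_at n z).
Proof.
move=> nyz; apply: contrapT => hs.
have : bad n 0 (y, fun=> false) (z, fun=> false).
  by move=> hs'; apply: hs; apply: separable_sub hs' => h ah; split=> //;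
    rewrite addn0.
move=> /bad_limit [x' [y' [ax ay hb]]].
have hx := bad_closed hb; have hy := bad_closed (fun k => bad_sym (hb k)).
have eqh : x'.2 = y'.2.
  apply/funext => i; apply: contrapT => ne; apply: (hb i.+1).
  exists (agree i.+1 x'.2); split.
  - apply: (@bianalytic_finite_dep i.+1) => h h' a b; exact: agree_trans b a.
  - by move=> h [].
  - by move=> h [a _] b; apply: ne; rewrite a // b.
apply: nyz; rewrite -eqh in hy; have e := injC hx hy.
case: ax ay => ax _ [ay _]; rewrite addn0 /= in ax ay.
by apply: agree_trans ax _; rewrite e; apply: agree_sym.
Qed.

(** The separators enclose the sections in bianalytic sets that are disjoint for incompatible
    segments. A point lying in such a set at every level thus determines one coherent witness, and
    closedness puts the pair in [C]. *)
Theorem lusin_souslin : analytic (fun h => ~ exists y, C h y).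
Proof.
pose ys c := nth 0 (CodeSeq.decode c).
have /choice [B hB] : forall nst : nat * (nat * nat), exists B, bianalytic B /\
   (~ agree nst.1 (ys nst.2.1) (ys nst.2.2) ->
     (forall h, section_at nst.1 (ys nst.2.1) h -> B h) /\
     (forall h, section_at nst.1 (ys nst.2.2) h -> ~ B h)).
  move=> [n [s t]] /=; case: (pselect (agree n (ys s) (ys t))) => ha.
    by exists (fun=> True); split=> //; apply: bianalytic_const.
  by have [B [bB h1 h2]] := separable_sections ha; exists B.
(* [h] is on the side of the segment [s] for every separator at level [n], and [C] meets the
   neighbourhood of size [n] around [h] and [s]. *)
pose D n s h := (forall t, ~ agree n (ys s) (ys t) ->
    B (n, (s, t)) h /\ ~ B (n, (t, s)) h) /\
  exists h' y', [/\ agree n h h', agree n (ys s) y' & C h' y'].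
have bD n s : bianalytic (D n s).
  apply: bianalytic_and.
    apply: bianalytic_forall => t.
    case: (pselect (agree n (ys s) (ys t))) => ha.
      have -> : (fun h => ~ agree n (ys s) (ys t) ->
        B (n, (s, t)) h /\ ~ B (n, (t, s)) h) = fun=> True.
        by apply/funext => h; apply/propext.
      exact: bianalytic_const.
    have -> : (fun h => ~ agree n (ys s) (ys t) ->
        B (n, (s, t)) h /\ ~ B (n, (t, s)) h) =
        fun h => B (n, (s, t)) h /\ ~ B (n, (t, s)) h.
      by apply/funext => h; apply/propext; split=> // hh; apply: hh.
    apply: bianalytic_and; first exact: (proj1 (hB _)).
    by apply: bianalytic_not; exact: (proj1 (hB _)).
  apply: (@bianalytic_finite_dep n) => h h' a [h'' [y' [a' b c]]].
  by exists h'', y'; split=> //; apply: agree_trans (agree_sym a) a'.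
(* Outside the projection, for some [n] no segment passes all levels up to [n]; in this form only
   countable operations occur. *)
apply: (@analytic_ext (fun h => exists n, forall s, exists i, i <= n /\ ~ D i s h)).
  move=> h; split=> [[n hn] [y cy]|].
    have [i [hi]] := hn (CodeSeq.code (mkseq y n)); apply.
    have sy : agree i (ys (CodeSeq.code (mkseq y n))) y.
      by move=> j hj; rewrite /ys CodeSeq.codeK nth_mkseq //; apply: leq_trans hi.
    have sA : section_at i (ys (CodeSeq.code (mkseq y n))) h by exists y.
    split; last by exists h, y.
    move=> t ha; split; first exact: (proj1 (proj2 (hB (i, (_, t))) ha)).
    have ha' : ~ agree i (ys t) (ys (CodeSeq.code (mkseq y n))).
      by move=> /agree_sym.
    exact: (proj2 (proj2 (hB (i, (t, _))) ha')).
  move=> hy; apply: contrapT => hn; apply: hy.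
  have /choice [s hs] : forall n, exists s, forall i, i <= n -> D i s h.
    move=> n; apply: contrapT => hs; apply: hn; exists n => s.
    apply: contrapT => hi; apply: hs; exists s => i le.
    by apply: contrapT => hd; apply: hi; exists i.
  (* For one point, the separators exclude incompatible segments, so all chosen segments extend one
     another. *)
  have coh i n m : i <= n -> i <= m -> agree i (ys (s n)) (ys (s m)).
    move=> ni mi; apply: contrapT => ha.
    have [/(_ _ ha) [b1 _] _] := hs n i ni.
    have ha' : ~ agree i (ys (s m)) (ys (s n)) by move=> /agree_sym.
    by have [/(_ _ ha') [_ b2] _] := hs m i mi.
  exists (fun i => ys (s i.+1) i); apply: closedC => k.
  have [_ [h' [y' [a b c]]]] := hs k k (leqnn k).
  exists h', y'; split=> // i hi.
  by rewrite -b //; apply: (coh i.+1).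
apply: analytic_exists => n; apply: analytic_forall => s.
apply: analytic_exists => i; case: (leqP i n) => hi.
  by apply: analytic_ext (proj2 (bD i s)) => h; split=> [|[]].
by apply: analytic_ext (proj1 (bianalytic_const False)) => h; split=> // -[].
Qed.

End LusinSouslin.

(** The diagonal of a universal analytic set: [h] is both the point and the set of refuted pairs of
    initial segments. *)
Definition diag (h : nat -> bool) : Prop := exists g, forall k,
  h (pair_code (hist (fun i => h i) k) (hist g k)) = false.

(** If [C] projects onto the complement, let [h0] refute the pairs of segments without extension in
    [C]. As [C] is closed, [diag h0] then says that [h0] is in the projection of [C], hence not in
    [diag]. *)
Lemma diag_not_coanalytic : ~ analytic (fun h => ~ diag h).
Proof.
move=> [C closedC eC].
pose h0 u := `[< exists (h : nat -> bool) g k,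
  u = pair_code (hist (fun i => h i) k) (hist g k) /\
  forall h' g', agree k h h' -> agree k g g' -> ~ C h' g' >].
suff : diag h0 <-> exists g, C h0 g by rewrite -eC; tauto.
split=> -[g hg]; exists g.
  apply: closedC => k; apply: contrapT => hn.
  have /asboolP := hg k; apply; exists h0, g, k; split=> // h' g' a b c.
  by apply: hn; exists h', g'.
move=> k; apply/asboolP => -[h [g' [k' [/pair_code_inj [/hist_inj [<- e1]]]]]].
move=> /hist_inj [_ e2] hn; apply: (hn h0 g) => // i hi; last by rewrite e2.
by have := e1 i hi; do 2 case: (_ i).
Qed.

(** * Compilation to counter programs *)

(** The last three are guards, which block when they fail. Branching is nondeterministic, by [Alt]
    and [Star], and only executions that succeed count. *)
Inductive instr (m : nat) : Type :=
| IZero (r : nat)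
| ICopy (r t : nat)
| IInc (r : nat)
| IEq (r t : nat)
| ITest (r : nat) (b : bool)
| IRead (o : 'I_m) (r : nat) (b : bool).
Arguments IZero {m}.
Arguments ICopy {m}.
Arguments IInc {m}.
Arguments IEq {m}.
Arguments ITest {m}.

Definition upd (s : nat -> nat) (r x : nat) : nat -> nat :=
  fun i => if i == r then x else s i.

Definition istep m (O : 'I_m -> nat -> bool) (i : instr m) (s s' : nat -> nat) :=
  match i with
  | IZero r => s' = upd s r 0
  | ICopy r t => s' = upd s r (s t)
  | IInc r => s' = upd s r (s r).+1
  | IEq r t => s' = s /\ s r = s t
  | ITest r b => s' = s /\ (s r == 0) = b
  | IRead o r b => s' = s /\ O o (s r) = b
  end.

Inductive prog (m : nat) : Type :=
| Prim (i : instr m)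
| Seq (p q : prog m)
| Alt (p q : prog m)
| Star (p : prog m).

Inductive star T (R : T -> T -> Prop) : T -> T -> Prop :=
| star_refl x : star R x x
| star_step x y z : R x y -> star R y z -> star R x z.

Lemma star_trans T (R : T -> T -> Prop) x y z :
  star R x y -> star R y z -> star R x z.
Proof. by elim=> // a b c ab _ IH /IH; apply: star_step. Qed.

Lemma star1 T (R : T -> T -> Prop) x y : R x y -> star R x y.
Proof. by move=> h; apply: star_step h _; apply: star_refl. Qed.

Fixpoint exec m (O : 'I_m -> nat -> bool) (p : prog m) :
    (nat -> nat) -> (nat -> nat) -> Prop :=
  match p with
  | Prim i => istep O i
  | Seq p q => fun s s' => exists2 s'', exec O p s s'' & exec O q s'' s'
  | Alt p q => fun s s' => exec O p s s' \/ exec O q s s'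
  | Star p => star (exec O p)
  end.

Definition Skip m : prog m := Prim (IEq 0 0).

(* [compile c args dst fr] leaves in [dst] the value of [c] at the registers
   [args]; its temporaries are the registers from [fr] on. *)
Fixpoint compile m n (c : recf m n) : n.-tuple nat -> nat -> nat -> prog m :=
  match c in recf _ n0 return n0.-tuple nat -> nat -> nat -> prog m with
  | RZero n => fun _ dst _ => Prim (IZero dst)
  | RSucc => fun args dst _ =>
      Seq (Prim (ICopy dst (thead args))) (Prim (IInc dst))
  | RProj n i => fun args dst _ => Prim (ICopy dst (tnth args i))
  | ROracle o => fun args dst _ =>
      Alt (Seq (Prim (IRead o (thead args) false)) (Prim (IZero dst)))
          (Seq (Prim (IRead o (thead args) true))
            (Seq (Prim (IZero dst)) (Prim (IInc dst))))
  | RComp k n f g => fun args dst fr =>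
      Seq (foldr (fun i p => Seq (compile (g i) args (fr + val i) (fr + k)) p)
                 (Skip m) (enum 'I_k))
          (compile f [tuple fr + val i | i < k] dst (fr + k))
  | RPrec n f g => fun args dst fr =>
      let v := [tuple of behead args] in
      Seq (compile f v fr fr.+2)
      (Seq (Prim (IZero fr.+1))
      (Seq (Star (Seq (compile g [tuple of fr.+1 :: fr :: v] fr fr.+2)
                      (Prim (IInc fr.+1))))
      (Seq (Prim (IEq fr.+1 (thead args))) (Prim (ICopy dst fr)))))
  | RMin n f => fun args dst fr =>
      let p := compile f [tuple of fr :: args] fr.+1 fr.+2 in
      Seq (Prim (IZero fr))
      (Seq (Star (Seq p (Seq (Prim (ITest fr.+1 false)) (Prim (IInc fr)))))
      (Seq p (Seq (Prim (ITest fr.+1 true)) (Prim (ICopy dst fr)))))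
  end.

Section Compile.
Variables (m : nat) (O : 'I_m -> nat -> bool).
Let fs : m.-tuple (nat -> nat) := [tuple (fun x => O i x : nat) | i < m].

Definition vals n (s : nat -> nat) (args : n.-tuple nat) : n.-tuple nat :=
  [tuple of map s args].

Lemma eq_vals n s s' fr (args : n.-tuple nat) :
  all (fun a => a < fr) args -> agree fr s s' -> vals s args = vals s' args.
Proof.
move=> /allP ha h; apply: val_inj; apply/eq_in_map => a ain.
by apply: h; apply: ha.
Qed.

Lemma upd_same s r x : upd s r x r = x.
Proof. by rewrite /upd eqxx. Qed.

Lemma upd_other s r x i : i != r -> upd s r x i = s i.
Proof. by rewrite /upd => /negbTE ->. Qed.

Lemma all_tnth n (args : n.-tuple nat) fr i :
  all (fun a => a < fr) args -> tnth args i < fr.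
Proof. by move/all_tnthP; apply. Qed.

Lemma all_behead n (args : n.+1.-tuple nat) fr :
  all (fun a => a < fr) args -> all (fun a => a < fr) (behead args).
Proof. by rewrite {1}(tuple_eta args) /= => /andP []. Qed.

Lemma all_ltn_le (s : seq nat) a b : a <= b ->
  all (fun x => x < a) s -> all (fun x => x < b) s.
Proof. by move=> h; apply: sub_all => x hx; apply: leq_trans h. Qed.

Lemma vals_cons n s a (args : n.-tuple nat) :
  vals s [tuple of a :: args] = [tuple of s a :: vals s args].
Proof. exact: val_inj. Qed.

Lemma vals_behead n s (args : n.+1.-tuple nat) :
  [tuple of behead (vals s args)] = vals s [tuple of behead args].
Proof. by apply: val_inj; rewrite /= behead_map. Qed.

Lemma thead_vals n s (args : n.+1.-tuple nat) :
  thead (vals s args) = s (thead args).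
Proof. by rewrite /thead tnth_map. Qed.

Definition keeps fr dst (s s' : nat -> nat) :=
  forall r, r < fr -> r != dst -> s' r = s r.

(** Of the registers below [fr + k], the program for argument [i] changes only [fr + i], so inputs
    and earlier results survive. *)
Lemma args_sound k n (g : 'I_k -> recf m n) (p : 'I_k -> prog m)
    (args : n.-tuple nat) fr s s1 :
  all (fun a => a < fr) args ->
  (forall i s s', exec O (p i) s s' ->
     rec_eval fs (g i) (vals s args) (s' (fr + i)) /\
     keeps (fr + k) (fr + i) s s') ->
  exec O (foldr (fun i => Seq (p i)) (Skip m) (enum 'I_k)) s s1 ->
  agree fr s s1 /\ forall i, rec_eval fs (g i) (vals s args) (s1 (fr + i)).
Proof.
move=> ha hp h1.
have hd i : fr + val (i : 'I_k) < fr + k by rewrite ltn_add2l; exact: ltn_ord.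
suff [ag ev] : agree fr s s1 /\ forall i, i \in enum 'I_k ->
    rec_eval fs (g i) (vals s args) (s1 (fr + i)).
  by split=> // i; apply: ev; rewrite mem_enum.
elim: (enum 'I_k) (enum_uniq 'I_k) s h1 => [|j l IHl] /=.
  by move=> _ s0 [-> _]; split=> // i; rewrite in_nil.
move=> /andP [jl ul] s0 [s2 h3 h4].
have [ev0 kp0] := hp _ _ _ h3.
have ag : agree fr s0 s2.
  move=> r hr; rewrite kp0 ?(leq_trans hr (leq_addr _ _)) //.
  by rewrite ltn_eqF // (leq_trans hr) // leq_addr.
have [ag' ev'] := IHl ul _ h4; split; first exact: agree_trans ag ag'.
have ev1 i : i \in l -> rec_eval fs (g i) (vals s0 args) (s1 (fr + i)).
  by move=> /ev'; rewrite (eq_vals ha ag).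
have keepj : s1 (fr + j) = s2 (fr + j).
  elim: l jl {IHl ul ev' ev1} s2 h4 {h3 ev0 kp0 ag ag'} => [|i l IHl] /=.
    by move=> _ s2 [-> _].
  rewrite inE negb_or => /andP [ji jl] s2 [s3 h5 h6].
  rewrite (IHl jl _ h6); have [_ kp3] := hp _ _ _ h5.
  by apply: kp3; [exact: hd|rewrite eqn_add2l].
move=> i; rewrite inE => /predU1P [->|]; last exact: ev1.
by rewrite keepj.
Qed.

Lemma compile_sound n (c : recf m n) (args : n.-tuple nat) dst fr s s' :
  all (fun a => a < fr) args -> dst < fr ->
  exec O (compile c args dst fr) s s' ->
  rec_eval fs c (vals s args) (s' dst) /\ keeps fr dst s s'.
Proof.
elim: c args dst fr s s' => {n} [n|| n i|i|k n f IHf g IHg|n f IHf g IHg|n f IHf]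
    args dst fr s s' ha hd /=.
- by move=> ->; rewrite upd_same; split=> // r _ hr; rewrite upd_other.
- move=> [s1 ->] ->; rewrite !upd_same thead_vals; split=> // r _ hr.
  by rewrite !upd_other.
- by move=> ->; rewrite upd_same tnth_map; split=> // r _ hr; rewrite upd_other.
- rewrite tnth_mktuple thead_vals; case=> [[_ [-> h] ->]|[_ [-> h] [_ -> ->]]].
    by rewrite upd_same h; split=> // r _ hr; rewrite upd_other.
  by rewrite !upd_same h; split=> // r _ hr; rewrite !upd_other.
- move=> [s1 h1 h2].
  have hd' i : fr + val (i : 'I_k) < fr + k by rewrite ltn_add2l; exact: ltn_ord.
  have haf : all (fun a => a < fr + k) args.
    by apply: all_ltn_le ha; rewrite leq_addr.
  have htmp : all (fun a => a < fr + k) [tuple fr + val i | i < k].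
    by apply/all_tnthP => i; rewrite tnth_mktuple.
  have [ev kp] := IHf _ _ _ _ _ htmp (leq_trans hd (leq_addr _ _)) h2.
  have [ag ev'] := args_sound ha (fun i s s' => IHg i _ _ _ s s' haf (hd' i)) h1.
  split; last first.
    move=> r hr nr; rewrite kp ?ag //; exact: leq_trans hr (leq_addr _ _).
  exists (vals s1 [tuple fr + val i | i < k]); last exact: ev.
  by move=> i; rewrite tnth_map tnth_mktuple; apply: ev'.
- set v := [tuple of behead args] => -[s1 h1 [_ -> [s2 h2 [_ [-> e] ->]]]].
  have hv : all (fun a => a < fr) v by apply: all_behead.
  have hv2 : all (fun a => a < fr.+2) v by apply: all_ltn_le hv; lia.
  have hv3 : all (fun a => a < fr.+2) [tuple of fr.+1 :: fr :: v].
    by rewrite /= !ltnS leqnn leqnSn.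
  have [ev kp] := IHf _ _ _ _ _ hv2 (leqnSn fr.+1) h1.
  have ag1 : agree fr s (upd s1 fr.+1 0).
    by move=> r hr; rewrite upd_other ?kp //; lia.
  rewrite upd_same thead_vals vals_behead -/v.
  (* Loop invariant: [fr] holds the value of the recursion at the counter in [fr.+1]. *)
  suff [hp ag2] : prec_graph (rec_eval fs f) (rec_eval fs g) (vals s v)
      (s2 fr.+1) (s2 fr) /\ agree fr s s2.
    split; last by move=> r hr nr; rewrite upd_other // ag2.
    by rewrite ag2 -?e //; apply: all_tnth.
  have hp1 : prec_graph (rec_eval fs f) (rec_eval fs g) (vals s v)
      (upd s1 fr.+1 0 fr.+1) (upd s1 fr.+1 0 fr).
    by rewrite upd_same upd_other //; lia.
  elim: h2 ag1 hp1 {e} => [x ag hp|x y z [y' h3 -> h4] IH ag hp] //.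
  have [ev3 kp3] := IHg _ _ _ _ _ hv3 (leqnSn fr.+1) h3.
  apply: IH.
    by move=> r hr; rewrite upd_other ?kp3 ?ag //; lia.
  rewrite upd_same upd_other; last by lia.
  exists (x fr); first by rewrite kp3 //; lia.
  by move: ev3; rewrite !vals_cons -(eq_vals hv ag) (kp3 fr.+1) //; lia.
- set p := compile _ _ _ _ => -[_ -> [s1 h1 [s2 h2 [_ [-> /eqP t0] ->]]]].
  have hv3 : all (fun a => a < fr.+2) [tuple of fr :: args].
    rewrite /= leqnSn; apply: all_ltn_le ha; lia.
  have step x y : exec O p x y ->
      rec_eval fs f [tuple of x fr :: vals x args] (y fr.+1) /\ agree fr.+1 x y.
    move=> h; have [ev kp] := IHf _ _ _ _ _ hv3 (ltnSn fr.+1) h.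
    split; first by rewrite -vals_cons.
    by move=> r hr; rewrite kp //; lia.
  have [ev2 ag2] := step _ _ h2.
  (* Search invariant: the value is positive at every argument below the counter in [fr]. *)
  have main : agree fr s s1 /\ forall x, x < s1 fr ->
      exists z, rec_eval fs f [tuple of x :: vals s args] z.+1.
    have : agree fr s (upd s fr 0) /\ forall x, x < upd s fr 0 fr ->
        exists z, rec_eval fs f [tuple of x :: vals s args] z.+1.
      split; last by rewrite upd_same.
      by move=> r hr; rewrite upd_other //; lia.
    elim: h1 {h2 ev2 ag2} => // x y z [x1 h3 [_ [-> nz] ->]] _ IH [ag hx].
    have [ev ag3] := step _ _ h3.
    apply: IH; split.
      move=> r hr; rewrite upd_other; last by lia.
      by rewrite ag // ag3 //; lia.
    move=> w; rewrite upd_same -(ag3 fr) // ltnS leq_eqVlt.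
    move=> /orP [/eqP ->|]; last exact: hx.
    exists (x1 fr.+1).-1; rewrite (eq_vals ha ag).
    by move: nz ev; case: (x1 _).
  case: main => ag hx; rewrite upd_same; split.
    rewrite -(ag2 fr) // in hx *; rewrite t0 -(eq_vals ha ag) in ev2.
    by split.
  move=> r hr nr; rewrite upd_other // ag // -ag2 //; lia.
Qed.

Lemma compile_complete n (c : recf m n) (args : n.-tuple nat) dst fr s y :
  all (fun a => a < fr) args -> dst < fr ->
  rec_eval fs c (vals s args) y ->
  exists2 s', exec O (compile c args dst fr) s s' & s' dst = y.
Proof.
move=> ha hd hy.
(* Only termination is left, since soundness and determinism give the value. *)
suff [s' hs'] : exists s', exec O (compile c args dst fr) s s'.
  exists s' => //; have [ev _] := compile_sound ha hd hs'.
  exact: rec_eval_det ev hy.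
elim: c args dst fr s y ha hd hy =>
    {n} [n|| n i|i|k n f IHf g IHg|n f IHf g IHg|n f IHf]
    args dst fr s y ha hd.
- by move=> _; eexists.
- by move=> _; eexists; eexists.
- by move=> _; eexists.
- move=> _ /=; case E : (O i (s (thead args))).
    by eexists; right; eexists; [split|eexists].
  by eexists; left; eexists; [split|].
- move=> [w hw0 hf].
  have {hw0}hw i : rec_eval fs (g i) (vals s args) (tnth w i) by exact: hw0.
  have {}hf : rec_eval fs f w y by exact: hf.
  have hd' i : fr + val (i : 'I_k) < fr + k by rewrite ltn_add2l; exact: ltn_ord.
  have haf : all (fun a => a < fr + k) args.
    by apply: all_ltn_le ha; rewrite leq_addr.
  have htmp : all (fun a => a < fr + k) [tuple fr + val i | i < k].
    by apply/all_tnthP => i; rewrite tnth_mktuple.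
  have [s1 h1] : exists s1, exec O (foldr (fun i =>
      Seq (compile (g i) args (fr + val i) (fr + k)))
                 (Skip m) (enum 'I_k)) s s1.
    (* The start is generalised to any state equal to [s] below [fr], because earlier arguments have
       changed temporaries. *)
    move: (@agree_refl _ fr s); move: {2 3}s.
    elim: (enum 'I_k) => [|i l IHl] s0 ag; first by exists s0.
    have := hw i; rewrite (eq_vals ha ag) => /(IHg _ _ _ _ _ _ haf (hd' i)) [s2 h2].
    have [_ kp] := compile_sound haf (hd' i) h2.
    have [|s3 h3] := IHl s2.
      move=> r hr; rewrite ag // kp ?(leq_trans hr (leq_addr _ _)) //.
      by rewrite ltn_eqF // (leq_trans hr) // leq_addr.
    by exists s3; exists s2.
  have [_ ev] := args_sound ha
    (fun i s s' => @compile_sound _ (g i) _ _ _ s s' haf (hd' i)) h1.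
  have eqw : w = vals s1 [tuple fr + val i | i < k].
    apply: eq_from_tnth => i; rewrite tnth_map tnth_mktuple.
    exact: rec_eval_det (hw i) (ev i).
  have := hf; rewrite eqw => /(IHf _ _ _ _ _ htmp (leq_trans hd (leq_addr _ _))).
  by move=> [s' h']; exists s'; exists s1.
- set v := [tuple of behead args].
  have hv : all (fun a => a < fr) v by apply: all_behead.
  have hv2 : all (fun a => a < fr.+2) v by apply: all_ltn_le hv; lia.
  have hv3 : all (fun a => a < fr.+2) [tuple of fr.+1 :: fr :: v].
    by rewrite /= !ltnS leqnn leqnSn.
  rewrite /= thead_vals vals_behead -/v => hy.
  suff [s1 [s2 [[h1 h2] ag2 e2 _]]] : exists s1 s2,
      [/\ exec O (compile f v fr fr.+2) s s1 /\
      star (exec O (Seq (compile g [tuple of fr.+1 :: fr :: v] fr fr.+2)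
         (Prim (IInc fr.+1)))) (upd s1 fr.+1 0) s2,
      agree fr s s2, s2 fr.+1 = s (thead args) & s2 fr = y].
    exists (upd s2 dst (s2 fr)); exists s1 => //; eexists; first by [].
    exists s2 => //; exists s2 => //=; split=> //.
    by rewrite e2 ag2 //; apply: all_tnth.
  elim: (s (thead args)) y hy => [|k IH] y /=.
    move=> hy; have [s1 h1] := IHf _ _ _ _ _ hv2 (leqnSn fr.+1) hy.
    have [ev kp] := compile_sound hv2 (leqnSn fr.+1) h1.
    exists s1, (upd s1 fr.+1 0); split.
    - by split=> //; exact: star_refl.
    - by move=> r hr; rewrite upd_other ?kp //; lia.
    - by rewrite upd_same.
    - rewrite upd_other; last by lia.
      exact: rec_eval_det ev hy.
  move=> [z hz hy]; have [s1 [s2 [[h1 h2] ag2 e2 ez]]] := IH _ hz.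
  have ev3 : rec_eval fs g (vals s2 [tuple of fr.+1 :: fr :: v]) y.
    by rewrite !vals_cons -(eq_vals hv ag2) ez e2.
  have [s3 h3] := IHg _ _ _ _ _ hv3 (leqnSn fr.+1) ev3.
  have [ev kp3] := compile_sound hv3 (leqnSn fr.+1) h3.
  exists s1, (upd s3 fr.+1 (s3 fr.+1).+1); split.
  - by split=> //; apply: star_trans h2 _; apply: star1; exists s3.
  - by move=> r hr; rewrite upd_other ?kp3 ?ag2 //; lia.
  - by rewrite upd_same kp3 ?e2 //; lia.
  - rewrite upd_other; last by lia.
    exact: rec_eval_det ev ev3.
- move=> [h0 hlt].
  have {}h0 : rec_eval fs f [tuple of y :: vals s args] 0 by exact: h0.
  have {}hlt x : x < y -> exists z, rec_eval fs f [tuple of x :: vals s args] z.+1.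
    exact: hlt.
  have hv3 : all (fun a => a < fr.+2) [tuple of fr :: args].
    rewrite /= leqnSn; apply: all_ltn_le ha; lia.
  set p := compile f [tuple of fr :: args] fr.+1 fr.+2.
  have step x z : agree fr s x ->
      rec_eval fs f [tuple of x fr :: vals s args] z ->
      exists x', [/\ exec O p x x', x' fr.+1 = z & agree fr.+1 x x'].
    move=> ag; rewrite (eq_vals ha ag) -vals_cons => ev.
    have [x' hx] := IHf _ _ _ _ _ hv3 (ltnSn fr.+1) ev.
    have [ev' kp] := compile_sound hv3 (ltnSn fr.+1) hx.
    exists x'; split=> //; first exact: rec_eval_det ev' ev.
    by move=> r hr; rewrite kp //; lia.
  have [s1 [h1 ag1 e1]] : exists s1, [/\
      star (exec O (Seq p (Seq (Prim (ITest fr.+1 false)) (Prim (IInc fr)))))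
           (upd s fr 0) s1, agree fr s s1 & s1 fr = y].
    elim: y hlt {h0} => [|k IH] hlt.
      exists (upd s fr 0); split; [exact: star_refl| |by rewrite upd_same].
      by move=> r hr; rewrite upd_other //; lia.
    have [|s1 [h1 ag1 e1]] := IH; first by move=> x hx; apply: hlt; lia.
    have [z hz] := hlt k (ltnSn k); rewrite -e1 in hz.
    have [x' [hx ex agx]] := step _ _ ag1 hz.
    exists (upd x' fr (x' fr).+1); split.
    - apply: star_trans h1 _; apply: star1; exists x' => //.
      by exists x' => //=; rewrite ex.
    - by move=> r hr; rewrite upd_other ?ag1 ?agx //; lia.
    - by rewrite upd_same -agx // e1.
  rewrite -e1 in h0; have [s2 [h2 e2 ag2]] := step _ _ ag1 h0.
  exists (upd s2 dst (s2 fr)); exists (upd s fr 0) => //.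
  by exists s1 => //; exists s2 => //; exists s2 => //=; rewrite e2.
Qed.

End Compile.

(** * Execution of programs *)

HB.instance Definition _ m := gen_eqMixin (prog m).
HB.instance Definition _ m := gen_choiceMixin (prog m).

(* A program in execution is the stack of the programs that remain to be run. *)
Definition nexts m (K : seq (prog m)) : seq (seq (prog m)) :=
  match K with
  | [::] => [::]
  | Prim _ :: K => [:: K]
  | Seq p q :: K => [:: p :: q :: K]
  | Alt p q :: K => [:: p :: K; q :: K]
  | Star p :: K => [:: K; p :: Star p :: K]
  end.

Definition action m (K : seq (prog m)) : option (instr m) :=
  if K is Prim i :: _ then Some i else None.

Definition ostep m (O : 'I_m -> nat -> bool) (a : option (instr m)) s s' :=
  if a is Some i then istep O i s s' else s' = s.

Definition sstep m (O : 'I_m -> nat -> bool)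
    (x y : seq (prog m) * (nat -> nat)) : Prop :=
  y.1 \in nexts x.1 /\ ostep O (action x.1) x.2 y.2.

Inductive reach T (R : T -> T -> Prop) : nat -> T -> T -> Prop :=
| reach0 x : reach R 0 x x
| reachS n x y z : R x y -> reach R n y z -> reach R n.+1 x z.

Lemma reach_add T (R : T -> T -> Prop) n n' x y z :
  reach R n x y -> reach R n' y z -> reach R (n + n') x z.
Proof.
by elim=> // {n y}n a b c ab _ IH /IH; rewrite addSn; apply: reachS ab.
Qed.

Lemma reach_inv T (R : T -> T -> Prop) n y z : reach R n y z ->
  if n is n'.+1 then exists2 b, R y b & reach R n' b z else y = z.
Proof. by case=> // {y}k y b z' h1 h2; exists b. Qed.

(** At least one step is taken, so gluing infinitely many executions does not stall. *)
Lemma exec_reach m (O : 'I_m -> nat -> bool) p K s s' : exec O p s s' ->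
  exists n, reach (sstep O) n.+1 (p :: K, s) (K, s').
Proof.
elim: p K s s' => [i|p IHp q IHq|p IHp q IHq|p IHp] K s s' /=.
- move=> h; exists 0; apply: reachS (reach0 _ _).
  by split; rewrite /= ?inE.
- move=> [s1 /(IHp (q :: K)) [n h1] /(IHq K) [n' h2]].
  exists (n.+1 + n'.+1); apply: reachS (reach_add h1 h2).
  by split; rewrite /= ?inE.
- by case=> [/(IHp K)|/(IHq K)] [n h]; exists n.+1; apply: reachS h;
    split; rewrite /= ?inE ?eqxx ?orbT.
- elim=> {s s'} [s|s s1 s2 /(IHp (Star p :: K)) [n h] _ [n' h']].
    by exists 0; apply: reachS (reach0 _ _); split; rewrite /= ?inE ?eqxx.
  exists (n.+1 + n'.+1); apply: reachS (reach_add h h').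
  by split; rewrite /= ?inE ?eqxx ?orbT.
Qed.

Lemma infinite_run T (R : T -> T -> Prop) (x : nat -> T) :
  (forall k, exists n, reach R n.+1 (x k) (x k.+1)) ->
  exists y, [/\ y 0 = x 0, forall t, R (y t) (y t.+1) &
    forall t, exists t' k, t <= t' /\ y t' = x k].
Proof.
move=> /choice [N hN].
(* State of the gluing: the current point, the index of the next target and the number of steps left
   to it. *)
have /choice [F hF] : forall u : T * nat * nat, exists v : T * nat * nat,
    reach R u.2 u.1.1 (x u.1.2) ->
    [/\ R u.1.1 v.1.1, reach R v.2 v.1.1 (x v.1.2) &
        u.2 <> 0 -> v.2 = u.2.-1].
  move=> [[a k] n] /=; case: (pselect (reach R n a (x k))) => hr; last first.
    by exists (a, k, 0) => /hr.
  case: n hr => [|n] hr.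
  - have [b h1 h2] := reach_inv (hN k); rewrite (reach_inv hr).
    by exists (b, k.+1, N k).
  - have [b h1 h2] := reach_inv hr.
    by exists (b, k, n).
pose S t := iter t F (x 0, 0, 0).
have inv t : reach R (S t).2 (S t).1.1 (x (S t).1.2).
  by elim: t => [|t IH] /=; [exact: reach0|have [] := hF _ IH].
exists (fun t => (S t).1.1); split=> //.
  by move=> t; have [] := hF _ (inv t).
move=> t; have [n hn] : exists n, (S t).2 = n by eexists.
elim: n t hn => [|n IH] t hn.
  exists t, (S t).1.2; split=> //; move: (inv t).
  by rewrite hn => h; exact: reach_inv h.
have [_ _ hd] := hF _ (inv t).
have [|t' [k [le e]]] := IH t.+1; first by rewrite /= hd hn.
by exists t', k; split=> //; apply: ltnW.
Qed.

Section Runs.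
Variables (m : nat) (O : 'I_m -> nat -> bool).
Variables (K : nat -> seq (prog m)) (s : nat -> nat -> nat).
Hypothesis run : forall t, sstep O (K t, s t) (K t.+1, s t.+1).

(** The stack stays higher than [L] until [p] is used up, so a return to that height certifies a
    complete execution of [p]. *)
Lemma run_exec p L t n : K t = p :: L -> size (K (t + n)) <= size L ->
  exists k, [/\ 0 < k <= n, K (t + k) = L & exec O p (s t) (s (t + k))].
Proof.
elim/ltn_ind: n t p L => n IH t p L hK hs.
case: n => [|n] in IH hs *.
  by rewrite addn0 hK /= ltnn in hs.
rewrite -addSnnS in hs.
have [hn hst] := run t; rewrite hK /= in hn hst.
case: p hn hst hK => [i|p q|p q|p] /=; rewrite ?inE.
- move=> /eqP hL hi hK; exists 1; rewrite addn1; split=> //.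
- move=> /eqP hL e hK.
  have [|k [/andP[k0 kn] h1 h2]] := IH n (ltnSn n) _ _ _ hL.
    by apply: leq_trans hs _; rewrite /= leqnSn.
  have lt : n - k < n.+1 by lia.
  have [|k' [/andP[k0' kn'] h1' h2']] := IH (n - k) lt _ _ _ h1.
    by rewrite -addnA subnKC.
  exists (k + k').+1; rewrite -addSnnS addnA; split=> //; first by lia.
  by exists (s (t.+1 + k)) => //; rewrite -e.
- by move=> /orP [] /eqP hL e hK;
    have [k [/andP[k0 kn] h1 h2]] := IH n (ltnSn n) _ _ _ hL hs;
    exists k.+1; rewrite -addSnnS; split=> //; rewrite -e; [left|right].
- move=> /orP [] /eqP hL e hK.
    exists 1; rewrite addn1 e; split=> //; exact: star_refl.
  have [|k [/andP[k0 kn] h1 h2]] := IH n (ltnSn n) _ _ _ hL.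
    by apply: leq_trans hs _; rewrite /= leqnSn.
  have lt : n - k < n.+1 by lia.
  have [|k' [/andP[k0' kn'] h1' h2']] := IH (n - k) lt _ _ _ h1.
    by rewrite -addnA subnKC.
  exists (k + k').+1; rewrite -addSnnS addnA; split=> //; first by lia.
  by apply: star_step h2'; rewrite -e.
Qed.

Lemma run_loop p t t' : t < t' -> K t = [:: Star p] -> K t' = [:: Star p] ->
  exists t1, [/\ t < t1, K t1 = [:: Star p] & exec O p (s t) (s t1)].
Proof.
move=> tt' hK hK'; have [hn e] := run t.
rewrite hK /= !inE in hn e; case/orP: hn => /eqP hn.
  (* Leaving the loop empties the stack, which has no successor. *)
  by have [] := run t.+1; rewrite hn.
have [|k [/andP [k0 _] h1 h2]] := run_exec (n := t' - t.+1) hn.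
  by rewrite subnKC // hK'.
exists (t.+1 + k); split=> //; first by lia.
by rewrite -e.
Qed.

End Runs.

Section Main.
Variables (m : nat) (c : recf m 2).

(** Register 0 is the bound variable [k], 1 the input, 2 the value of [c], 3 the constant 1. A value
    other than 1 blocks at [IEq 2 3]; otherwise [k] is increased. *)
Definition loop_body : prog m :=
  Seq (compile c [tuple 0; 1] 2 4)
    (Seq (Prim (IZero 3)) (Seq (Prim (IInc 3))
      (Seq (Prim (IEq 2 3)) (Prim (IInc 0))))).

Definition main_loop : seq (prog m) := [:: Star loop_body].

Variable O : 'I_m -> nat -> bool.
Let fs : m.-tuple (nat -> nat) := [tuple (fun x => O i x : nat) | i < m].

Lemma loop_body_sound s s' : exec O loop_body s s' ->
  [/\ rec_eval fs c [tuple s 0; s 1] 1, s' 0 = (s 0).+1 & s' 1 = s 1].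
Proof.
move=> [s1 h1 [_ -> [_ -> [_ [-> e] ->]]]].
have [ev kp] := compile_sound (args := [tuple 0; 1]) (dst := 2) (fr := 4) isT isT h1.
rewrite /upd /= in e *; rewrite e in ev; rewrite !kp //; split=> //.
have <- // : vals s [tuple 0; 1] = [tuple s 0; s 1] by exact: val_inj.
Qed.

Lemma loop_body_complete s : rec_eval fs c [tuple s 0; s 1] 1 ->
  exists2 s', exec O loop_body s s' & s' 0 = (s 0).+1 /\ s' 1 = s 1.
Proof.
have <- : vals s [tuple 0; 1] = [tuple s 0; s 1] by exact: val_inj.
move=> /(compile_complete (args := [tuple 0; 1]) (dst := 2) (fr := 4) isT isT) [s1 h1 e].
suff [s' h] : exists s', exec O loop_body s s'.
  by exists s' => //; have [] := loop_body_sound h.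
eexists; exists s1 => //; eexists; first by [].
by eexists; first by []; eexists; [split; [|rewrite /upd]|].
Qed.

(** Recurrence of [main_loop] excludes runs that stay forever inside one evaluation, so register 0
    passes through all numbers. *)
Lemma main_loopP x :
  (exists K s, [/\ K 0 = main_loop, s 0 = upd (fun=> 0) 1 x,
     forall t, sstep O (K t, s t) (K t.+1, s t.+1) &
     forall t, exists t', t <= t' /\ K t' = main_loop]) <->
  forall k, rec_eval fs c [tuple k; x] 1.
Proof.
split=> [[K [s [K0 s0 run inf]]]|hc].
  have h k : exists t, [/\ K t = main_loop, s t 0 = k & s t 1 = x].
    elim: k => [|k [t [hK h0 h1]]]; first by exists 0; rewrite K0 s0.
    have [t' [tt' hK']] := inf t.+1.
    have [t1 [_ hK1 /loop_body_sound [_ e0 e1]]] := run_loop run tt' hK hK'.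
    by exists t1; rewrite e0 e1 h0 h1.
  move=> k; have [t [hK h0 h1]] := h k.
  have [t' [tt' hK']] := inf t.+1.
  have [t1 [_ hK1 /loop_body_sound []]] := run_loop run tt' hK hK'.
  by rewrite h0 h1.
have /choice [F hF] : forall s, exists s', s 1 = x ->
    [/\ exec O loop_body s s', s' 0 = (s 0).+1 & s' 1 = x].
  move=> s; case: (pselect (s 1 = x)) => h1; last by exists s.
  have : rec_eval fs c [tuple s 0; s 1] 1 by rewrite h1.
  by move/loop_body_complete => [s' h [e0 e1]]; exists s'; rewrite e1.
pose S k := iter k F (upd (fun=> 0) 1 x).
have S1 k : S k 1 = x by elim: k => //= k /hF [].
have [|y [y0 yR inf]] := @infinite_run _ (sstep O) (fun k => (main_loop, S k)).
  move=> k; have [h _ _] := hF _ (S1 k).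
  have [n hn] := exec_reach main_loop h; exists n.+1; apply: reachS hn.
  by split; rewrite /= ?inE ?eqxx ?orbT.
exists (fun t => (y t).1), (fun t => (y t).2); split.
- by rewrite y0.
- by rewrite y0.
- by move=> t; have := yR t; case: (y t) => ? ?; case: (y t.+1).
- by move=> t; have [t' [k [le e]]] := inf t; exists t'; rewrite e.
Qed.

End Main.

(** * Space-time diagrams *)

(** The stacks that occur while [p] runs on top of [K]. They are finitely many because a loop comes
    back to its own stack; so control is finite-state. *)
Fixpoint conts m (p : prog m) (K : seq (prog m)) : seq (seq (prog m)) :=
  (p :: K) :: match p with
  | Prim _ => [::]
  | Seq a b => conts a (b :: K) ++ conts b K
  | Alt a b => conts a K ++ conts b K
  | Star a => conts a (p :: K)
  end.

Lemma conts_head m (p : prog m) K : p :: K \in conts p K.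
Proof. by case: p => *; rewrite inE eqxx. Qed.

Lemma conts_next m (p : prog m) K L L' :
  L \in conts p K -> L' \in nexts L -> L' \in K :: conts p K.
Proof.
elim: p K L => [i|a IHa b IHb|a IHa b IHb|a IHa] K L /=; rewrite !inE.
- by move=> /eqP -> /=; rewrite !inE => ->.
- case/orP => [/eqP ->|].
    by rewrite /= inE => /eqP ->; rewrite mem_cat conts_head !orbT.
  rewrite mem_cat => /orP [/IHa h /h|/IHb h /h]; rewrite inE mem_cat.
    by case/orP => [/eqP ->|->]; rewrite ?conts_head ?orbT.
  by case/orP => ->; rewrite ?orbT.
- case/orP => [/eqP ->|].
    by rewrite /= !inE => /orP [] /eqP ->; rewrite mem_cat conts_head !orbT.
  by rewrite mem_cat => /orP [/IHa h /h|/IHb h /h]; rewrite inE mem_cat;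
    case/orP => ->; rewrite ?orbT.
- case/orP => [/eqP ->|/IHa h /h].
    by rewrite /= !inE => /orP [] /eqP ->; rewrite ?eqxx ?conts_head ?orbT.
  by rewrite inE => /orP [/eqP ->|->]; rewrite ?eqxx ?orbT.
Qed.

Definition reg_bound m (i : instr m) : nat :=
  match i with
  | IZero r => r.+1
  | ICopy r t => maxn r.+1 t.+1
  | IInc r => r.+1
  | IEq r t => maxn r.+1 t.+1
  | ITest r _ => r.+1
  | IRead _ r _ => r.+1
  end.

Fixpoint regs_lt m R (p : prog m) : bool :=
  match p with
  | Prim i => reg_bound i <= R
  | Seq a b | Alt a b => regs_lt R a && regs_lt R b
  | Star a => regs_lt R a
  end.

Lemma regs_lt_mono m R R' (p : prog m) : R <= R' -> regs_lt R p -> regs_lt R' p.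
Proof.
move=> h; elim: p => //= [i|a IHa b IHb|a IHa b IHb].
- by move/leq_trans; apply.
- by case/andP => /IHa -> /IHb ->.
- by case/andP => /IHa -> /IHb ->.
Qed.

Lemma regs_lt_exists m (p : prog m) : exists R, regs_lt R p.
Proof.
elim: p => /= [i|a [R hR] b [R' hR']|a [R hR] b [R' hR']|//].
- by exists (reg_bound i).
- by exists (maxn R R'); rewrite (regs_lt_mono (leq_maxl _ _) hR)
    (regs_lt_mono (leq_maxr _ _) hR').
- by exists (maxn R R'); rewrite (regs_lt_mono (leq_maxl _ _) hR)
    (regs_lt_mono (leq_maxr _ _) hR').
Qed.

Lemma regs_lt_next m R (L L' : seq (prog m)) :
  all (regs_lt R) L -> L' \in nexts L -> all (regs_lt R) L'.
Proof.
case: L => [|[i|a b|a b|a] L] //=; rewrite !inE.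
- by move=> /andP [_ h] /eqP ->.
- by move=> /andP [/andP [ha hb] h] /eqP -> /=; rewrite ha hb.
- by move=> /andP [/andP [ha hb] h] /orP [] /eqP -> /=; rewrite ?ha ?hb.
- by move=> /andP [ha h] /orP [] /eqP -> /=; rewrite ?ha.
Qed.

Section Rows.
Variables (m R : nat) (L : seq (seq (prog m))).

(* A cell carries: whether it lies in column 0, the stack (the same along a
   row), one bit of the unary expansion of every register, and one bit of
   every oracle (the same along a column). *)
Definition label : finType :=
  (bool * seq_sub L * {ffun 'I_R -> bool} * {ffun 'I_m -> bool})%type.

Implicit Types l : label.
Definition left_flag l : bool := l.1.1.1.
Definition stack l : seq (prog m) := ssval l.1.1.2.
Definition reg l (r : nat) : bool :=
  if insub r is Some i then l.1.2 i else false.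
Definition track l (o : 'I_m) : bool := l.2 o.

Lemma label_exists fl (K : seq (prog m)) (b : nat -> bool) (t : 'I_m -> bool) :
  K \in L -> exists l, [/\ left_flag l = fl, stack l = K,
    forall r, r < R -> reg l r = b r & forall o, track l o = t o].
Proof.
move=> hK.
exists (fl, SeqSub hK, [ffun r : 'I_R => b r], [ffun o => t o]); split => //.
  by move=> r hr; rewrite /reg /= insubT ffunE.
by move=> o; rewrite /track ffunE.
Qed.

Definition same_reg l' l := forall r, r < R -> reg l' r = reg l r.

(* [l1'] and [l2'] lie above [l1] and its right neighbour [l2]. *)
Definition local_action (a : option (instr m)) (l1' l2' l1 l2 : label) : Prop :=
  match a with
  | None => same_reg l1' l1
  | Some (IZero r) =>
      forall q, q < R -> reg l1' q = if q == r then false else reg l1 q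
  | Some (ICopy r t) =>
      forall q, q < R -> reg l1' q = if q == r then reg l1 t else reg l1 q
  | Some (IInc r) =>
      [/\ forall q, q < R -> q != r -> reg l1' q = reg l1 q,
          reg l2' r = reg l1 r & left_flag l1 -> reg l1' r]
  | Some (IEq r t) => same_reg l1' l1 /\ reg l1 r = reg l1 t
  | Some (ITest r b) =>
      same_reg l1' l1 /\ (left_flag l1 -> ~~ reg l1 r = b)
  | Some (IRead o r b) =>
      [/\ same_reg l1' l1, left_flag l1 -> ~~ reg l1 r -> track l1 o = b &
          reg l1 r -> ~~ reg l2 r -> track l2 o = b]
  end.

Variable O : 'I_m -> nat -> bool.

(** Unary notation makes every instruction local: equality holds column by column, zero is seen in
    column 0, an increment is a shift to the right, and an oracle is read in the first column where
    the bit is false. *)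
Definition shows (row : nat -> label) (s : nat -> nat) :=
  forall i r, r < R -> reg (row i) r = (i < s r).

Lemma local_of_step (a : option (instr m)) (row row' : nat -> label) s s' :
  (if a is Some i then reg_bound i <= R else true) ->
  (forall i, left_flag (row i) = (i == 0)) ->
  (forall i o, track (row i) o = O o i) ->
  shows row s -> shows row' s' -> ostep O a s s' ->
  forall i, local_action a (row' i) (row' i.+1) (row i) (row i.+1).
Proof.
move=> ha hfl htr hs hs'; case: a ha => [[r|r t|r|r t|r b|o r b]|] /= ha.
- move=> es i q hq; rewrite hs' // hs // es /upd; by case: ifP; rewrite ?ltn0.
- move=> es i q hq; rewrite hs' // !hs // ?es /upd; last by lia.
  by case: ifP.
- move=> es i; split.
  + by move=> q hq /negbTE nq; rewrite hs' // hs // es /upd nq.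
  + by rewrite hs' // hs // es /upd eqxx ltnS.
  + by rewrite hfl => /eqP ->; rewrite hs' // es /upd eqxx.
- move=> [es e] i; split; first by move=> q hq; rewrite hs' // hs // es.
  by rewrite !hs ?e //; lia.
- move=> [es e] i; split; first by move=> q hq; rewrite hs' // hs // es.
  by rewrite hfl => /eqP ->; rewrite hs // -e lt0n negbK.
- move=> [es e] i; split; first by move=> q hq; rewrite hs' // hs // es.
    rewrite hfl => /eqP ->; rewrite hs // -eqn0Ngt htr => /eqP h0.
    by rewrite -e h0.
  rewrite !hs // -leqNgt htr => h1 h2; rewrite -e; congr (O o _); lia.
- by move=> es i q hq; rewrite hs' // hs // es.
Qed.

Lemma step_of_local (a : option (instr m)) (row row' : nat -> label) s :
  (if a is Some i then reg_bound i <= R else true) ->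
  (forall i, left_flag (row i) = (i == 0)) ->
  (forall i o, track (row i) o = O o i) ->
  shows row s ->
  (forall i, local_action a (row' i) (row' i.+1) (row i) (row i.+1)) ->
  exists2 s', ostep O a s s' & shows row' s'.
Proof.
move=> ha hfl htr hs; case: a ha => [[r|r t|r|r t|r b|o r b]|] /= ha hl.
- exists (upd s r 0) => // i q hq; rewrite hl // hs // /upd.
  by case: ifP; rewrite ?ltn0.
- exists (upd s r (s t)) => // i q hq; rewrite hl // !hs // /upd; last by lia.
  by case: ifP.
- exists (upd s r (s r).+1) => // i q hq; rewrite /upd; case: ifP => [/eqP ->|nq].
    case: i => [|i]; first by case: (hl 0) => _ _ ->; rewrite ?hfl.
    by case: (hl i) => _ -> _; rewrite hs.
  by case: (hl i) => h _ _; rewrite h ?hs ?nq.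
- exists s; last by move=> i q hq; case: (hl i) => h _; rewrite h ?hs.
  split=> //; apply/eqP; rewrite eqn_leq; apply/andP; split.
    (* If [s t < s r], the two bits differ in column [s t]; the other case is symmetric. *)
    rewrite leqNgt; apply/negP => lt; case: (hl (s t)) => _.
    by rewrite !hs ?lt ?ltnn //; lia.
  rewrite leqNgt; apply/negP => lt; case: (hl (s r)) => _.
  by rewrite !hs ?lt ?ltnn //; lia.
- exists s; last by move=> i q hq; case: (hl i) => h _; rewrite h ?hs.
  by split=> //; case: (hl 0) => _; rewrite hfl hs // lt0n negbK; apply.
- exists s; last by move=> i q hq; case: (hl i) => h _ _; rewrite h ?hs.
  (* The queried column is 0, or else [k.+1], recognised from column [k] as the place where the bit
     of [r] drops. *)
  split=> //; case E : (s r) => [|k].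
    by case: (hl 0) => _ + _; rewrite hfl hs // E htr; apply.
  by case: (hl k) => _ _; rewrite !hs // E ltnSn ltnn htr; apply.
- by exists s => // i q hq; rewrite hl // hs.
Qed.

End Rows.

Section LabelSystem.
Variable c : recf 2 2.

Lemma regs_lt_loop_exists : exists R, all (regs_lt R) (main_loop c).
Proof.
have [R hR] := regs_lt_exists (Star (loop_body c)).
by exists R; rewrite [all _ _]/= andbT.
Qed.

Variable R : nat.
Hypothesis hR : all (regs_lt R) (main_loop c).

Definition stacks : seq (seq (prog 2)) :=
  [::] :: conts (Star (loop_body c)) [::].

Lemma main_loop_stacks : main_loop c \in stacks.
Proof. by rewrite inE conts_head orbT. Qed.

Lemma stacks_next K K' : K \in stacks -> K' \in nexts K -> K' \in stacks.
Proof. by rewrite inE => /predU1P [->|h]; [|exact: conts_next h]. Qed.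

(** Oracle 1 is the input word; oracle 0 is guessed by the run. *)
Definition input_track : 'I_2 := lift ord0 ord0.

Definition init_label (first : bool) (letter x : bool)
    (l : label R stacks) : Prop :=
  [/\ left_flag l = first, stack l = main_loop c,
      forall r, r < R -> reg l r = (r == 1) && x &
      track l input_track = letter].

Definition step_label (first : bool) (l1' l2' l1 l2 : label R stacks) : Prop :=
  [/\ left_flag l1' = first, stack l1 = stack l2,
      stack l1' \in nexts (stack l1), forall o, track l1' o = track l1 o &
      local_action (action (stack l1)) l1' l2' l1 l2].

Definition label_run (X : nat -> bool) (x : nat)
    (l : nat -> nat -> label R stacks) : Prop :=
  [/\ forall i, init_label (i == 0) (X i) (i < x) (l i 0),
      forall i j, step_label (i == 0) (l i j.+1) (l i.+1 j.+1) (l i j) (l i.+1 j) &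
      forall t, exists t', t <= t' /\ stack (l 0 t') = main_loop c].

Definition oracles (Y X : nat -> bool) (o : 'I_2) : nat -> bool :=
  if o == input_track then X else Y.

Lemma action_bound (K : seq (prog 2)) : all (regs_lt R) K ->
  if action K is Some i then reg_bound i <= R else true.
Proof. by case: K => [|[i|a b|a b|a] K] //= /andP []. Qed.

Theorem label_runP X x : (exists l, label_run X x l) <->
  exists Y, forall k, rec_eval
    [tuple (fun n => oracles Y X o n : nat) | o < 2] c [tuple k; x] 1.
Proof.
split=> [[l [hi hst inf]]|[Y /main_loopP [K [s [K0 s0 run inf]]]]].
  (* Tracks are copied upwards, so the guess can be read off row 0. *)
  pose Y i := track (l i 0) ord0; exists Y; apply/main_loopP.
  have htr i j o : track (l i j) o = oracles Y X o i.
    elim: j => [|j IH]; last by case: (hst i j) => _ _ _ -> _.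
    rewrite /oracles; case: ifP => [/eqP ->|].
      by case: (hi i).
    move=> no; rewrite /Y; congr (track _ _); apply: val_inj.
    by case: o no => -[|[|]].
  have hfl i j : left_flag (l i j) = (i == 0).
    by case: j => [|j]; [case: (hi i)|case: (hst i j)].
  have hstk i j : stack (l i j) = stack (l 0 j).
    by elim: i => // i <-; case: (hst i j) => _ -> _ _ _.
  pose K t := stack (l 0 t).
  have hK t : all (regs_lt R) (K t).
    elim: t => [|t IH]; first by rewrite /K; case: (hi 0) => _ ->.
    by apply: regs_lt_next IH _; case: (hst 0 t).
  have /choice [F hF] : forall ts : nat * (nat -> nat), exists s',
      shows (l^~ ts.1) ts.2 -> ostep (oracles Y X) (action (K ts.1)) ts.2 s' /\
        shows (l^~ ts.1.+1) s'.
    move=> [t s]; case: (pselect (shows (l^~ t) s)) => hs; last by exists s.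
    have [|s' h1 h2] := step_of_local (action_bound (hK t)) (hfl^~ t)
      (fun i o => htr i t o) hs (row' := l^~ t.+1).
      by move=> i; case: (hst i t) => _ _ _ _; rewrite hstk.
    by exists s'.
  pose S := fix S t := if t is t'.+1 then F (t', S t') else upd (fun=> 0) 1 x.
  have hS t : shows (l^~ t) (S t).
    elim: t => [|t IH]; last by case: (hF (t, S t) IH).
    move=> i r hr; case: (hi i) => _ _ -> // _; rewrite /= /upd.
    by case: eqP; rewrite // ltn0.
  exists K, S; split=> //.
  - by rewrite /K; case: (hi 0).
  - move=> t; split; first by case: (hst 0 t).
    by case: (hF (t, S t) (hS t)).
have hK t : K t \in stacks.
  elim: t => [|t IH]; first by rewrite K0 main_loop_stacks.
  by case: (run t) => h _; apply: stacks_next IH h.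
have hKR t : all (regs_lt R) (K t).
  elim: t => [|t IH]; first by rewrite K0.
  by case: (run t) => h _; apply: regs_lt_next IH h.
have /choice [l hl] : forall ij : nat * nat, exists l : label R stacks,
   [/\ left_flag l = (ij.1 == 0), stack l = K ij.2,
    forall r, r < R -> reg l r = (ij.1 < s ij.2 r) &
    forall o, track l o = oracles Y X o ij.1].
  move=> [i j].
  by have [l hl] := @label_exists 2 R stacks (i == 0) (K j)
    (fun r => i < s j r) (fun o => oracles Y X o i) (hK j); exists l.
exists (fun i j => l (i, j)); split.
- move=> i; case: (hl (i, 0)) => h1 h2 h3 h4; split=> //.
  + by rewrite h2.
  + by move=> r hr; rewrite h3 // s0 /upd /=; case: eqP; rewrite ?ltn0.
- move=> i j; case: (hl (i, j.+1)) => h1 h2 h3 h4.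
  case: (hl (i, j)) => h1' h2' h3' h4'; case: (hl (i.+1, j)) => _ h2'' _ _.
  case: (run j) => r1 r2; split.
  + by [].
  + by rewrite h2' h2''.
  + by rewrite h2 h2'.
  + by move=> o; rewrite h4 h4'.
  + rewrite h2'; apply: (local_of_step (row := fun i => l (i, j))
      (row' := fun i => l (i, j.+1)) (action_bound (hKR j)) _ _ _ _ r2).
    * by move=> k; case: (hl (k, j)).
    * by move=> k o; case: (hl (k, j)).
    * by move=> k r hr; case: (hl (k, j)) => _ _ ->.
    * by move=> k r hr; case: (hl (k, j.+1)) => _ _ ->.
- move=> t; have [t' [le e]] := inf t; exists t'; split=> //.
  by case: (hl (0, t')) => _ ->.
Qed.

End LabelSystem.

(** * Tiling systems of space-time diagrams *)

(** The state set of the reduction grows with its parameter; with states in [nat], tiles and their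
    codes are described uniformly. *)
Definition nat_tile : Type :=
  ((option bool * nat) * (option bool * nat) *
   (option bool * nat) * (option bool * nat))%type.

Definition erase n (t : tile 'I_n bool) : nat_tile :=
  let: ((s1, q1), (s2, q2), (s3, q3), (s4, q4)) := t in
  ((s1, nat_of_ord q1), (s2, nat_of_ord q2), (s3, nat_of_ord q3),
   (s4, nat_of_ord q4)).

Lemma erase_inj n : injective (@erase n).
Proof.
move=> [[[[s1 q1] [s2 q2]] [s3 q3]] [s4 q4]] [[[[t1 r1] [t2 r2]] [t3 r3]] [t4 r4]].
by move=> [-> /val_inj -> -> /val_inj -> -> /val_inj -> -> /val_inj ->].
Qed.

Definition tile_states (u : nat_tile) : seq nat :=
  [:: u.1.1.1.2; u.1.1.2.2; u.1.2.2; u.2.2].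

Lemma erase_surj n (u : nat_tile) :
  all (fun q => q < n) (tile_states u) -> exists t : tile 'I_n bool, erase t = u.
Proof.
case: u => [[[[s1 q1] [s2 q2]] [s3 q3]] [s4 q4]] /= /and5P [h1 h2 h3 h4 _].
by exists ((s1, Ordinal h1), (s2, Ordinal h2), (s3, Ordinal h3), (s4, Ordinal h4)).
Qed.

Section Tiling.
Variables (c : recf 2 2) (R : nat).
Hypothesis hR : all (regs_lt R) (main_loop c).

Let lab := label R (stacks c).
Let N := #|lab|.

Definition label_number (l : lab) : nat := nat_of_ord (enum_rank l).

Lemma label_number_inj : injective label_number.
Proof. by move=> l l' /val_inj /enum_rank_inj. Qed.

Lemma label_number_lt l : label_number l < N.
Proof. exact: ltn_ord. Qed.

(** A letter at the bottom right tells that the tile is off the bottom border; among such tiles, [#]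
    at the top left marks column 0. *)
Definition step_tile (t : tile lab bool) : bool :=
  let: ((s1, l1'), (s2, l2'), (s3, l1), (s4, l2)) := t in
  (s4 != None) && `[< step_label (s1 == None) l1' l2' l1 l2 >].

Definition number_tile (t : tile lab bool) : nat_tile :=
  let: ((s1, l1'), (s2, l2'), (s3, l1), (s4, l2)) := t in
  ((s1, label_number l1'), (s2, label_number l2'),
   (s3, label_number l1), (s4, label_number l2)).

Definition half_tile : finType := ((option bool * lab) * (option bool * lab))%type.

Definition bottom_tile (q q' : nat) (u : half_tile) : nat_tile :=
  ((u.1.1, label_number u.1.2), (u.2.1, label_number u.2.2), (None, q), (None, q')).

Definition init_half (first x : bool) (u : half_tile) : bool :=
  ((u.1.1 == None) == first) &&
  `[< init_label first (u.1.1 == Some true) x u.1.2 >].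

Definition fixed_tiles : seq nat_tile :=
  [seq number_tile t | t <- enum [pred t | step_tile t]] ++
  [seq bottom_tile N N.+1 u | u <- enum [pred u | init_half true true u]].

(** The start tile gives a true bit of register 1 to column 0, the chain tile [k] to column [k.+1],
    and the end tile a false bit to the rest. Hence register 1 starts at [x.+1]. *)
Definition chain_tiles (k : nat) : seq nat_tile :=
  [seq bottom_tile (N.+1 + k) (N.+1 + k).+1 u |
     u <- enum [pred u | init_half false true u]].

Definition end_tiles (x : nat) : seq nat_tile :=
  [seq bottom_tile (N.+1 + x) (N.+1 + x) u |
     u <- enum [pred u | init_half false false u]].

Definition reduction_tiles (x : nat) : seq nat_tile :=
  fixed_tiles ++ flatten [seq chain_tiles k | k <- iota 0 x] ++ end_tiles x.

(** Restricted to column 0: a row shows one stack throughout, so otherwise a single row would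
    contain infinitely many final cells. *)
Definition final_states : seq nat :=
  [seq label_number l |
     l <- enum [pred l : lab | left_flag l && (stack l == main_loop c)]].

(* The states [N.+1 + k], [k <= x], along the bottom border count up to [x];
   the state [N] is that of the corner. *)
Definition reduction_system (x : nat) : buchi_system 'I_(N + x.+2) bool :=
  BuchiSystem [set t | erase t \in reduction_tiles x]
              [set q | nat_of_ord q \in final_states].

Variant reduction_tile_spec x : nat_tile -> Prop :=
| StepTile s1 l1' s2 l2' s3 l1 s4 l2 of
    s4 != None & step_label (s1 == None) l1' l2' l1 l2 :
    reduction_tile_spec x ((s1, label_number l1'), (s2, label_number l2'),
                           (s3, label_number l1), (s4, label_number l2))
| StartTile l1 s2 l2 of init_label true false true l1 :
    reduction_tile_spec x ((None, label_number l1), (s2, label_number l2),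
                           (None, N), (None, N.+1))
| ChainTile b l1 s2 l2 k of k < x & init_label false b true l1 :
    reduction_tile_spec x ((Some b, label_number l1), (s2, label_number l2),
                           (None, N.+1 + k), (None, (N.+1 + k).+1))
| EndTile b l1 s2 l2 of init_label false b false l1 :
    reduction_tile_spec x ((Some b, label_number l1), (s2, label_number l2),
                           (None, N.+1 + x), (None, N.+1 + x)).

Lemma reduction_tileP x u :
  u \in reduction_tiles x <-> reduction_tile_spec x u.
Proof.
split.
  rewrite !mem_cat => /orP [/orP [/mapP|/mapP]|/orP [/flattenP|/mapP]].
  - move=> [[[[[s1 l1'] [s2 l2']] [s3 l1]] [s4 l2]]]; rewrite mem_enum inE.
    by move=> /andP [h1 /asboolP h2] ->; constructor.
  - move=> [[[s1 l1] [s2 l2]]]; rewrite mem_enum inE /init_half /=.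
    by move=> /andP [/eqP h1 /asboolP h2] ->; move: h1 h2; case: s1 => // _ h;
      constructor.
  - move=> [s /mapP [k]]; rewrite mem_iota add0n => /andP [_ kx] -> /mapP.
    move=> [[[s1 l1] [s2 l2]]]; rewrite mem_enum inE /init_half /=.
    move=> /andP [/eqP h1 /asboolP h2] ->; move: h1 h2; case: s1 => // b _ h2.
    by constructor => //; move: h2; case: b.
  - move=> [[[s1 l1] [s2 l2]]]; rewrite mem_enum inE /init_half /=.
    move=> /andP [/eqP h1 /asboolP h2] ->; move: h1 h2; case: s1 => // b _ h2.
    by constructor => //; move: h2; case: b.
rewrite !mem_cat; case.
- move=> s1 l1' s2 l2' s3 l1 s4 l2 h1 h2; apply/orP; left; apply/orP; left.
  apply/mapP; exists ((s1, l1'), (s2, l2'), (s3, l1), (s4, l2)) => //.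
  by rewrite mem_enum; apply/andP; split=> //; apply/asboolP.
- move=> l1 s2 l2 h; apply/orP; left; apply/orP; right.
  apply/mapP; exists ((None, l1), (s2, l2)) => //.
  by rewrite mem_enum; apply/andP; split=> //; apply/asboolP.
- move=> b l1 s2 l2 k kx h; apply/orP; right; apply/orP; left.
  apply/flattenP; exists (chain_tiles k); first by apply: map_f; rewrite mem_iota.
  apply/mapP; exists ((Some b, l1), (s2, l2)) => //.
  rewrite mem_enum; apply/andP; split=> //; apply/asboolP.
  by move: h; case: b.
- move=> b l1 s2 l2 h; apply/orP; right; apply/orP; right.
  apply/mapP; exists ((Some b, l1), (s2, l2)) => //.
  rewrite mem_enum; apply/andP; split=> //; apply/asboolP.
  by move: h; case: b.
Qed.

Lemma step_tile_inv x s1 q1 s2 q2 s3 q3 b q4 :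
  reduction_tile_spec x ((s1, q1), (s2, q2), (s3, q3), (Some b, q4)) ->
  exists l1' l2' l1 l2, [/\ q1 = label_number l1', q2 = label_number l2',
    q3 = label_number l1 & q4 = label_number l2] /\ step_label (s1 == None) l1' l2' l1 l2.
Proof. by inversion 1; subst; exists l1', l2', l1, l2. Qed.

Lemma start_tile_inv x q1 s2 q2 s3 q3 q4 :
  reduction_tile_spec x ((None, q1), (s2, q2), (s3, q3), (None, q4)) ->
  [/\ q3 = N, q4 = N.+1 &
   exists l1, q1 = label_number l1 /\ init_label true false true l1].
Proof. by inversion 1; subst => //; split=> //; exists l1. Qed.

Lemma bottom_tile_inv x b q1 s2 q2 s3 q3 q4 :
  reduction_tile_spec x ((Some b, q1), (s2, q2), (s3, q3), (None, q4)) ->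
  exists l1, q1 = label_number l1 /\
   ((exists2 k, k < x & [/\ q3 = N.+1 + k, q4 = (N.+1 + k).+1 &
      init_label false b true l1]) \/
    [/\ q3 = N.+1 + x, q4 = N.+1 + x & init_label false b false l1]).
Proof.
inversion 1; subst => //; exists l1; split=> //; last by right.
by left; exists k.
Qed.

(** In a picture, entry 0 falls on the border and is therefore false. *)
Definition input_word (p : nat * nat -> option bool) (i : nat) : bool :=
  p (i, 1) == Some true.

Lemma pictureE (p : nat * nat -> option bool) i j : pictures p ->
  (p (i, j) == None) = (i == 0) || (j == 0).
Proof.
move=> [h h']; case: i => [|i]; first by case: (h j) => _ ->.
case: j => [|j]; first by case: (h i.+1) => ->.
by apply/negbTE/eqP; apply: h'.
Qed.

Lemma run_label_run x p rho :
  pictures p -> accepting_runs (reduction_system x) p rho ->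
  exists l : nat -> nat -> lab, label_run (input_word p) x.+1 l.
Proof.
move=> hp [hrun hinf].
have htile i j : reduction_tile_spec x
    ((p (i, j.+1), nat_of_ord (rho (i, j.+1))),
     (p (i.+1, j.+1), nat_of_ord (rho (i.+1, j.+1))),
     (p (i, j), nat_of_ord (rho (i, j))),
     (p (i.+1, j), nat_of_ord (rho (i.+1, j)))).
  by apply/reduction_tileP; have := hrun i j; rewrite inE.
have hstep i j : exists l1' l2' l1 l2, [/\ rho (i, j.+2) = label_number l1' :> nat,
    rho (i.+1, j.+2) = label_number l2' :> nat, rho (i, j.+1) = label_number l1 :> nat &
    rho (i.+1, j.+1) = label_number l2 :> nat] /\ step_label (i == 0) l1' l2' l1 l2.
  have := htile i j.+1; have := pictureE i.+1 j.+1 hp.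
  case: (p (i.+1, j.+1)) => // b _ /step_tile_inv.
  by rewrite pictureE // orbF.
have /choice [l hl] : forall ij, exists l, rho (ij.1, ij.2.+1) = label_number l :> nat.
  move=> [i j]; have [l1' [l2' [l1 [l2 [[_ _ h _] _]]]]] := hstep i j.
  by exists l1.
(* The bottom tiles force the border states: they count up to [x] and then repeat. *)
have hrow0 i : rho (i.+1, 0) = N.+1 + minn i x :> nat.
  elim: i => [|i IH].
    have := htile 0 0; rewrite min0n addn0.
    have /eqP -> : p (1, 0) == None by rewrite pictureE.
    have /eqP -> : p (0, 1) == None by rewrite pictureE.
    by move=> /start_tile_inv [].
  have := htile i.+1 0; have /eqP -> : p (i.+2, 0) == None by rewrite pictureE.
  have := pictureE i.+1 1 hp; case: (p (i.+1, 1)) => // b _.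
  move=> /bottom_tile_inv [l1 [_ [[k kx [e1 -> _]]|[e1 -> _]]]].
    by move: e1; rewrite IH => /addnI e; rewrite -addnS -e; congr (_ + _); lia.
  by move: e1; rewrite IH => /addnI e; congr (_ + _); lia.
have hinit i : init_label (i == 0) (input_word p i) (i < x.+1) (l (i, 0)).
  case: i => [|i].
    have := htile 0 0; have /eqP -> : p (1, 0) == None by rewrite pictureE.
    have e0 : p (0, 1) = None by apply/eqP; rewrite pictureE.
    rewrite /input_word e0 => /start_tile_inv [_ _ [l1 []]].
    by rewrite (hl (0, 0)) => /label_number_inj ->.
  have := htile i.+1 0; have /eqP -> : p (i.+2, 0) == None by rewrite pictureE.
  rewrite /input_word; have := pictureE i.+1 1 hp; case: (p (i.+1, 1)) => // b _.
  move=> /bottom_tile_inv [l1 [+ H]]; rewrite (hl (i.+1, 0)) => /label_number_inj ->.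
  have -> : (Some b == Some true) = b by case: b {H}.
  rewrite hrow0 in H.
  case: H => [[k kx [/addnI e _ h]]|[/addnI e _ h]]; move: h.
    by have -> : i.+1 < x.+1 by lia.
  by have -> : (i.+1 < x.+1) = false by lia.
have hst i j : step_label (i == 0) (l (i, j.+1)) (l (i.+1, j.+1)) (l (i, j))
    (l (i.+1, j)).
  have [l1' [l2' [l1 [l2 [[]]]]]] := hstep i j.
  rewrite (hl (i, j.+1)) (hl (i.+1, j.+1)) (hl (i, j)) (hl (i.+1, j)).
  by do 4 move=> /label_number_inj ->.
have hflag i j : left_flag (l (i, j)) = (i == 0).
  by case: j => [|j]; [case: (hinit i)|case: (hst i j)].
(* Border states lie above all label numbers, so no cell of row 0 is final. *)
have hrho i : N <= rho (i, 0).
  case: i => [|i]; last by rewrite hrow0; lia.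
  have := htile 0 0; have /eqP -> : p (1, 0) == None by rewrite pictureE.
  have /eqP -> : p (0, 1) == None by rewrite pictureE.
  by move=> /start_tile_inv [->].
(* Without a return from time [t] on, all final cells lie in column 0 at heights 1 to [t]. *)
exists (fun i j => l (i, j)); split=> // t; apply: contrapT => hn; apply: hinf.
apply: (@sub_finite_set _ _ ((fun k => (0, k.+1)) @` `I_t)); last first.
  exact/finite_image/finite_II.
move=> [i j] /=; rewrite inE => /mapP [l1]; rewrite mem_enum => /andP [f1 /eqP st].
case: j => [|j].
  by move=> e; have := hrho i; rewrite e leqNgt label_number_lt.
rewrite (hl (i, j)) => /label_number_inj e; rewrite -e hflag in f1.
rewrite (eqP f1) in e *; exists j => //=; rewrite ltnNge; apply/negP => tj.
by apply: hn; exists j; rewrite e.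
Qed.

Lemma label_run_run x p (l : nat -> nat -> lab) : pictures p ->
  label_run (input_word p) x.+1 l -> accepting_runs (reduction_system x) p !=set0.
Proof.
move=> hp [hinit hst inf].
pose st (v : nat * nat) : nat :=
  if v.2 is j.+1 then label_number (l v.1 j)
  else if v.1 is i.+1 then N.+1 + minn i x else N.
have hlt v : st v < N + x.+2.
  case: v => [[|i] [|j]]; rewrite /st /=; try (by lia);
  by apply: leq_trans (label_number_lt _) _; rewrite leq_addr.
exists (fun v => Ordinal (hlt v)); split.
  move=> i j; rewrite inE; apply/reduction_tileP; rewrite /erase.
  case: j => [|j]; last first.
    by constructor; [rewrite pictureE|rewrite pictureE // orbF; apply: hst].
  have /eqP -> : p (i.+1, 0) == None by rewrite pictureE.
  have /eqP -> : p (i, 0) == None by rewrite pictureE ?orbT.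
  case: i => [|i].
    have e0 : p (0, 1) = None by apply/eqP; rewrite pictureE.
    rewrite e0 /st /= min0n addn0; constructor.
    by have := hinit 0; rewrite /input_word e0.
  have := hinit i.+1; have := pictureE i.+1 1 hp; rewrite /input_word.
  case: (p (i.+1, 1)) => // b _.
  have -> : (Some b == Some true) = b by case: b.
  rewrite /st /=; case: (leqP x i) => h.
    have -> : (i.+1 < x.+1) = false by lia.
    by rewrite (minn_idPr (leqW h)); apply: EndTile.
  have -> : i.+1 < x.+1 by lia.
  by rewrite (minn_idPl h) addnS; apply: ChainTile.
move=> /finite_seqP [s hs].
(* A return at least as late as every row in the supposed finite list [s] of final cells. *)
have [t [lt e]] := inf (\max_(v <- s) v.2).
have : (0, t.+1) \in s.
  suff : [set` s] (0, t.+1) by [].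
  rewrite -hs /= inE; apply/mapP; exists (l 0 t) => //.
  rewrite mem_enum; apply/andP; split; last exact/eqP.
  by case: t {lt e} => [|t]; [case: (hinit 0)|case: (hst 0 t)] => ->.
move=> hin; have := @leq_bigmax_seq _ s predT (fun v => v.2) _ hin isT.
by move=> /= /leq_trans /(_ lt); rewrite ltnn.
Qed.

Theorem reduction_systemP x p : pictures p ->
  (accepting_runs (reduction_system x) p !=set0 <->
   exists Y, forall k, rec_eval
     [tuple (fun n => oracles Y (input_word p) o n : nat) | o < 2] c
     [tuple k; x.+1] 1).
Proof.
move=> hp; rewrite -(label_runP hR); split; first by case=> rho; apply: run_label_run.
by case=> l; apply: label_run_run.
Qed.

End Tiling.

(** * Codes of tiling systems *)

(** Distinct powers of 2 add without carry, so halving lowers the exponents and parity detects the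
    exponent 0. *)
Lemma half_sumn (s : seq nat) : uniq s ->
  (\sum_(m <- s) 2 ^ m)./2 = \sum_(m <- s | 0 < m) 2 ^ m.-1 /\
  odd (\sum_(m <- s) 2 ^ m) = (0 \in s).
Proof.
elim: s => [|m s IH] /=; first by rewrite !big_nil.
move=> /andP [ms /IH [h1 h2]]; rewrite !big_cons inE halfD h1 oddD h2.
case: m ms => [|m] ms /=; first by rewrite (negbTE ms) !add0n.
by rewrite expnS mul2n odd_double doubleK.
Qed.

Lemma bit_sum (s : seq nat) k : uniq s -> bit (\sum_(m <- s) 2 ^ m) k = (k \in s).
Proof.
elim: k s => [|k IH] s us; first by rewrite /bit /=; case: (half_sumn us).
rewrite /bit iterSr (proj1 (half_sumn us)).
have -> : \sum_(m <- s | 0 < m) 2 ^ m.-1 =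
    \sum_(m <- [seq m.-1 | m <- s & 0 < m]) 2 ^ m.
  by rewrite big_map big_filter.
rewrite -/(bit _ _) IH.
  apply/mapP/idP => [[[|m]]|ks].
  - by rewrite mem_filter.
  - by rewrite mem_filter /= => ms ->.
  - by exists k.+1; rewrite // mem_filter.
rewrite map_inj_in_uniq ?filter_uniq // => -[|a] [|b]; rewrite ?mem_filter //=.
by move=> _ _ ->.
Qed.

Lemma bit_canonical_index (I : finType) (A : {set I}) (f : I -> nat) i :
  injective f -> bit (\sum_(j in A) 2 ^ f j) (f i) = (i \in A).
Proof.
move=> fi; have -> : \sum_(j in A) 2 ^ f j = \sum_(m <- [seq f j | j <- enum A]) 2 ^ m.
  by rewrite big_map big_enum.
by rewrite bit_sum ?map_inj_uniq ?enum_uniq // mem_map // mem_enum.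
Qed.

Lemma letter_code_inj : injective letter_code.
Proof. by move=> [[]|] [[]|]. Qed.

Lemma tile_code_inj n : injective (@tile_code n).
Proof.
move=> [[[[s1 q1] [s2 q2]] [s3 q3]] [s4 q4]] [[[[t1 r1] [t2 r2]] [t3 r3]] [t4 r4]].
move=> /(can_inj CodeSeq.codeK) [].
by do 4 move=> /letter_code_inj -> /val_inj ->.
Qed.

Lemma system_code_language (S S' : numbered_system) :
  system_code S = system_code S' ->
  buchi_language (projT2 S) = buchi_language (projT2 S').
Proof.
case: S S' => [n [A F]] [n' [A' F']] /(can_inj CodeSeq.codeK) [en]; subst n'.
move=> /= eA eF; suff [-> ->] : A = A' /\ F = F' by [].
split; apply/setP => t.
  by rewrite -(bit_canonical_index A t (@tile_code_inj n)) eA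
    bit_canonical_index //; apply: tile_code_inj.
by rewrite -(bit_canonical_index F t (@ord_inj n)) eF
  bit_canonical_index //; apply: ord_inj.
Qed.

Lemma recfun_sum m n (F : m.-tuple (nat -> nat) -> n.+1.-tuple nat -> nat)
    (G : m.-tuple (nat -> nat) -> n.-tuple nat -> nat) :
  recfun F -> recfun G ->
  recfun (fun fs v => \sum_(k <- iota 0 (G fs v)) F fs [tuple of k :: v]).
Proof.
move=> hF hG; apply: recfun_ext (recfun_primrec (recfun_const m n 0) (S :=
  fun fs w => nth 0 w 1 + F fs [tuple of nth 0 w 0 :: behead (behead w)]) _ hG).
  move=> fs v /=; elim: (G fs v) => [|k /= ->]; first by rewrite big_nil.
  have -> : 0 :: iota 1 k = iota 0 k ++ [:: k].
    by rewrite -[LHS]/(iota 0 k.+1) -addn1 iotaD.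
  rewrite big_cat big_seq1 /=.
  by congr (_ + F fs _); apply: val_inj.
by apply: recfun_add; [exact: recfun_nth|exact: recfun_skip].
Qed.

Lemma recfun_sum_seq m n (I : Type) (s : seq I)
    (F : I -> m.-tuple (nat -> nat) -> n.-tuple nat -> nat) :
  (forall i, recfun (F i)) -> recfun (fun fs v => \sum_(i <- s) F i fs v).
Proof.
move=> hF; elim: s => [|i s IH].
  by apply: (recfun_ext _ (recfun_const m n 0)) => fs v; rewrite big_nil.
by apply: (recfun_ext _ (recfun_add (hF i) IH)) => fs v; rewrite big_cons.
Qed.

Definition nat_tile_code (u : nat_tile) : nat :=
  let: ((s1, q1), (s2, q2), (s3, q3), (s4, q4)) := u in
  CodeSeq.code [:: letter_code s1; q1; letter_code s2; q2; letter_code s3; q3;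
                   letter_code s4; q4].

Lemma tile_codeE n (t : tile 'I_n bool) : tile_code t = nat_tile_code (erase t).
Proof. by case: t => [[[[s1 q1] [s2 q2]] [s3 q3]] [s4 q4]]. Qed.

Lemma sum_tile_code n (s : seq nat_tile) : uniq s ->
  (forall u, u \in s -> all (fun q => q < n) (tile_states u)) ->
  \sum_(t in [set t : tile 'I_n bool | erase t \in s]%SET) 2 ^ tile_code t =
  \sum_(u <- s) 2 ^ nat_tile_code u.
Proof.
move=> us hs; rewrite -big_enum.
under eq_bigr => t _ do rewrite tile_codeE.
rewrite -(big_map (@erase n) predT (fun u => 2 ^ nat_tile_code u)).
apply: perm_big; apply: uniq_perm => //.
  by rewrite map_inj_uniq ?enum_uniq //; apply: erase_inj.
move=> u; apply/mapP/idP => [[t]|hu]; first by rewrite mem_enum inE => ? ->.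
have [t et] := erase_surj (hs u hu).
by exists t; rewrite ?mem_enum ?inE et.
Qed.

Section ReductionCode.
Variables (c : recf 2 2) (R : nat).
Let N := #|label R (stacks c)|.

Lemma number_tile_inj : injective (@number_tile c R).
Proof.
move=> [[[[s1 q1] [s2 q2]] [s3 q3]] [s4 q4]] [[[[t1 r1] [t2 r2]] [t3 r3]] [t4 r4]].
by move=> [-> /label_number_inj -> -> /label_number_inj ->
  -> /label_number_inj -> -> /label_number_inj ->].
Qed.

Lemma bottom_tile_inj q q' : injective (@bottom_tile c R q q').
Proof.
move=> [[s l] [t r]] [[s' l'] [t' r']].
by move=> [-> /label_number_inj -> -> /label_number_inj ->].
Qed.

(** Tells the families of tiles apart: less than [N] on step tiles, [N] on start tiles, [N.+1 + k]
    on chain tiles and [N.+1 + x] on end tiles. *)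
Definition corner_state (u : nat_tile) : nat := u.1.2.2.

Lemma reduction_tiles_uniq x : uniq (reduction_tiles c R x).
Proof.
have h1 : uniq (fixed_tiles c R) /\ {in fixed_tiles c R, forall u, corner_state u <= N}.
  split.
    rewrite cat_uniq !map_inj_uniq ?enum_uniq ?andbT /=; last first.
    - exact: number_tile_inj.
    - exact: bottom_tile_inj.
    apply/hasPn => u /mapP [v _ ->].
    apply/mapP => -[[[[[s1 q1] [s2 q2]] [s3 q3]] [s4 q4]]] _.
    move=> /(congr1 corner_state) /= e; have := label_number_lt q3.
    by rewrite /corner_state /= in e; rewrite -e ltnn.
  move=> u; rewrite mem_cat => /orP [] /mapP [].
    move=> [[[[s1 q1] [s2 q2]] [s3 q3]] [s4 q4]] _ ->; apply: ltnW; exact: label_number_lt.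
  by move=> v _ ->.
have h2 : uniq (flatten [seq chain_tiles c R k | k <- iota 0 x]) /\
    {in flatten [seq chain_tiles c R k | k <- iota 0 x], forall u,
     N < corner_state u <= N + x}.
  elim: x => [|x [IHu IH]] //.
  rewrite -addn1 iotaD map_cat flatten_cat /= cats0 add0n cat_uniq IHu /=.
  have hc : {in chain_tiles c R x, forall u, corner_state u = N.+1 + x}.
    by move=> u /mapP [v _ ->].
  rewrite map_inj_uniq ?enum_uniq ?andbT; last exact: bottom_tile_inj.
  split.
    apply/hasPn => u /hc hu; apply/negP => /IH; rewrite hu; lia.
  move=> u; rewrite mem_cat => /orP [/IH|/hc ->]; lia.
case: h1 => u1 h1; case: h2 => u2 h2.
have hc : {in end_tiles c R x, forall u, corner_state u = N.+1 + x}.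
  by move=> u /mapP [v _ ->].
rewrite /reduction_tiles cat_uniq u1 [uniq (flatten _ ++ _)]cat_uniq u2.
rewrite map_inj_uniq ?enum_uniq ?andbT /=; last exact: bottom_tile_inj.
apply/andP; split; apply/hasPn => u.
  rewrite mem_cat => /orP [/h2 h|/hc h]; apply/negP => /h1; lia.
by move=> /hc h; apply/negP => /h2; lia.
Qed.

Lemma reduction_tiles_states x u : u \in reduction_tiles c R x ->
  all (fun q => q < N + x.+2) (tile_states u).
Proof.
have lt (l : label R (stacks c)) : label_number l < N + x.+2.
  by apply: leq_trans (label_number_lt _) _; rewrite leq_addr.
move=> /reduction_tileP [s1 l1' s2 l2' s3 l1 s4 l2 _ _|l1 s2 l2 _|
  b l1 s2 l2 k kx _|b l1 s2 l2 _]; rewrite /= !lt /= -/N; lia.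
Qed.

Lemma reduction_system_codeE x :
  system_code (existT _ _ (reduction_system c R x)) =
  CodeSeq.code [:: N + x.+2;
   \sum_(u <- fixed_tiles c R) 2 ^ nat_tile_code u +
    (\sum_(k <- iota 0 x) \sum_(u <- chain_tiles c R k) 2 ^ nat_tile_code u +
     \sum_(u <- end_tiles c R x) 2 ^ nat_tile_code u);
   \sum_(q <- final_states c R) 2 ^ q].
Proof.
rewrite /system_code; congr (CodeSeq.code [:: _; _; _]).
  rewrite sum_tile_code ?reduction_tiles_uniq //; last exact: reduction_tiles_states.
  rewrite /reduction_tiles big_cat; congr (_ + _).
  by rewrite big_cat big_flatten big_map.
rewrite /=.
transitivity (\sum_(q <- [seq val q | q <- enum [set q : 'I_(N + x.+2) |
    nat_of_ord q \in final_states c R]%SET]) 2 ^ q).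
  by rewrite big_map big_enum.
apply: perm_big; apply: uniq_perm.
- by rewrite map_inj_uniq ?enum_uniq //; apply: val_inj.
- by rewrite map_inj_uniq ?enum_uniq //; apply: label_number_inj.
move=> q; apply/mapP/idP => [[r]|hq]; first by rewrite mem_enum inE => ? ->.
have lt : q < N + x.+2.
  case/mapP: hq => l _ ->; apply: leq_trans (label_number_lt _) _; exact: leq_addr.
by exists (Ordinal lt); rewrite // mem_enum inE.
Qed.

(** The number of states already determines [x]. *)
Lemma reduction_system_code_inj :
  injective (fun x => system_code (existT _ _ (reduction_system c R x))).
Proof.
move=> x y; rewrite !reduction_system_codeE => /(can_inj CodeSeq.codeK) [].
by move=> /addnI [].
Qed.

Lemma recfun_bottom_tile_code m n (s : seq (half_tile c R))
   (F G : m.-tuple (nat -> nat) -> n.-tuple nat -> nat) :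
  recfun F -> recfun G ->
  recfun (fun fs v => \sum_(u <- [seq bottom_tile (F fs v) (G fs v) u | u <- s])
    2 ^ nat_tile_code u).
Proof.
move=> hF hG.
apply: (recfun_ext (F := fun fs v => \sum_(u <- s)
  2 ^ nat_tile_code (bottom_tile (F fs v) (G fs v) u))).
  by move=> fs v; rewrite big_map.
apply: recfun_sum_seq => u; rewrite /nat_tile_code /bottom_tile /=.
apply: recfun_exp2; apply: (recfun_ext (F := fun fs v => foldr pair_code 0
  [:: letter_code u.1.1; label_number u.1.2; letter_code u.2.1;
      label_number u.2.2; 0; F fs v; 0; G fs v])); first by [].
by rewrite /=; repeat (exact: recfun_const || apply: recfun_pair_code).
Qed.

Lemma recfun_reduction_system_code m :
  @recfun m 1 (fun fs v =>
    system_code (existT _ _ (reduction_system c R (nth 0 v 0)))).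
Proof.
have hx : @recfun m 1 (fun _ v => nth 0 v 0) by apply: recfun_nth.
apply: (recfun_ext (F := fun fs v => foldr pair_code 0 [:: N + (nth 0 v 0).+2;
   \sum_(u <- fixed_tiles c R) 2 ^ nat_tile_code u +
    (\sum_(k <- iota 0 (nth 0 v 0)) \sum_(u <- chain_tiles c R k) 2 ^ nat_tile_code u +
     \sum_(u <- end_tiles c R (nth 0 v 0)) 2 ^ nat_tile_code u);
   \sum_(q <- final_states c R) 2 ^ q])).
  by move=> fs v; rewrite reduction_system_codeE.
rewrite /=; apply: recfun_pair_code.
  apply: recfun_add; first exact: recfun_const.
  by do 2 apply: recfun_succ.
apply: recfun_pair_code; last exact: recfun_const.
apply: recfun_add; first exact: recfun_const.
apply: recfun_add.
  apply: (recfun_ext _ (recfun_sum (F := fun fs w =>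
    \sum_(u <- chain_tiles c R (nth 0 w 0)) 2 ^ nat_tile_code u) _ hx)) => //.
  apply: recfun_bottom_tile_code.
    by apply: recfun_add; [exact: recfun_const|exact: recfun_nth].
  apply: recfun_succ.
  by apply: recfun_add; [exact: recfun_const|exact: recfun_nth].
by apply: recfun_bottom_tile_code; (apply: recfun_add; first exact: recfun_const).
Qed.

End ReductionCode.

Lemma recfun_computable (f : nat -> nat) :
  computable f <-> @recfun 0 1 (fun _ v => f (nth 0 v 0)).
Proof.
split=> -[c hc]; exists c.
  by move=> fs; case/tupleP => x v; rewrite (tuple0 fs) (tuple0 v); apply: hc.
by move=> x; apply: hc.
Qed.

(** The least index with the code of [S x] is found by unbounded search, which halts as [T] is onto.
    Distinct codes have distinct indices, which makes the reduction injective. *)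
Lemma one_reducible_systems (T : nat -> numbered_system) (S : nat -> numbered_system)
    (B A : set nat) : effective_enumeration T ->
  @recfun 0 1 (fun _ v => system_code (S (nth 0 v 0))) ->
  injective (fun x => system_code (S x)) ->
  (forall x z, system_code (T z) = system_code (S x) -> (B x <-> A z)) ->
  one_reducible B A.
Proof.
move=> [/recfun_computable hT surjT] hS injS hBA.
have ex x : exists z, system_code (T z) == system_code (S x).
  by have [z ez] := surjT (S x); exists z; rewrite ez.
pose f x := ex_minn (ex x).
have fE x : system_code (T (f x)) = system_code (S x).
  by rewrite /f; case: ex_minnP => z /eqP.
exists f; split.
- have [c hc] : @recfun 0 2 (fun _ v =>
     ~~ (system_code (T (nth 0 v 0)) == system_code (S (nth 0 v 1))) : nat).
    apply: recfun_neg; apply: recfun_eq.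
      have := recfun_comp hT (fun=> recfun_nth 0 (n := 2) (k := 0) isT).
      by apply: recfun_ext => fs v; rewrite (nth_mktuple _ _ ord0).
    have := recfun_comp hS (fun=> recfun_nth 0 (n := 2) (k := 1) isT).
    by apply: recfun_ext => fs v; rewrite (nth_mktuple _ _ ord0).
  have hz x z b : (system_code (T z) == system_code (S x)) = b ->
      rec_eval [tuple] c [tuple of z :: [tuple x]] (~~ b).
    by move=> <-; exact: (hc [tuple] [tuple of z :: [tuple x]]).
  exists (RMin c) => x; rewrite /f; case: ex_minnP => z ez min_z.
  split=> [|y yz]; first exact: (hz x z true).
  exists 0; apply: (hz x y false); apply/negP => e.
  by move: yz; rewrite ltnNge min_z.
- by move=> x y e; apply: injS; rewrite -!fE e.
- by apply/seteqP; split=> x /=; rewrite (hBA x (f x)).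
Qed.

(** * The relation of the reduction *)

Definition bit_oracles (Y X : nat -> bool) : 2.-tuple (nat -> nat) :=
  [tuple (fun n => oracles Y X o n : nat) | o < 2].

Lemma bit_oraclesE Y X :
  bit_oracles Y X = [tuple (fun n => Y n : nat); (fun n => X n : nat)].
Proof.
apply: eq_from_tnth => o; rewrite tnth_mktuple (tnth_nth (fun=> 0)) /oracles.
by case: o => -[|[|]].
Qed.

(** * Functions coded by sets of numbers *)

Section BitOracle.
Variable M0 : relation 2 2.
Hypothesis M0_rec : recursive_relation M0.

(* A function [g] is coded by the bits [Y] where [g k] is the least [y] such
   that [Y] holds at the code of [(k, y)]. *)
Definition least (Y : nat -> bool) (k y : nat) : Prop :=
  Y (pair_code k y) /\ forall z, z < y -> ~~ Y (pair_code k z).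

(** An equivalence, because the search diverges when [Y] has no value at the argument. *)
Lemma rec_least : exists c : recf 2 3, forall Y X (v : 3.-tuple nat) y,
  rec_eval (bit_oracles Y X) c v y <-> least Y (thead v) y.
Proof.
have [c hc] : @recfun 2 4 (fun fs w =>
    1 - nth (fun=> 0) fs 0 (pair_code (nth 0 w 1) (nth 0 w 0))) by rec_tac.
exists (RMin c) => Y X v y /=.
have {}hc z : rec_eval (bit_oracles Y X) c [tuple of z :: v]
    (1 - Y (pair_code (thead v) z)).
  have := hc (bit_oracles Y X) [tuple of z :: v]; rewrite bit_oraclesE /=.
  by case/tupleP: v.
split=> -[h1 h2]; split.
- by have := rec_eval_det h1 (hc y); case: (Y _).
- by move=> z /h2 [w hw]; have := rec_eval_det hw (hc z); case: (Y _).
- by have := hc y; rewrite h1.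
- by move=> z /h2 /negbTE hz; exists 0; have := hc z; rewrite hz.
Qed.

(** Evaluating [M0] may query the coded function at few arguments. The code [c2] also searches for a
    value at [k], so success for all [k] forces [Y] to code a total function. *)
Lemma bit_oracle_form : exists c : recf 2 2, forall (X : nat -> bool) x,
  (exists Y, forall k, rec_eval (bit_oracles Y X) c [tuple k; x] 1) <->
  (exists g, forall k, M0 [tuple g; (fun n => X n : nat)] [tuple k; x]).
Proof.
have [c0 hc0] := M0_rec; have [h0 hh0] := rec_least.
pose o1 : 'I_2 := lift ord0 ord0.
have [h1 hh1] : @recfun 2 3 (fun fs v => nth (fun=> 0) fs 1 (nth 0 v 0)).
  by rec_tac.
pose H (o : 'I_2) := if o == ord0 then h0 else h1.
pose c1 := rec_subst H c0.
have main Y (X : nat -> bool) g (hg : forall k, least Y k (g k)) v y :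
    rec_eval [tuple g; (fun n => X n : nat)] c0 v y ->
    rec_eval (bit_oracles Y X) c1 [tuple of v ++ v] y.
  apply: rec_subst_eval => o x; rewrite /H; case: (eqVneq o ord0) => [->|no].
    by apply/hh0; rewrite theadE; apply: hg.
  have -> : o = o1 by apply: val_inj; case: o no => -[|[|]].
  by have := hh1 (bit_oracles Y X) [tuple of x :: v]; rewrite bit_oraclesE.
(* The arguments are repeated to fill the two parameters that [rec_subst] appends. *)
pose G1 (i : 'I_(2 + 2)) := RProj 2 (if odd i then o1 else ord0).
pose G2 (i : 'I_3) := RProj 2 (@ord0 1).
pose c2 := RComp (RProj 2 (@ord0 1)) (fun i : 'I_2 =>
  if i == ord0 then RComp c1 G1 else RComp h0 G2).
have e1 k x : [tuple of [tuple k; x] ++ [tuple k; x]] = [tuple k; x; k; x]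
    :> 4.-tuple nat by exact: val_inj.
have c2P Y X k x y : rec_eval (bit_oracles Y X) c2 [tuple k; x] y <->
    rec_eval (bit_oracles Y X) c1 [tuple k; x; k; x] y /\ exists z, least Y k z.
  rewrite [X in X <-> _]/=; split.
    move=> [w hw ->]; split.
      have := hw ord0; rewrite eqxx => -[w' hw' hc].
      suff <- : w' = [tuple k; x; k; x] by [].
      apply: eq_from_tnth => i; rewrite hw' (tnth_nth 0).
      by case: i => -[|[|[|[|]]]].
    have := hw o1 => /= -[w' hw' hc].
    by exists (tnth w o1); move/hh0: hc; rewrite /thead hw'.
  move=> [h [z hz]]; exists [tuple y; z] => // -[[|[|//]] hi].
    rewrite (_ : _ == _ = true) //.
    exists [tuple k; x; k; x] => //.
    by move=> i; rewrite (tnth_nth 0); case: i => -[|[|[|[|]]]].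
  rewrite (_ : _ == _ = false) //.
  exists [tuple k; k; k]; last by apply/hh0.
  by move=> i; rewrite (tnth_nth 0); case: i => -[|[|[|]]].
exists c2 => X x; split=> [[Y hY]|[g hg]].
  have /choice [g hg] : forall k, exists z, least Y k z.
    by move=> k; have /c2P [] := hY k.
  exists g => k; have /c2P [h _] := hY k.
  have [_ h0'] := hc0 [tuple g; (fun n => X n : nat)] [tuple k; x].
  apply: contrapT => /h0' /(main _ _ _ hg); rewrite e1 => h'.
  by have := rec_eval_det h h'.
pose Y u := `[< exists k, u = pair_code k (g k) >].
have hY k : least Y k (g k).
  split; first by apply/asboolP; exists k.
  move=> z hz; apply/asboolPn => -[k' /pair_code_inj [e1' e2]]; subst k'.
  by rewrite e2 ltnn in hz.
exists Y => k; apply/c2P; split; last by exists (g k).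
rewrite -e1; apply: (main Y X g hY [tuple k; x]).
by have [h _] := hc0 [tuple g; (fun n => X n : nat)] [tuple k; x]; apply: h.
Qed.

End BitOracle.

Section HardMatrix.
Variable M : relation 2 2.
Hypothesis M_rec : recursive_relation M.

(* [X] is the input word: its odd positions are bits of the graph of a
   function and its even positions from 2 on a point to test for membership in
   the non-Borel set [diag].  [G 0] selects one of three reasons for
   acceptance: column [G 1] of the graph is empty; [k |-> G k.*2.+2] runs
   through the graph and [M] holds with witness [k |-> G k.*2.+3]; or the
   point belongs to [diag]. *)
Definition hard_matrix (G X : nat -> nat) (k x : nat) : bool :=
  if G 0 == 0 then X (pair_code (G 1) k).*2.+1 == 0
  else if G 0 == 1 then
    (X (pair_code k (G k.*2.+2)).*2.+1 == 1) &&
    `[< M [tuple (fun i => G i.*2.+3); (fun i => G i.*2.+2)] [tuple k; x.-1] >]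
  else X (pair_code (hist (fun i => X i.*2.+2) k)
                    (hist (fun i => G i.*2.+2) k)).*2.+2 == 0.

Definition hard_relation : relation 2 2 := fun fs v =>
  hard_matrix (nth (fun=> 0) fs 0) (nth (fun=> 0) fs 1) (nth 0 v 0) (nth 0 v 1).

Lemma hard_relation_rec : recursive_relation hard_relation.
Proof.
apply/recursive_relationE.
apply: (recfun_ext (F := fun fs v => hard_matrix (nth (fun=> 0) fs 0)
  (nth (fun=> 0) fs 1) (nth 0 v 0) (nth 0 v 1) : nat)).
  by move=> fs v; rewrite /hard_relation; case: asboolP; case: (hard_matrix _ _ _ _).
have r0 n F : @recfun 2 n F -> @recfun 2 n (fun fs v => nth (fun=> 0) fs 0 (F fs v)).
  exact: recfun_oracle.
have r1 n F : @recfun 2 n F -> @recfun 2 n (fun fs v => nth (fun=> 0) fs 1 (F fs v)).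
  exact: recfun_oracle.
have v0 n : @recfun 2 n.+1 (fun fs v => nth 0 v 0) by exact: recfun_nth.
have v1 : @recfun 2 2 (fun fs v => nth 0 v 1) by exact: recfun_nth.
apply: recfun_ifb.
- by apply: recfun_eq; [apply: r0|]; apply: recfun_const.
- apply: recfun_eq; last exact: recfun_const.
  apply: (r1); apply: recfun_succ; apply: recfun_double.
  apply: recfun_pair_code => //; apply: (r0); exact: recfun_const.
apply: recfun_ifb.
- by apply: recfun_eq; [apply: r0|]; apply: recfun_const.
- apply: recfun_and.
    apply: recfun_eq; last exact: recfun_const.
    apply: (r1); apply: recfun_succ; apply: recfun_double.
    apply: recfun_pair_code => //; apply: r0.
    by do 2 apply: recfun_succ; apply: recfun_double.
  apply/recursive_relationE.
  apply: (recursive_subst (M := M)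
     (hs := fun fs _ => [tuple of (fun i => nth (fun=> 0) fs 0 i.*2.+3) ::
        [tuple of (fun i => nth (fun=> 0) fs 0 i.*2.+2) :: [tuple]]])
     (ws := fun _ v => [tuple of nth 0 v 0 :: [tuple of (nth 0 v 1).-1 :: [tuple]]])).
  + by [].
  + apply: recfuns_cons; last apply: recfuns_cons; last exact: recfuns_nil.
      by apply: (r0); do 3 apply: recfun_succ; apply: recfun_double; apply: recfun_thead.
    by apply: (r0); do 2 apply: recfun_succ; apply: recfun_double; apply: recfun_thead.
  + apply: recvec_cons => //; apply: recvec_cons; last exact: recvec_nil.
    exact: recfun_pred.
- apply: recfun_eq; last exact: recfun_const.
  apply: (r1); do 2 apply: recfun_succ; apply: recfun_double.
  apply: recfun_pair_code.
    apply: (recfun_hist (F := fun fs w => nth (fun=> 0) fs 1 (nth 0 w 0).*2.+2)) => //.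
    by apply: (r1); do 2 apply: recfun_succ; apply: recfun_double.
  apply: (recfun_hist (F := fun fs w => nth (fun=> 0) fs 0 (nth 0 w 0).*2.+2)) => //.
  by apply: (r0); do 2 apply: recfun_succ; apply: recfun_double.
Qed.

(** The argument [x.+1] is the initial content of register 1; [hard_matrix] takes its
    predecessor. *)
Definition hard (X : nat -> bool) (x : nat) : Prop :=
  exists G, forall k, hard_matrix G (fun n => X n : nat) k x.+1.

Variable B : set nat.
Hypothesis B_form : forall x, B x <->
  forall f, exists g, forall k, M [tuple g; f] [tuple k; x].

(** Either some argument has no value in the word, which is the first reason, or a choice of values
    is a function [f], for which [B] supplies [g]. *)
Lemma hard_of_mem x : B x -> forall X, hard X x.
Proof.
move=> /B_form hB X.
case: (pselect (exists a, forall y, ~~ X (pair_code a y).*2.+1)) => [[a ha]|hn].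
  exists (fun i => if i == 1 then a else 0) => k; rewrite /hard_matrix /=.
  by rewrite (negbTE (ha k)).
have /choice [f hf] : forall a, exists y, X (pair_code a y).*2.+1.
  move=> a; apply: contrapT => /forallNP h; apply: hn; exists a => y.
  exact/negP.
have [g hg] := hB f.
(* [G 0] is 1; from position 2 on, [f] occupies the even and [g] the odd positions. *)
exists (fun i => if i is i'.+2 then merge g f i' else 1) => k.
rewrite /hard_matrix /=; have -> : merge g f k.*2 = f k.
  by rewrite -[LHS]/((fun y => merge g f y.*2) k) merge_even.
rewrite hf /=; apply/asboolP.
by rewrite merge_even (_ : (fun i => merge g f i.*2.+1) = g) // merge_odd.
Qed.

(** Position 0 is false to match the border column of a picture. *)
Definition code_point (f : nat -> nat) (h : nat -> bool) (u : nat) : bool :=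
  if odd u then `[< exists a, u./2 = pair_code a (f a) >]
  else (u != 0) && h u./2.-1.

Lemma code_point_odd f h a y : code_point f h (pair_code a y).*2.+1 = (y == f a).
Proof.
rewrite /code_point /= odd_double /= uphalf_double.
apply/asboolP/eqP => [[a' /pair_code_inj [<- ->]] //|->]; by exists a.
Qed.

Lemma code_point_even f h i : code_point f h i.*2.+2 = h i.
Proof. by rewrite /code_point /= odd_double /= doubleK. Qed.

(** Take [f] without answer [g]. Its graph has a value at every argument and only one, so the first
    reason fails and the second would produce an answer; what remains is membership in [diag]. *)
Lemma hard_of_notin x : ~ B x ->
  exists f, forall h, hard (code_point f h) x <-> diag h.
Proof.
rewrite B_form => /existsNP [f /forallNP hf]; exists f => h.
have eh : (fun i => code_point f h i.*2.+2 : nat) = (fun i => h i : nat).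
  by apply/funext => i; rewrite code_point_even.
split=> [[G]|[g hg]].
  rewrite /hard_matrix; case: eqP => _ hG.
    by have := hG (f (G 1)); rewrite code_point_odd eqxx.
  case: eqP hG => _ hG.
    case: (hf (fun i => G i.*2.+3)) => k; have /andP [_ /asboolP] := hG k.
    suff -> : (fun i => G i.*2.+2) = f by [].
    apply/funext => i; have /andP [] := hG i; rewrite code_point_odd.
    by rewrite eqb1 => /eqP.
  exists (fun i => G i.*2.+2) => k; have := hG k.
  by rewrite eh code_point_even; case: (h _).
(* [G 0] is 2, the third reason, and [G i.*2.+2] is [g i]. *)
exists (fun i => if i is i'.+2 then g i'./2 else 2) => k.
rewrite /hard_matrix /= eh code_point_even.
have -> : (fun i => g i.*2./2) = g by apply/funext => i; rewrite doubleK.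
by rewrite hg.
Qed.

End HardMatrix.

(** * Inherent ambiguity *)

Lemma pair_code_surj m : 0 < m -> exists a b, m = pair_code a b.
Proof.
move=> m0; have := CodeSeq.decodeK m; case: (CodeSeq.decode m) => [|a s] e.
  by rewrite -e in m0.
by exists a, (CodeSeq.code s); rewrite -[LHS]e.
Qed.

Definition word_picture (X : nat -> bool) (v : nat * nat) : option bool :=
  if (v.1 == 0) || (v.2 == 0) then None else Some ((v.2 == 1) && X v.1).

Lemma word_picture_picture X : pictures (word_picture X).
Proof.
by split=> [i|[|i] [|j]] //; rewrite /word_picture eqxx ?orbT.
Qed.

Lemma input_word_picture X : X 0 = false -> input_word (word_picture X) = X.
Proof.
move=> X0; apply/funext => i; rewrite /input_word /word_picture /= orbF.
by case: i => [|i] /=; [rewrite X0|case: (X i.+1)].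
Qed.

(** [N] may depend on the point, so a condition may look at a position that is itself a value of
    [y]. *)
Lemma closed2_forall (P : nat -> (nat -> bool) -> (nat -> nat) -> Prop) :
  (forall k h y, exists N, forall h' y', agree N h h' -> agree N y y' ->
     P k h' y' -> P k h y) ->
  closed2 (fun h y => forall k, P k h y).
Proof.
move=> hP h y hk k; have [N hN] := hP k h y.
by have [h' [y' [a b c]]] := hk N; apply: hN a b (c k).
Qed.

Section Unambiguous.
Variables (Q : finType) (A : buchi_system Q bool).
Hypothesis unambA : unambiguous_system A.
Variable X : (nat -> bool) -> nat -> bool.
Hypothesis X_cont : forall i, exists N, forall h h', agree N h h' -> X h i = X h' i.

Let rank (q : Q) : nat := enum_rank q.

Lemma rank_inj : injective rank.
Proof. by move=> q r /val_inj /enum_rank_inj. Qed.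

Lemma rank_lt q : rank q < #|Q|.
Proof. exact: ltn_ord. Qed.

Let pos (v : nat * nat) : nat := pair_code v.1 v.2.

Lemma pos_inj : injective pos.
Proof. by move=> [a b] [a' b'] /pair_code_inj /= [-> ->]. Qed.

Lemma pos_surj m : 0 < m -> exists v, m = pos v.
Proof. by move=> /pair_code_surj [a [b ->]]; exists (a, b). Qed.

(* [y] codes an accepting run: at [(pos v).*2] the rank of the state at [v],
   at [k.*2.+1] the first final position from [k] on. *)
Let run_code (ij : nat) (h : nat -> bool) (y : nat -> nat) : Prop :=
  let i := unpair1 ij in let j := unpair2 ij in
  let p := word_picture (X h) in
  exists q1 q2 q3 q4 : Q,
    [/\ y (pos (i, j.+1)).*2 = rank q1, y (pos (i.+1, j.+1)).*2 = rank q2,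
        y (pos (i, j)).*2 = rank q3 & y (pos (i.+1, j)).*2 = rank q4] /\
    ((p (i, j.+1), q1), (p (i.+1, j.+1), q2), (p (i, j), q3), (p (i.+1, j), q4))
      \in tiles A.

Let final_at (y : nat -> nat) (m : nat) : Prop :=
  exists2 q, q \in final A & y m.*2 = rank q.

(** Naming a final position beyond each [k] makes the Büchi condition closed; asking for the first
    one makes it unique. *)
Let final_code (k : nat) (y : nat -> nat) : Prop :=
  [/\ k <= y k.*2.+1, final_at y (y k.*2.+1) &
      forall m, k <= m < y k.*2.+1 -> ~ final_at y m].

(** Position 0 codes no cell, so [y 0] is fixed to keep codes unique; [#|Q|] is the rank of no
    state, so 0 never counts as final. *)
Let code k h y := [/\ run_code k h y, final_code k y & y 0 = #|Q|].

Lemma code_closed : closed2 (fun h y => forall k, code k h y).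
Proof.
apply: closed2_forall => k h y.
set i := unpair1 k; set j := unpair2 k.
have [N1 hN1] := X_cont i; have [N2 hN2] := X_cont i.+1.
pose m := (pos (i, j.+1)).*2 + (pos (i.+1, j.+1)).*2 + (pos (i, j)).*2
   + (pos (i.+1, j)).*2.
(* Covers the two columns of the word, the four states of the tile, the entry [k.*2.+1], all states
   up to the position it names, and entry 0. *)
exists (N1 + N2 + m + k.*2 + (y k.*2.+1).*2 + 2) => h' y' ah ay.
move=> [[q1 [q2 [q3 [q4 [[e1 e2 e3 e4] ht]]]]] [f1 f2 f3] e0].
have ey : y' k.*2.+1 = y k.*2.+1 by rewrite ay //; lia.
have efin l : l <= y k.*2.+1 -> final_at y' l -> final_at y l.
  by move=> hl [q qf e]; exists q => //; rewrite ay //; lia.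
have efin' l : l <= y k.*2.+1 -> final_at y l -> final_at y' l.
  by move=> hl [q qf e]; exists q => //; rewrite -ay //; lia.
split; last by rewrite ay //; lia.
  exists q1, q2, q3, q4; split.
    rewrite -/i -/j in e1 e2 e3 e4 *.
    by split; rewrite ay //; rewrite /m; lia.
  move: ht; rewrite /word_picture /= -/i -/j.
  rewrite (hN1 h h') ?(hN2 h h') //; apply: agree_le ah; lia.
split; first by rewrite -ey.
  by apply: efin => //; rewrite -ey.
move=> l hl /efin' h1; apply: (f3 l); first by rewrite ey.
by apply: h1; case/andP: hl => _ /ltnW.
Qed.

Lemma code_run h y : (forall k, code k h y) -> exists rho,
  accepting_runs A (word_picture (X h)) rho /\ forall v, y (pos v).*2 = rank (rho v).
Proof.
move=> hc; have /choice [rho hrho] : forall v, exists q, y (pos v).*2 = rank q.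
  move=> [i j]; have [[q1 [q2 [q3 [q4 [[_ _ e _] _]]]]] _ _] := hc (pair_code i j).
  by exists q3; rewrite -e unpair1K unpair2K.
exists rho; split=> //; split.
  move=> i j; have [[q1 [q2 [q3 [q4 [[e1 e2 e3 e4] ht]]]]] _ _] := hc (pair_code i j).
  move: e1 e2 e3 e4 ht; rewrite unpair1K unpair2K !hrho.
  by do 4 move=> /rank_inj <-.
move=> /finite_seqP [s hs].
pose k := (\max_(v <- s) pos v).+1.
have [_ [f1 [q qf e] _] y0] := hc k.
have [v ev] : exists v, y k.*2.+1 = pos v by apply: pos_surj; apply: leq_trans f1.
rewrite ev hrho in e; have {e} e := rank_inj e.
have vs : v \in s.
  suff : [set` s] v by [].
  by rewrite -hs /= e.
have := @leq_bigmax_seq _ s predT pos _ vs isT.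
by rewrite -ev => /= /(leq_trans f1); rewrite ltnn.
Qed.

Lemma final_at_pos y rho : y 0 = #|Q| -> (forall v, y (pos v).*2 = rank (rho v)) ->
  forall m, final_at y m <-> exists2 v, m = pos v & rho v \in final A.
Proof.
move=> y0 hy m; split=> [[q qf e]|[v -> vf]]; last by exists (rho v).
have m0 : 0 < m.
  by case: m e => // e; have := rank_lt q; rewrite -e y0 ltnn.
have [v ev] := pos_surj m0; exists v => //.
by rewrite ev hy in e; rewrite (rank_inj e).
Qed.

(** Unambiguity identifies the two runs, and a run determines its first final positions. *)
Lemma code_inj h y z : (forall k, code k h y) -> (forall k, code k h z) -> y = z.
Proof.
move=> hy hz; have [rho [accy ey]] := code_run hy.
have [rho' [accz ez]] := code_run hz.
have er : rho = rho' by apply: (unambA (word_picture_picture (X h))).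
subst rho'; have [_ _ y0] := hy 0; have [_ _ z0] := hz 0.
apply/funext => n; rewrite -(odd_double_half n); case: (odd n); last first.
  rewrite add0n; case: (posnP n./2) => [->|/pos_surj [v ->]].
    by rewrite y0 z0.
  by rewrite ey ez.
rewrite add1n; set k := n./2.
have [_ [fy1 fy2 fy3] _] := hy k; have [_ [fz1 fz2 fz3] _] := hz k.
have eq m : final_at y m <-> final_at z m.
  by rewrite (final_at_pos y0 ey) (final_at_pos z0 ez).
case: (ltngtP (y k.*2.+1) (z k.*2.+1)) => // lt.
  by case: (fz3 (y k.*2.+1)); [rewrite fy1|apply/eq].
by case: (fy3 (z k.*2.+1)); [rewrite fz1|apply/eq].
Qed.

Lemma run_has_code h rho : accepting_runs A (word_picture (X h)) rho ->
  exists y, forall k, code k h y.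
Proof.
move=> [hrun hinf].
have ex k : exists m, (k <= m) && `[< exists2 v, m = pos v & rho v \in final A >].
  apply: contrapT => hn; apply: hinf.
  apply: (@sub_finite_set _ _ (pos @^-1` `I_k)); last first.
    apply: finite_preimage; [|exact: finite_II].
    by move=> v w _ _; apply: pos_inj.
  move=> v vf /=; rewrite ltnNge; apply/negP => kv; apply: hn.
  by exists (pos v); rewrite kv; apply/asboolP; exists v.
pose y n := if odd n then ex_minn (ex n./2)
  else if n == 0 then #|Q| else rank (rho (unpair1 n./2, unpair2 n./2)).
have ye v : y (pos v).*2 = rank (rho v).
  rewrite /y odd_double doubleK double_eq0 eqn0Ngt pair_code_gt0 /=.
  by rewrite unpair1K unpair2K; case: v.
have y0 : y 0 = #|Q| by [].
exists y => k; split=> //.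
  exists (rho (unpair1 k, (unpair2 k).+1)), (rho ((unpair1 k).+1, (unpair2 k).+1)),
    (rho (unpair1 k, unpair2 k)), (rho ((unpair1 k).+1, unpair2 k)).
  by split; [rewrite !ye|apply: hrun].
have ym : y k.*2.+1 = ex_minn (ex k) by rewrite /y /= odd_double /= uphalf_double.
rewrite /final_code ym; case: ex_minnP => m /andP [km /asboolP fm] hm; split=> //.
  exact/(final_at_pos y0 ye).
move=> l /andP [kl lm] /(final_at_pos y0 ye) fl.
by have := hm l; rewrite kl leqNgt lm; case: asboolP => // _ /(_ isT).
Qed.

Lemma unambiguous_coanalytic :
  analytic (fun h => ~ buchi_language A (word_picture (X h))).
Proof.
have := lusin_souslin code_closed code_inj; apply: analytic_ext => h.
rewrite /buchi_language /=; split=> hn.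
  by move=> [_ [rho /run_has_code]].
move=> [y /code_run [rho [hrho _]]]; apply: hn; split; last by exists rho.
exact: word_picture_picture.
Qed.

End Unambiguous.

Lemma code_point_cont f i : exists N, forall h h', agree N h h' ->
  code_point f h i = code_point f h' i.
Proof.
exists i.+1 => h h' hh; rewrite /code_point; case: ifP => // _.
by congr (_ && _); apply: hh; rewrite ltnS; lia.
Qed.

Theorem Pi2_hard (B : set nat) : Pi1 2 B ->
  exists S : nat -> numbered_system,
  [/\ @recfun 0 1 (fun _ v => system_code (S (nth 0 v 0))),
      injective (fun x => system_code (S x)) &
      forall x, B x <-> unambiguous_language (buchi_language (projT2 (S x)))].
Proof.
move=> /Pi2_normal_form [M [M_rec hB]].
have [c hc] := bit_oracle_form (hard_relation_rec M_rec).
have [R hR] := regs_lt_loop_exists c.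
exists (fun x => existT (fun n => buchi_system 'I_n bool) _ (reduction_system c R x)).
split.
- exact: recfun_reduction_system_code.
- exact: reduction_system_code_inj.
move=> x.
have hL p : buchi_language (reduction_system c R x) p <->
    pictures p /\ hard M (input_word p) x.
  rewrite /buchi_language /=; split=> [[hp]|[hp h]].
    by rewrite (reduction_systemP hR x hp) => /hc h.
  by split=> //; apply/(reduction_systemP hR x hp)/hc.
split=> [bx|[Q [A [eL unA]]]].
  (* All pictures are accepted, and a single state leaves room for one run only. *)
  exists unit, (BuchiSystem [set: tile unit bool]%SET [set: unit]%SET); split.
    apply/seteqP; split=> p; first move=> /hL [hp _]; last first.
      by move=> [hp _]; apply/hL; split=> //; apply: (hard_of_mem hB bx).
    split=> //; exists (fun=> tt); split; first by move=> i j; rewrite inE.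
    have -> : [set v : nat * nat | tt \in [set: unit]%SET] = setT.
      by apply/seteqP; split=> v //= _; rewrite inE.
    move=> /= hfin; apply: infinite_nat.
    have := finite_image fst hfin; apply: sub_finite_set => i _.
    by exists (i, 0).
  by move=> p _ r r' _ _; apply/funext => v; case: (r v); case: (r' v).
(* On the pictures of [code_point f h] the language is [diag], whose complement would be
   analytic. *)
apply: contrapT => /(hard_of_notin hB) [f hf].
apply: diag_not_coanalytic.
have := unambiguous_coanalytic unA (code_point_cont f).
apply: analytic_ext => h; rewrite -hf.
have X0 : code_point f h 0 = false by [].
have eA : buchi_language A (word_picture (code_point f h)) <->
    hard M (code_point f h) x.
  rewrite -eL -/(buchi_language _ _) hL input_word_picture //.
  by split=> [[]|] // hh; split=> //; apply: word_picture_picture.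
by rewrite eA.
Qed.

(** * Upper bound *)

(** Every triple of numbers decodes to a system, so number quantifiers range over all systems
    without a test of validity. *)
Definition decoded_system (n t f : nat) : buchi_system 'I_n bool :=
  BuchiSystem [set u | bit t (tile_code u)] [set q : 'I_n | bit f q].

Lemma decoded_systemK n (A : buchi_system 'I_n bool) :
  A = decoded_system n (\sum_(t in tiles A) 2 ^ tile_code t)
                       (\sum_(q in final A) 2 ^ nat_of_ord q).
Proof.
case: A => A F; rewrite /decoded_system; congr BuchiSystem; apply/setP => t.
  by rewrite inE bit_canonical_index //; apply: tile_code_inj.
by rewrite inE bit_canonical_index //; apply: ord_inj.
Qed.

Section Transport.
Variables (Q Q' : finType) (A : buchi_system Q bool) (e : Q' -> Q) (e' : Q -> Q').
Hypotheses (eK : cancel e e') (e'K : cancel e' e).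

Definition map_tile (u : tile Q' bool) : tile Q bool :=
  let: ((s1, q1), (s2, q2), (s3, q3), (s4, q4)) := u in
  ((s1, e q1), (s2, e q2), (s3, e q3), (s4, e q4)).

Definition transport_system : buchi_system Q' bool :=
  BuchiSystem [set u | map_tile u \in tiles A] [set q | e q \in final A].

Lemma transport_runs p rho :
  accepting_runs transport_system p rho <-> accepting_runs A p (e \o rho).
Proof.
rewrite /accepting_runs /=.
have -> : [set v | rho v \in [set q | e q \in final A]%SET] =
   [set v | (e \o rho) v \in final A] by apply/seteqP; split=> v /=; rewrite inE.
by split=> -[h hi]; split=> // i j; have := h i j; rewrite inE.
Qed.

Lemma transport_language : buchi_language transport_system = buchi_language A.
Proof.
apply/seteqP; split=> p [hp [rho hrho]]; split=> //.
  by exists (e \o rho); apply/transport_runs.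
exists (e' \o rho); apply/transport_runs.
by have -> : e \o (e' \o rho) = rho by apply/funext => v /=; rewrite e'K.
Qed.

Lemma transport_unambiguous : unambiguous_system A -> unambiguous_system transport_system.
Proof.
move=> h p hp r r' /transport_runs h1 /transport_runs h2.
have er := h p hp _ _ h1 h2; apply/funext => v.
by apply: (can_inj eK); rewrite -[LHS]/((e \o r) v) er.
Qed.

End Transport.

Lemma unambiguous_languageP (L : set (nat * nat -> option bool)) :
  unambiguous_language L <-> exists n t f,
    L = buchi_language (decoded_system n t f) /\
    unambiguous_system (decoded_system n t f).
Proof.
split=> [[Q [A [-> hA]]]|[n [t [f h]]]]; last by exists 'I_n, (decoded_system n t f).
have h1 := transport_language A (@enum_rankK Q) .
have h2 := transport_unambiguous (@enum_valK Q) hA.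
set A' := transport_system A _ in h1 h2.
exists #|Q|, (\sum_(t in tiles A') 2 ^ tile_code t),
  (\sum_(q in final A') 2 ^ nat_of_ord q).
by rewrite -decoded_systemK h1.
Qed.

Definition codes_picture (P : nat -> nat) (p : nat * nat -> option bool) :=
  forall i j, P (pair_code i j) = letter_code (p (i, j)).

Definition codes_run n (S : nat -> nat) (rho : nat * nat -> 'I_n) :=
  forall i j, S (pair_code i j) = rho (i, j).

(* [h] witnesses the Buchi condition: for every [i] there is a final cell
   [(a, b)] with [i <= a + b], namely [a = h i.*2] and [b = h i.*2.+1]. *)
Definition check (n t f : nat) (P S h : nat -> nat) (i j : nat) : bool :=
  [&& P (pair_code i j) <= 2,
      (P (pair_code i j) == 0 : nat) == ((i == 0) || (j == 0)),
      S (pair_code i j) < n,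
      bit t (CodeSeq.code
        [:: P (pair_code i j.+1); S (pair_code i j.+1);
            P (pair_code i.+1 j.+1); S (pair_code i.+1 j.+1);
            P (pair_code i j); S (pair_code i j);
            P (pair_code i.+1 j); S (pair_code i.+1 j)]),
      i <= h i.*2 + h i.*2.+1 &
      bit f (S (pair_code (h i.*2) (h i.*2.+1)))].

Lemma check_sound n t f P S h : (forall i j, check n t f P S h i j) ->
  exists p rho, [/\ codes_picture P p, @codes_run n S rho, pictures p &
    accepting_runs (decoded_system n t f) p rho].
Proof.
move=> hc.
have hS i j : S (pair_code i j) < n by have /and5P [] := hc i j.
pose rho (v : nat * nat) : 'I_n := Ordinal (hS v.1 v.2).
pose p (v : nat * nat) := let x := P (pair_code v.1 v.2) in
  if x == 0 then None else Some (x == 2).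
have hp : codes_picture P p.
  move=> i j; rewrite /p /=; have /andP [] := hc i j.
  by case: (P _) => [|[|[|]]].
have hr : codes_run S rho by [].
exists p, rho; split=> //.
  have hb i j : (P (pair_code i j) == 0) = (i == 0) || (j == 0).
    by have /and5P [_ + _ _ _] := hc i j; case: (P _ == 0); case: (_ || _).
  by split=> [i|i j i0 j0]; rewrite /p /= !hb ?orbT // (gtn_eqF i0) (gtn_eqF j0).
split.
  move=> i j; rewrite inE /tile_code -!hp -!hr.
  by have /and5P [_ _ _ h1 _] := hc i j.
move=> /finite_seqP [s hs].
pose k := (\max_(v <- s) (v.1 + v.2)).+1.
have /and5P [_ _ _ _ /andP [h1 h2]] := hc k 0.
have vs : (h k.*2, h k.*2.+1) \in s.
  suff : [set` s] (h k.*2, h k.*2.+1) by [].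
  by rewrite -hs /= inE.
have := @leq_bigmax_seq _ s predT (fun v => v.1 + v.2) _ vs isT.
by move=> /(leq_trans h1); rewrite ltnn.
Qed.

Lemma check_complete n t f P S p rho : codes_picture P p -> @codes_run n S rho ->
  pictures p -> accepting_runs (decoded_system n t f) p rho ->
  exists h, forall i j, check n t f P S h i j.
Proof.
move=> hP hS hp [hrun hinf].
have /choice [v hv] : forall k, exists v : nat * nat,
    k <= v.1 + v.2 /\ rho v \in final (decoded_system n t f).
  move=> k; apply: contrapT => hn; apply: hinf.
  apply: (@sub_finite_set _ _ (`I_k.+1 `*` `I_k.+1)); last exact: finite_setX.
  move=> v /= vf; have lt : v.1 + v.2 < k.
    by rewrite ltnNge; apply/negP => kv; apply: hn; exists v.
  by split; rewrite /=; lia.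
exists (fun x => if odd x then (v x./2).2 else (v x./2).1) => i j.
rewrite /check /= odd_double doubleK /= uphalf_double !hP.
apply/and5P; split.
- by case: (p _) => [[]|].
- have := pictureE i j hp; case: (p _) => [b|] /= <- //.
- by rewrite hS.
- by have := hrun i j; rewrite inE /tile_code -!hP -!hS !hP.
- have [h1 h2] := hv i; rewrite h1 /=; move: h2; rewrite inE.
  by case: (v i) => a b; rewrite hS.
Qed.

Section Matrix.
Variable code : nat -> nat.
Hypothesis code_rec : @recfun 0 1 (fun _ v => code (nth 0 v 0)).

(** Each quantifier puts its variable in front, so indices run backwards: [F 6] to [F 0] are the
    picture, two runs, their two witnesses, then the answering run and its witness; [x 11] is the
    index, [x 10] to [x 8] and [x 7] to [x 5] the two systems. [x 4] selects unambiguity or one of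
    the two inclusions. *)
Definition upper_matrix : relation 7 12 := fun fs v =>
  let F k := nth (fun=> 0) fs k in let x k := nth 0 v k in
  (CodeSeq.code [:: x 10; x 9; x 8] == code (x 11)) &&
  (if x 4 == 0 then
     (check (x 7) (x 6) (x 5) (F 6) (F 5) (F 3) (x 3) (x 2) &&
      check (x 7) (x 6) (x 5) (F 6) (F 4) (F 2) (x 3) (x 2)) ==>
     (F 5 (pair_code (x 1) (x 0)) == F 4 (pair_code (x 1) (x 0)))
   else if x 4 == 1 then
     check (x 10) (x 9) (x 8) (F 6) (F 5) (F 3) (x 3) (x 2) ==>
     check (x 7) (x 6) (x 5) (F 6) (F 1) (F 0) (x 1) (x 0)
   else
     check (x 7) (x 6) (x 5) (F 6) (F 5) (F 3) (x 3) (x 2) ==>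
     check (x 10) (x 9) (x 8) (F 6) (F 1) (F 0) (x 1) (x 0)).

Lemma recfun_check m n (a b c : nat)
    (N T F I J : m.-tuple (nat -> nat) -> n.-tuple nat -> nat) :
  a < m -> b < m -> c < m ->
  recfun N -> recfun T -> recfun F -> recfun I -> recfun J ->
  recfun (fun fs v => check (N fs v) (T fs v) (F fs v) (nth (fun=> 0) fs a)
    (nth (fun=> 0) fs b) (nth (fun=> 0) fs c) (I fs v) (J fs v) : nat).
Proof.
move=> ha hb hc hN hT hF hI hJ; rewrite /check.
have hI' := recfun_succ hI; have hJ' := recfun_succ hJ.
have hp F1 F2 : recfun F1 -> recfun F2 ->
    recfun (fun (fs : m.-tuple _) (v : n.-tuple _) =>
      nth (fun=> 0) fs a (pair_code (F1 fs v) (F2 fs v))).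
  by move=> h1 h2; apply: recfun_oracle => //; apply: recfun_pair_code.
have hs F1 F2 : recfun F1 -> recfun F2 ->
    recfun (fun (fs : m.-tuple _) (v : n.-tuple _) =>
      nth (fun=> 0) fs b (pair_code (F1 fs v) (F2 fs v))).
  by move=> h1 h2; apply: recfun_oracle => //; apply: recfun_pair_code.
have hh0 : recfun (fun fs v => nth (fun=> 0) fs c (I fs v).*2).
  by apply: recfun_oracle => //; apply: recfun_double.
have hh1 : recfun (fun fs v => nth (fun=> 0) fs c (I fs v).*2.+1).
  by apply: recfun_oracle => //; apply: recfun_succ; apply: recfun_double.
apply: recfun_and; first by apply: recfun_leq; [apply: (hp)|apply: recfun_const].
apply: recfun_and.
  apply: recfun_eq.
    by apply: recfun_eq; [apply: (hp)|apply: recfun_const].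
  by apply: recfun_orb; (apply: recfun_eq; [|apply: recfun_const]).
apply: recfun_and; first by apply: recfun_leq; [apply: recfun_succ; apply: (hs)|].
apply: recfun_and.
  apply: recfun_bit => //.
  repeat (apply: recfun_pair_code);
    by first [exact: (hp)|exact: (hs)|exact: recfun_const].
apply: recfun_and; first by apply: recfun_leq => //; apply: recfun_add.
by apply: recfun_bit => //; apply: (hs).
Qed.

Lemma upper_matrix_rec : recursive_relation upper_matrix.
Proof.
apply/recursive_relationE.
have hx k : k < 12 -> @recfun 7 12 (fun fs v => nth 0 v k) by apply: recfun_nth.
apply: (recfun_ext (F := fun fs v => 
  let F k := nth (fun=> 0) fs k in let x k := nth 0 v k in
  ((CodeSeq.code [:: x 10; x 9; x 8] == code (x 11)) &&
  (if x 4 == 0 then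
     (check (x 7) (x 6) (x 5) (F 6) (F 5) (F 3) (x 3) (x 2) &&
      check (x 7) (x 6) (x 5) (F 6) (F 4) (F 2) (x 3) (x 2)) ==>
     (F 5 (pair_code (x 1) (x 0)) == F 4 (pair_code (x 1) (x 0)))
   else if x 4 == 1 then
     check (x 10) (x 9) (x 8) (F 6) (F 5) (F 3) (x 3) (x 2) ==>
     check (x 7) (x 6) (x 5) (F 6) (F 1) (F 0) (x 1) (x 0)
   else
     check (x 7) (x 6) (x 5) (F 6) (F 5) (F 3) (x 3) (x 2) ==>
     check (x 10) (x 9) (x 8) (F 6) (F 1) (F 0) (x 1) (x 0))) : nat)).
  by move=> fs v; congr nat_of_bool; apply/idP/asboolP.
rewrite /=.
apply: recfun_and.
  apply: recfun_eq.
    by repeat (apply: recfun_pair_code); first [exact: hx|exact: recfun_const].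
  apply: (recfun_subst (hs := fun _ _ => [tuple])
    (ws := fun _ v => [tuple nth 0 v 11])) code_rec _ _.
    by case.
  by move=> j; apply: (recfun_ext _ (hx 11 isT)) => fs v; rewrite ord1.
apply: recfun_ifb.
- by apply: recfun_eq; [apply: hx|apply: recfun_const].
- apply: recfun_imp; first by apply: recfun_and; apply: recfun_check; try apply: hx.
  by apply: recfun_eq; apply: recfun_oracle => //; apply: recfun_pair_code; apply: hx.
apply: recfun_ifb; first by apply: recfun_eq; [apply: hx|apply: recfun_const].
- by apply: recfun_imp; apply: recfun_check; try apply: hx.
- by apply: recfun_imp; apply: recfun_check; try apply: hx.
Qed.

End Matrix.

(** The unambiguous system is guessed by numbers and so costs no function quantifier; the universal
    number after it merges three conditions into one matrix. *)
Definition upper_prefix : seq quantifier :=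
  [:: ExNum; ExNum; ExNum; ExNum; ExNum; ExNum; AllNum;
      AllFun; AllFun; AllFun; AllFun; AllFun; ExFun; ExFun;
      ExNum; ExNum; AllNum; AllNum].

Lemma codes_picture_exists p : exists P, codes_picture P p.
Proof.
exists (fun m => letter_code (p (unpair1 m, unpair2 m))) => i j.
by rewrite unpair1K unpair2K.
Qed.

Lemma codes_run_exists n rho : exists S, @codes_run n S rho.
Proof.
exists (fun m => nat_of_ord (rho (unpair1 m, unpair2 m))) => i j.
by rewrite unpair1K unpair2K.
Qed.

Lemma codes_picture_inj P p p' : codes_picture P p -> codes_picture P p' -> p = p'.
Proof.
by move=> h h'; apply/funext => -[i j]; apply: letter_code_inj; rewrite -h.
Qed.

Lemma Pi2_unambiguous (T : nat -> numbered_system) : effective_enumeration T ->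
  Pi1 2 [set z | unambiguous_language (buchi_language (projT2 (T z)))].
Proof.
move=> [/recfun_computable hT _].
pose code z := system_code (T z).
have [R [hR eR]] : exists R : relation 0 1, predicate_form upper_prefix R /\
  forall z, R [tuple] [tuple z] <-> exists n t f n' t' f', forall s,
    forall P S1 S2 h1 h2, exists S h i j, forall i' j',
    (CodeSeq.code [:: n; t; f] == code z) &&
    (if s == 0 then
       check n' t' f' P S1 h1 i j && check n' t' f' P S2 h2 i j ==>
       (S1 (pair_code i' j') == S2 (pair_code i' j'))
     else if s == 1 then
       check n t f P S1 h1 i j ==> check n' t' f' P S h i' j'
     else check n' t' f' P S1 h1 i j ==> check n t f P S h i' j').
  rewrite /upper_prefix; eexists; split.
    by do 19 constructor; exact: (upper_matrix_rec hT).
  by move=> z; split.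
exists upper_prefix, R; split=> //; apply/seteqP; split=> z; rewrite [X in X -> _]/=.
  move=> /unambiguous_languageP [n' [t' [f' [eL unA]]]]; apply/eR.
  have [n [t [f [ecode eA]]]] : exists n t f, CodeSeq.code [:: n; t; f] = code z /\
      buchi_language (projT2 (T z)) = buchi_language (decoded_system n t f).
    rewrite /code; case: (T z) => n A; exists n, (\sum_(t in tiles A) 2 ^ tile_code t),
      (\sum_(q in final A) 2 ^ nat_of_ord q); split=> //=.
    by rewrite -decoded_systemK.
  exists n, t, f, n', t', f' => s P S1 S2 h1 h2; rewrite ecode eqxx /=.
  (* If the premise fails, it fails at some [i], [j]: this is what the two existential number
     quantifiers are for. Otherwise the checks decode to a picture and a run, and the other system
     has a run as well. *)
  have half k l m k' l' m' : buchi_language (decoded_system k l m) =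
      buchi_language (decoded_system k' l' m') -> exists S h i j, forall i' j',
      check k l m P S1 h1 i j ==> check k' l' m' P S h i' j'.
    move=> e; case: (pselect (forall i j, check k l m P S1 h1 i j)) => hc.
      have [p [rho [hP hS hp hrun]]] := check_sound hc.
      have : buchi_language (decoded_system k l m) p by split=> //; exists rho.
      rewrite e => -[_ [rho' hrun']]; have [S hS'] := codes_run_exists rho'.
      have [h hh] := check_complete hP hS' hp hrun'.
      by exists S, h, 0, 0 => i' j'; apply/implyP.
    move/existsNP: hc => [i /existsNP [j /negP/negbTE hc]].
    by exists S1, h1, i, j => i' j'; rewrite hc.
  case: (s == 0); last first.
    by case: (s == 1); apply: half; rewrite -eL -eA.
  exists id, id.
  case: (pselect (forall i j,
    check n' t' f' P S1 h1 i j /\ check n' t' f' P S2 h2 i j)) => hc.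
    have [p [rho [hP hS hp hrun]]] := check_sound (fun i j => proj1 (hc i j)).
    have [p' [rho' [hP' hS' hp' hrun']]] := check_sound (fun i j => proj2 (hc i j)).
    have ep := codes_picture_inj hP hP'; subst p'.
    have er := unA p hp _ _ hrun hrun'; subst rho'.
    by exists 0, 0 => i' j'; apply/implyP => _; rewrite hS hS'.
  move/existsNP: hc => [i /existsNP [j hc]]; exists i, j => i' j'.
  by apply/implyP => /andP hc'.
move=> /eR [n [t [f [n' [t' [f' H]]]]]].
have ecode : CodeSeq.code [:: n; t; f] = code z.
  (* The equation of codes does not involve the functions, so any instance yields it. *)
  by have [S [h [i [j /(_ 0 0) /andP [/eqP]]]]] := H 0 id id id id id.
have eA : buchi_language (projT2 (T z)) = buchi_language (decoded_system n t f).
  move: ecode; rewrite /code; case: (T z) => k A /(can_inj CodeSeq.codeK) [ek et ef].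
  by subst k; rewrite /= [A in LHS]decoded_systemK et ef.
have half k l m k' l' m' : (forall P S1 h1, exists S h i j, forall i' j',
      check k l m P S1 h1 i j ==> check k' l' m' P S h i' j') ->
    buchi_language (decoded_system k l m) `<=` buchi_language (decoded_system k' l' m').
  move=> hc p [hp [rho hrho]].
  have [P hP] := codes_picture_exists p; have [S1 hS1] := codes_run_exists rho.
  have [h1 hh1] := check_complete hP hS1 hp hrho.
  have [S [h [i [j hij]]]] := hc P S1 h1.
  have [|p' [rho' [hP' hS hp' hrun]]] := @check_sound k' l' m' P S h.
    by move=> i' j'; have := hij i' j'; rewrite hh1.
  by rewrite (codes_picture_inj hP hP'); split=> //; exists rho'.
apply/unambiguous_languageP; exists n', t', f'; split.
  rewrite eA; apply/seteqP; split; apply: half => P S1 h1.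
    have [S [h [i [j hij]]]] := H 1 P S1 S1 h1 h1.
    by exists S, h, i, j => i' j'; have /andP [] := hij i' j'.
  have [S [h [i [j hij]]]] := H 2 P S1 S1 h1 h1.
  by exists S, h, i, j => i' j'; have /andP [] := hij i' j'.
move=> p hp r1 r2 hr1 hr2.
have [P hP] := codes_picture_exists p.
have [S1 hS1] := codes_run_exists r1; have [S2 hS2] := codes_run_exists r2.
have [h1 hh1] := check_complete hP hS1 hp hr1.
have [h2 hh2] := check_complete hP hS2 hp hr2.
have [S [h [i [j hij]]]] := H 0 P S1 S2 h1 h2.
apply/funext => -[i' j']; apply: val_inj => /=.
have /andP [_] := hij i' j'; rewrite /= hh1 hh2 /= => /eqP.
by rewrite hS1 hS2.
Qed.

Theorem theorem4p12 (T : nat -> numbered_system)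
    (hT : effective_enumeration T) :
  Pi1_complete 2
    [set z | unambiguous_language (buchi_language (projT2 (T z)))].
Proof.
split=> [|B /Pi2_hard [S [recS injS hS]]]; first exact: Pi2_unambiguous.
apply: one_reducible_systems hT recS injS _ => x z /system_code_language e.
by rewrite hS -e.
Qed.
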